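(* Let $s\in(0,1)$, $p>2$, and let $\Omega\subset\mathbb{R}^n$ be a bounded domain satisfying the uniform interior ball condition. Let $u\in C^{1,1}_{loc}(\Omega)\cap\mathcal{L}_{sp}(\mathbb{R}^n)$ be lower semicontinuous in $\overline{\Omega}$, let $c:\Omega\to\mathbb{R}$ be a bounded function with $c(x)\geq 0$, and assume that pointwise $$\begin{cases}(-\Delta)^s_p u(x)+c(x)u(x)\geq 0, & x\in\Omega,\\ u(x)>0, & x\in\Omega,\\ u(x)=0, & x\in\mathbb{R}^n\setminus\Omega.\end{cases}$$ Then there exists a constant $C=C(\Omega,u)>0$ such that $$\liminf_{x\to\partial\Omega}\frac{u(x)}{[\mathrm{dist}(x,\partial\Omega)]^s}\geq C,$$ where the liminf is taken over $x\in\Omega$ with $\mathrm{dist}(x,\partial\Omega)\to0$.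
   Context: The fractional $p$-Laplacian is defined pointwise by $$(-\Delta)^s_p u(x)=C_{n,s,p}\,\mathrm{P.V.}\int_{\mathbb{R}^n}\frac{|u(x)-u(y)|^{p-2}[u(x)-u(y)]}{|x-y|^{n+sp}}\,dy = C_{n,s,p}\lim_{\epsilon\to0^+}\int_{\mathbb{R}^n\setminus B_\epsilon(x)}\frac{|u(x)-u(y)|^{p-2}[u(x)-u(y)]}{|x-y|^{n+sp}}\,dy,$$ where $C_{n,s,p}>0$ is a constant depending only on $n,s,p$. The space $\mathcal{L}_{sp}=\mathcal{L}_{sp}(\mathbb{R}^n)$ is $$\mathcal{L}_{sp}=\left\{u\in L^{p-1}_{loc}(\mathbb{R}^n)\ :\ \int_{\mathbb{R}^n}\frac{|1+u(x)|^{p-1}}{1+|x|^{n+sp}}\,dx<\infty\right\}.$$ $C^{1,1}_{loc}(\Omega)$ is the space of functions that are continuously differentiable in $\Omega$ with locally Lipschitz gradient in $\Omega$; functions are defined pointwise on all of $\mathbb{R}^n$. The uniform interior ball condition for $\Omega$ means: there is a radius $R>0$ such that for every $z\in\partial\Omega$ there is an open ball $B\subset\Omega$ of radius $R$ with $z\in\partial B$. *)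

(* Defs.v *)
From HB Require Import structures.
From mathcomp Require Import all_boot all_order all_algebra.
From mathcomp Require Import all_classical all_reals all_analysis.

Set Implicit Arguments.
Unset Strict Implicit.
Unset Printing Implicit Defensive.

Import Order.TTheory GRing.Theory Num.Theory.
Import numFieldTopology.Exports numFieldNormedType.Exports.

Local Open Scope classical_set_scope.
Local Open Scope ring_scope.

(* The library norm on ['rV[R]_n] is the sup norm; its topology is the usual
   one, but balls, distances and kernels below use the Euclidean norm. *)
Definition enorm (R : realType) (n : nat) (x : 'rV[R]_n) : R :=
  Num.sqrt (\sum_(i < n) x 0 i ^+ 2).

Definition eball (R : realType) (n : nat) (x : 'rV[R]_n) (r : R)
  : set 'rV[R]_n := [set y | enorm (x - y) < r].

Definition boundary (T : topologicalType) (A : set T) : set T :=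
  closure A `\` A^°.

Definition dist_set (R : realType) (n : nat) (x : 'rV[R]_n) (A : set 'rV[R]_n)
  : R := inf [set enorm (x - z) | z in A].

(* Borel sigma-algebra of R^n, generated by the coordinate projections, as
   the library does for [n.-tuple]. *)
Fact rV_measure_display : measure_display. Proof. by []. Qed.

Section measurable_rV.
Variables (R : realType) (n : nat).

Let coord (i : 'I_n) (x : 'rV[R]_n) : measurableTypeR R := x 0 i.

Let rV_set0 : g_sigma_preimage coord set0.
Proof. exact: sigma_algebra0. Qed.

Let rV_setC A : g_sigma_preimage coord A -> g_sigma_preimage coord (~` A).
Proof. exact: sigma_algebraC. Qed.

Let rV_bigcup (F : (set 'rV[R]_n)^nat) :
  (forall i, g_sigma_preimage coord (F i)) ->
  g_sigma_preimage coord (\bigcup_i F i).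
Proof. exact: sigma_algebra_bigcup. Qed.

HB.instance Definition _ := @isMeasurable.Build rV_measure_display
  'rV[R]_n (g_sigma_preimage coord) rV_set0 rV_setC rV_bigcup.

Lemma measurable_rV_coord (i : 'I_n) :
  measurable_fun [set: 'rV[R]_n] (fun x => x 0 i : measurableTypeR R).
Proof.
move=> _ Y mY; rewrite setTI; apply: sub_sigma_algebra => /=.
rewrite -bigcup_seq/=; exists i => /=; first by rewrite mem_index_enum.
by exists Y => //; rewrite setTI.
Qed.

Lemma measurable_fun_rV d (T : measurableType d) (f : T -> 'rV[R]_n) :
  (forall i, measurable_fun [set: T] (fun t => f t 0 i : measurableTypeR R)) ->
  measurable_fun [set: T] f.
Proof.
move=> mf _ A mA; rewrite setTI.
have : preimage_set_system [set: T] f (g_sigma_preimage coord) (f @^-1` A).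
  by exists A => //; rewrite setTI.
rewrite -g_sigma_preimage_comp; apply: smallest_sub => //.
  exact: sigma_algebra_measurable.
rewrite -bigcup_seq; apply: bigcup_sub => i _ B [C mC <-]; exact: mf.
Qed.

End measurable_rV.

Definition cons_rV (R : realType) (n : nat)
    (z : measurableTypeR R * 'rV[R]_n) : 'rV[R]_n.+1 :=
  \row_i (if unlift ord0 i is Some j then z.2 0 j else z.1).

Definition uncons_rV (R : realType) (n : nat) (x : 'rV[R]_n.+1)
    : measurableTypeR R * 'rV[R]_n :=
  (x 0 ord0, \row_j x 0 (lift ord0 j)).

Lemma cons_rVK (R : realType) n : cancel (@cons_rV R n) (@uncons_rV R n).
Proof.
move=> [a x]; rewrite /cons_rV /uncons_rV/= mxE unlift_none; congr pair.
by apply/rowP => j; rewrite !mxE liftK.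
Qed.

Lemma measurable_cons_rV (R : realType) n :
  measurable_fun setT (@cons_rV R n).
Proof.
apply: measurable_fun_rV => i; rewrite /cons_rV.
under eq_fun do rewrite mxE.
case: (unlift ord0 i) => [j|]; last exact: measurable_fst.
exact: (measurableT_comp (measurable_rV_coord j) measurable_snd).
Qed.

Lemma measurable_uncons_rV (R : realType) n :
  measurable_fun setT (@uncons_rV R n).
Proof.
apply: measurable_fun_pair; first exact: measurable_rV_coord.
apply: measurable_fun_rV => j.
under eq_fun do rewrite mxE.
exact: measurable_rV_coord.
Qed.

(* n-dimensional Lebesgue measure (on Borel sets), as an iterated product. *)
Fixpoint lebesgue_rV (R : realType) (n : nat) : set 'rV[R]_n -> \bar R :=
  match n return set 'rV[R]_n -> \bar R with
  | 0%N => @dirac _ 'rV[R]_0 (0 : 'rV[R]_0) R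
  | m.+1 => pushforward
      (@product_measure1 _ _ (measurableTypeR R) 'rV[R]_m R
         lebesgue_measure (@lebesgue_rV R m)) (@cons_rV R m)
  end.
Arguments lebesgue_rV : clear implicits.

Lemma product_measure1_sigma_finite d1 d2 (T1 : measurableType d1)
    (T2 : measurableType d2) (R : realType)
    (m1 : {sigma_finite_measure set T1 -> \bar R})
    (m2 : {sigma_finite_measure set T2 -> \bar R}) :
  exists2 m : {measure set (T1 * T2)%type -> \bar R},
    (m1 \x m2)%E = m & sigma_finite setT m.
Proof.
eexists; first exact: erefl.
have /sigma_finiteP[F [TF ndF Foo]] := sigma_finiteT m1.
have /sigma_finiteP[G [TG ndG Goo]] := sigma_finiteT m2.
exists (fun n => F n `*` G n).
  rewrite -setXTT TF TG predeqE => -[x y]; split; last first.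
    by move=> [n _ []/= ? ?]; split; exists n.
  move=> [/= [n _ Fnx] [k _ Gky]]; exists (maxn n k) => //; split.
  - by move: x Fnx; exact/subsetPset/ndF/leq_maxl.
  - by move: y Gky; exact/subsetPset/ndG/leq_maxr.
move=> k; have [? ?] := Foo k; have [? ?] := Goo k.
split; first exact: measurableX.
by rewrite /= product_measure1E// lte_mul_pinfty// ge0_fin_numE.
Qed.

Section lebesgue_rV_measure.
Variable R : realType.

Section cons_step.
Variables (n : nat).
Variable pm : {measure set (measurableTypeR R * 'rV[R]_n)%type -> \bar R}.
Hypothesis pm_sigma_finite : sigma_finite setT pm.

Let map := pushforward pm (@cons_rV R n).

Let mc : measurable_fun setT (@cons_rV R n) := @measurable_cons_rV R n.

Let map0 : map set0 = 0%E.
Proof. by rewrite /map /pushforward preimage_set0 measure0. Qed.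

Let map_ge0 A : (0 <= map A)%E.
Proof. by rewrite /map /pushforward; exact: measure_ge0. Qed.

Let map_sigma_additive : semi_sigma_additive map.
Proof.
exact: measure_semi_sigma_additive.
Qed.

HB.instance Definition _ :=
  isMeasure.Build _ _ _ map map0 map_ge0 map_sigma_additive.

Let map_sigma_finite : sigma_finite setT map.
Proof.
have [F UF mF] := pm_sigma_finite.
exists (fun k => @uncons_rV R n @^-1` F k).
  by rewrite -preimage_bigcup -UF preimage_setT.
move=> k; have [mFk Fk] := mF k; split.
  by rewrite -[X in measurable X]setTI; exact: measurable_uncons_rV.
rewrite /map /pushforward -comp_preimage.
rewrite (_ : _ \o _ = id) //.
by apply/funext => z; exact: cons_rVK.
Qed.

HB.instance Definition _ :=
  Measure_isSigmaFinite.Build _ _ _ map map_sigma_finite.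

Lemma pushforward_cons_rV :
  exists mu : {sigma_finite_measure set 'rV[R]_n.+1 -> \bar R}, map = mu.
Proof. by eexists; exact: erefl. Qed.

End cons_step.

Lemma lebesgue_rV_sigma_finite_measure n :
  exists mu : {sigma_finite_measure set 'rV[R]_n -> \bar R},
    lebesgue_rV R n = mu.
Proof.
elim: n => [|n [mu muE]]; first by exists (@dirac _ 'rV[R]_0 (0 : 'rV[R]_0) R).
have [pm pmE pmsf] := product_measure1_sigma_finite
  (@lebesgue_measure R : {sigma_finite_measure set (measurableTypeR R) -> \bar R})
  mu.
by rewrite /= muE [X in pushforward X]pmE; exact: pushforward_cons_rV.
Qed.

Variable n : nat.

Let leb0 : lebesgue_rV R n set0 = 0%E.
Proof. by have [mu ->] := lebesgue_rV_sigma_finite_measure n. Qed.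

Let leb_ge0 A : (0 <= lebesgue_rV R n A)%E.
Proof. by have [mu ->] := lebesgue_rV_sigma_finite_measure n. Qed.

Let leb_sigma_additive : semi_sigma_additive (lebesgue_rV R n).
Proof.
have [mu ->] := lebesgue_rV_sigma_finite_measure n.
exact: measure_semi_sigma_additive.
Qed.

HB.instance Definition _ := isMeasure.Build _ _ _ (lebesgue_rV R n)
  leb0 leb_ge0 leb_sigma_additive.

Let leb_sigma_finite : sigma_finite setT (lebesgue_rV R n).
Proof.
have [mu ->] := lebesgue_rV_sigma_finite_measure n; exact: sigma_finiteT.
Qed.

HB.instance Definition _ := Measure_isSigmaFinite.Build _ _ _
  (lebesgue_rV R n) leb_sigma_finite.

End lebesgue_rV_measure.

(* Products of Borel sets get the product of the one-dimensional measures. *)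
Lemma lebesgue_rV_box (R : realType) n (A : 'I_n -> set R) :
  (forall i, measurable (A i)) ->
  lebesgue_rV R n [set x | forall i, A i (x 0 i)] =
    (\prod_(i < n) lebesgue_measure (A i))%E.
Proof.
elim: n A => [|n IHn] A mA.
  rewrite (_ : [set x | _] = setT); first by rewrite big_ord0 /= diracT.
  by apply/seteqP; split => // x _ [].
rewrite big_ord_recl -IHn//= /pushforward.
have mB : measurable [set x : 'rV[R]_n | forall i, A (lift ord0 i) (x 0 i)].
  rewrite [X in measurable X](_ : _ =
      \bigcap_(i in [set: 'I_n])
        ((fun x : 'rV[R]_n => x 0 i) @^-1` A (lift ord0 i))).
    apply: fin_bigcap_measurable => // i _.
    rewrite -[X in measurable X]setTI.
    exact: (@measurable_rV_coord R n i measurableT _ (mA _)).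
  by apply/seteqP; split => [x Ax i _|x Ax i]; [exact: (Ax i)|exact: (Ax i I)].
rewrite -product_measure1E; [|exact: mA|exact: mB]; congr (_ _).
apply/seteqP; split => -[a x] /=.
  move=> Ax; split => [|i].
    by have := Ax ord0; rewrite mxE unlift_none.
  by have := Ax (lift ord0 i); rewrite mxE liftK.
move=> [Aa Ax] i; rewrite mxE; case: unliftP => [j ->|->] //.
Qed.

Definition gradient (R : realType) (n : nat) (u : 'rV[R]_n -> R)
    (x : 'rV[R]_n) : 'rV[R]_n := \row_i 'D_(delta_mx 0 i) u x.

(* The Lipschitz condition is for the sup norm, equivalent to the Euclidean one. *)
Definition C11_loc (R : realType) (n : nat) (Omega : set 'rV[R]_n)
    (u : 'rV[R]_n -> R) : Prop :=
  forall x, Omega x ->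
    [/\ differentiable u x,
        {for x, continuous (gradient u)} &
        exists2 V, nbhs x V & [lipschitz gradient u y | y in V]].

(* Measurability is Borel measurability. *)
Definition Lploc (R : realType) (n : nat) (q : R) (u : 'rV[R]_n -> R) : Prop :=
  measurable_fun [set: 'rV[R]_n] u /\
  forall K, compact K ->
    (\int[lebesgue_rV R n]_(x in K) (`|u x| `^ q)%:E < +oo)%E.

Definition Lsp (R : realType) (n : nat) (s p : R) (u : 'rV[R]_n -> R) : Prop :=
  Lploc (p - 1) u /\
  (\int[lebesgue_rV R n]_x
     (`|1 + u x| `^ (p - 1) / (1 + enorm x `^ (n%:R + s * p)))%:E < +oo)%E.

(* The principal value is a limit in the extended reals.  For p > 2, x in Omega
   and u in C^{1,1}_loc(Omega) and Lsp, the limit exists and is finite. *)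
Definition frac_plaplacian (R : realType) (n : nat) (s p Cnsp : R)
    (u : 'rV[R]_n -> R) (x : 'rV[R]_n) : \bar R :=
  (Cnsp%:E * lim (\int[lebesgue_rV R n]_(y in ~` eball x eps)
     (`|u x - u y| `^ (p - 2) * (u x - u y)
        / enorm (x - y) `^ (n%:R + s * p))%:E @[eps --> 0^'+]))%E.

Definition uniform_interior_ball (R : realType) (n : nat)
    (Omega : set 'rV[R]_n) : Prop :=
  exists2 r : R, 0 < r & forall z, boundary Omega z ->
    exists y, eball y r `<=` Omega /\ boundary (eball y r) z.

(* The filter "x in Omega and dist(x, boundary Omega) -> 0". *)
Definition to_boundary (R : realType) (n : nat) (Omega : set 'rV[R]_n)
  : set_system 'rV[R]_n :=
  filter_from [set d : R | 0 < d]
    (fun d => [set x | Omega x /\ dist_set x (boundary Omega) < d]).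

(* Main.v *)
From HB Require Import structures.
Require Import Defs.
From mathcomp Require Import all_boot all_order all_algebra.
From mathcomp Require Import all_classical all_reals all_analysis.
From mathcomp Require Import measurable_realfun ring lra.

Import Order.TTheory GRing.Theory Num.Theory.
Import numFieldTopology.Exports numFieldNormedType.Exports.

Local Open Scope classical_set_scope.
Local Open Scope ring_scope.

Set Implicit Arguments.
Unset Strict Implicit.
Unset Printing Implicit Defensive.


(** The Hopf-type estimate is proved by comparison with the explicit profile
    [bar s y0 r y = (1 - |y - y0|^2 / r^2)_+^s] of a ball, which decays like the
    power [s] of the distance to the sphere.

    The operator at a contact point.  The half-line profile [(1 + t)_+^s] solves
    the equation: the inversion of the half-line in its end point exchanges the
    parts of the integrand on the two sides of the base point, up to a boundary
    term, so that the principal value with cut-off [e] is of order [e^(p - s p)]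
    (lemma [hl_balance_le]).  Integrals over the space are compared direction by
    direction, opposite directions together ([le_integral_rays]), and so the
    half-space profile solves the equation as well ([halfspace_pv]).  At a point
    [x] of the ball, [bar] lies below the half-space profile that has as its base
    the tangent of the quadratic at [x]; by concavity of the power [s] the
    difference costs at most a constant times [r^(- s p)], uniformly in [x]
    ([integral_excess_le]).  If [k * bar] touches [u] from below at [x], then
    monotonicity of [|t|^(p-2) t] bounds the operator of [u] at [x] by
    [k^(p-1) * C * r^(- s p)], minus the contribution of any set on which [u] is
    well above [k * bar] ([lim_touching]).  The integrand
    of [u] is an integrable function minus a nonnegative one, and so the principal
    value exists in the extended reals.

    Propagation.  Let [u >= m] on a ball of radius comparable to [r] at a distance
    comparable to [r] from the centre [y0].  For [k = theta * m] with [theta]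
    small, touching is impossible: the ball where [u >= m] contributes
    [- c * m^(p-1) * r^(- s p)], which beats both [k^(p-1) * C * r^(- s p)] and the
    term [c u <= M k], the latter if [M r^(s p)] is controlled by [m^(p-2)].  As
    [u >= 0] everywhere and is continuous inside, touching from below does occur
    as soon as [k * bar] exceeds [u] somewhere ([exists_touching]); hence
    [u >= theta * m * bar] ([bar_propagation]).

    Conclusion.  Interior balls of the common radius [rho] have [u >= m] near
    their centres by compactness, hence [u >= c d^s] at depth [d] in such a ball.
    A point [x] at distance [d] from the boundary need not lie in an interior
    ball, but a ball of radius [d] within distance [4 d] of it lies at depth [d]
    in one.  A second propagation, to the ball of radius [d] around [x] with
    [m = c d^s], gives [u x >= C d^s] ([boundary_growth]); there the condition on
    [M] holds for small [d] because [d^(s p) <= d^(s (p - 2))]. *)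

(** * Euclidean norm *)

Section euclidean_norm.
Context {R : realType} {n : nat}.
Implicit Types x y z : 'rV[R]_n.

Definition dot x y : R := \sum_(i < n) x 0 i * y 0 i.

Lemma dotC x y : dot x y = dot y x.
Proof. by apply: eq_bigr => i _; rewrite mulrC. Qed.

Lemma dotDl x y z : dot (x + y) z = dot x z + dot y z.
Proof. by rewrite -big_split/=; apply: eq_bigr => i _; rewrite mxE mulrDl. Qed.

Lemma dotZl (c : R) x y : dot (c *: x) y = c * dot x y.
Proof. by rewrite mulr_sumr; apply: eq_bigr => i _; rewrite mxE mulrA. Qed.

Lemma dotDr x y z : dot x (y + z) = dot x y + dot x z.
Proof. by rewrite dotC dotDl !(dotC x). Qed.

Lemma dotZr (c : R) x y : dot x (c *: y) = c * dot x y.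
Proof. by rewrite dotC dotZl dotC. Qed.

Lemma dot_ge0 x : 0 <= dot x x.
Proof. by apply: sumr_ge0 => i _; rewrite -expr2 sqr_ge0. Qed.

Lemma enorm_dot x : enorm x = Num.sqrt (dot x x).
Proof. by congr Num.sqrt; apply: eq_bigr => i _; rewrite expr2. Qed.

Lemma enorm_sqr x : enorm x ^+ 2 = dot x x.
Proof. by rewrite enorm_dot sqr_sqrtr// dot_ge0. Qed.

Lemma enorm_ge0 x : 0 <= enorm x. Proof. exact: sqrtr_ge0. Qed.

Lemma enormZ (c : R) x : enorm (c *: x) = `|c| * enorm x.
Proof.
by rewrite !enorm_dot dotZl dotZr mulrA -expr2 sqrtrM ?sqr_ge0// sqrtr_sqr.
Qed.

Lemma enormN x : enorm (- x) = enorm x.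
Proof. by rewrite -scaleN1r enormZ normrN1 mul1r. Qed.

Lemma enormB x y : enorm (x - y) = enorm (y - x).
Proof. by rewrite -enormN opprB. Qed.

Lemma enorm0 : enorm (0 : 'rV[R]_n) = 0.
Proof. by rewrite -(scale0r 0) enormZ normr0 mul0r. Qed.

Lemma coord_le_enorm x i : `|x 0 i| <= enorm x.
Proof.
rewrite -sqrtr_sqr ler_wsqrtr// (bigD1 i)//= lerDl.
by apply: sumr_ge0 => j _; rewrite sqr_ge0.
Qed.

Lemma enorm_gt0 x : (0 < enorm x) = (x != 0).
Proof.
apply/idP/idP; first by apply: contraTneq => ->; rewrite enorm0 ltxx.
apply: contraNT; rewrite -leNgt => x0; apply/eqP/rowP => i; rewrite mxE.
by apply/eqP; rewrite -normr_le0 (le_trans (coord_le_enorm x i)).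
Qed.

Lemma dot_le_enorm x y : dot x y <= enorm x * enorm y.
Proof.
have [->|x0] := eqVneq x 0.
  by rewrite enorm0 mul0r -(scale0r 0) dotZl mul0r.
have [->|y0] := eqVneq y 0.
  by rewrite enorm0 mulr0 -(scale0r 0) dotZr mul0r.
set A := enorm x; set B := enorm y.
have A0 : 0 < A by rewrite enorm_gt0.
have B0 : 0 < B by rewrite enorm_gt0.
have := dot_ge0 (B *: x + (- A) *: y).
rewrite !(dotDl, dotDr, dotZl, dotZr) -!enorm_sqr -/A -/B (dotC y x) => H.
have {H} : 0 <= (2 * (A * B)) * (A * B - dot x y).
  by apply: le_trans H _; rewrite le_eqVlt; apply/orP; left; apply/eqP; ring.
by rewrite pmulr_rge0 ?subr_ge0// !mulr_gt0.
Qed.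

Lemma norm_dot_le x y : `|dot x y| <= enorm x * enorm y.
Proof.
rewrite ler_norml dot_le_enorm andbT lerNl.
by have := dot_le_enorm (- x) y; rewrite enormN -scaleN1r dotZl mulN1r.
Qed.

Lemma enormD x y : enorm (x + y) <= enorm x + enorm y.
Proof.
rewrite -(@ler_pXn2r _ 2)// ?nnegrE ?addr_ge0 ?enorm_ge0// sqrrD.
rewrite enorm_sqr !(dotDl, dotDr) -!enorm_sqr (dotC y x).
have := dot_le_enorm x y; lra.
Qed.

Lemma enorm_dist_tri z x y : enorm (x - y) <= enorm (x - z) + enorm (z - y).
Proof. by have := enormD (x - z) (z - y); rewrite addrA subrK. Qed.

Lemma measurable_enormB x :
  measurable_fun [set: 'rV[R]_n] (fun y => enorm (x - y)).
Proof.
have -> : (fun y => enorm (x - y)) =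
    (fun y => (\sum_(i < n) (x - y) 0 i ^+ 2) `^ 2^-1).
  apply/funext => y; rewrite powR12_sqrt//.
  by apply: sumr_ge0 => i _; rewrite sqr_ge0.
apply: (measurableT_comp (measurable_powR _)).
apply: measurable_sum => i; apply: measurable_funX.
under eq_fun do rewrite !mxE.
by apply: measurable_funB => //; exact: measurable_rV_coord.
Qed.

Lemma measurable_eball x (r : R) : measurable (eball x r).
Proof.
have := measurable_enormB x measurableT (measurable_itv `]-oo, r[).
by rewrite setTI; congr (measurable _); apply/seteqP; split => y;
  rewrite /eball/= in_itv.
Qed.

End euclidean_norm.

(** * Powers *)

Section real_powers.
Context {R : realType}.
Implicit Types a b c x y k M q r s t : R.

Lemma powR_continuous a x : 0 < x -> {for x, continuous (fun y : R => y `^ a)}.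
Proof.
move=> x0; apply/differentiable_continuous/derivable1_diffP.
by apply: derivable_powR; rewrite in_itv/= x0.
Qed.

Lemma powR_le1 q r : 0 <= q -> 0 <= r <= 1 -> r `^ q <= 1.
Proof.
move=> q0 /andP[r0 r1]; have -> : 1 = 1 `^ q :> R by rewrite powR1.
by rewrite ge0_ler_powR ?nnegrE.
Qed.

Lemma powR_lt1 q r : 0 < q -> 0 <= r < 1 -> r `^ q < 1.
Proof.
move=> q0 /andP[r0 r1]; have -> : 1 = 1 `^ q :> R by rewrite powR1.
by rewrite gt0_ltr_powR ?nnegrE.
Qed.

Lemma powR_gt1 q r : 0 < q -> 1 < r -> 1 < r `^ q.
Proof.
move=> q0 r1; have {1}-> : 1 = 1 `^ q :> R by rewrite powR1.
by rewrite gt0_ltr_powR ?nnegrE// (le_trans ler01) ?ltW.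
Qed.

Lemma powR_bernoulli q r : 1 <= q -> 0 <= r <= 1 -> 1 - r `^ q <= q * (1 - r).
Proof.
move=> q1 /andP[]; rewrite le_eqVlt => /predU1P[<- _|r0].
  by rewrite powR0 ?subr0 ?mulr1// gt_eqF// (lt_le_trans ltr01).
rewrite le_eqVlt => /predU1P[->|r1]; first by rewrite powR1 !subrr mulr0.
have dq (x : R) : x \in `]r, 1[ ->
    is_derive x 1 (fun x : R => x `^ q) (q * x `^ (q - 1)).
  rewrite in_itv/= => /andP[rx _].
  by apply: is_derive1_powR; exact: lt_trans rx.
have cq : {within `[r, 1], continuous (fun x : R => x `^ q)}.
  apply: continuous_in_subspaceT => x; rewrite inE/= in_itv/= => /andP[rx _].
  by apply: powR_continuous; exact: lt_le_trans rx.
have [c] := MVT r1 dq cq.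
rewrite in_itv/= => /andP[rc c1]; rewrite powR1 => ->.
rewrite ler_wpM2r ?subr_ge0 ?(ltW r1)// -[leRHS]mulr1 ler_wpM2l ?(le_trans ler01 q1)//.
apply: powR_le1; rewrite ?subr_ge0// (ltW (lt_trans r0 rc))/=.
exact: ltW.
Qed.

Lemma powR_lip q x y : 1 <= q -> 0 <= y <= x ->
  x `^ q - y `^ q <= q * x `^ (q - 1) * (x - y).
Proof.
move=> q1 /andP[y0 yx].
have [->|x0] := eqVneq x y; first by rewrite !subrr mulr0.
have {x0}xp : 0 < x by rewrite (le_lt_trans y0)// lt_neqAle eq_sym x0.
have -> : y `^ q = x `^ q * (y / x) `^ q.
  by rewrite -powRM ?divr_ge0// ?(ltW xp)// mulrC divfK// gt_eqF.
rewrite -{1}[x `^ q]mulr1 -mulrBr.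
have := @powR_bernoulli q (y / x) q1; rewrite divr_ge0 ?(ltW xp)//=.
rewrite ler_pdivrMr// mul1r => /(_ yx) H.
apply: le_trans (ler_wpM2l (powR_ge0 _ _) H) _.
rewrite -(@mulr_powRB1 _ x q) ?(ltW xp) ?(lt_le_trans ltr01)//.
by rewrite le_eqVlt; apply/orP; left; apply/eqP; field; rewrite gt_eqF.
Qed.

Lemma powR_conc s t : 0 <= s <= 1 -> 0 <= t <= 1 -> t <= t `^ s.
Proof.
move=> /andP[s0 s1] /andP[]; rewrite le_eqVlt => /predU1P[<- _|t0 t1].
  exact: powR_ge0.
by apply: ger1_powR; rewrite ?t0.
Qed.

Lemma powR_subadd s a c : 0 <= s <= 1 -> 0 <= c <= a ->
  a `^ s - c `^ s <= (a - c) `^ s.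
Proof.
move=> s01 /andP[c0 ca]; have a0 := le_trans c0 ca.
have [aE|an0] := eqVneq a 0.
  have -> : c = a by apply/eqP; rewrite eq_le ca aE c0.
  by rewrite !subrr powR_ge0.
have ap : 0 < a by rewrite lt_neqAle a0 andbT eq_sym.
have ai : 0 <= a^-1 by rewrite invr_ge0.
have -> : c `^ s = a `^ s * (c / a) `^ s.
  by rewrite -powRM ?divr_ge0// mulrC divfK// gt_eqF.
have -> : (a - c) `^ s = a `^ s * ((a - c) / a) `^ s.
  by rewrite -powRM ?divr_ge0 ?subr_ge0// [_ * (_ / _)]mulrC divfK// gt_eqF.
have h1 : c / a <= (c / a) `^ s.
  by apply: powR_conc; rewrite // divr_ge0//= ler_pdivrMr// mul1r.
have h2 : (a - c) / a <= ((a - c) / a) `^ s.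
  apply: powR_conc; rewrite // divr_ge0 ?subr_ge0//= ler_pdivrMr// mul1r.
  by rewrite gerBl.
rewrite -{1}[a `^ s]mulr1 -mulrBr ler_wpM2l ?powR_ge0//.
apply: le_trans h2; rewrite mulrBl divff ?gt_eqF//.
by rewrite lerD2l lerN2.
Qed.

(** Positive parts are needed because powers of negative numbers are not [0]. *)
Definition ppow (s a : R) : R := Num.max 0 a `^ s.

Lemma ppow_ge0 s a : 0 <= ppow s a. Proof. exact: powR_ge0. Qed.

Lemma ppowE s a : 0 <= a -> ppow s a = a `^ s.
Proof. by move=> a0; rewrite /ppow max_r. Qed.

Lemma ppow0 s a : s != 0 -> a <= 0 -> ppow s a = 0.
Proof. by move=> s0 a0; rewrite /ppow max_l// powR0. Qed.

Lemma ppow_le s a c : 0 <= s -> a <= c -> ppow s a <= ppow s c.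
Proof.
move=> s0 ac; apply: ge0_ler_powR; rewrite ?nnegrE ?[0 <= _]le_max ?lexx//.
by rewrite ge_max !le_max lexx ac orbT.
Qed.

Lemma ppow_holder s a c : 0 <= s <= 1 ->
  `|ppow s a - ppow s c| <= `|a - c| `^ s.
Proof.
move=> s01; have s0 : 0 <= s by case/andP: s01.
wlog ca : a c / c <= a.
  move=> H; have [/H//|/ltW/H] := leP c a.
  by rewrite distrC [`|c - a|]distrC.
rewrite ger0_norm ?subr_ge0 ?ppow_le// [`|a - c|]ger0_norm ?subr_ge0//.
apply: le_trans (powR_subadd s01 _) _.
  by rewrite ge_max !le_max lexx ca orbT.
rewrite ge0_ler_powR ?nnegrE ?subr_ge0//.
  by rewrite ge_max !le_max lexx ca orbT.
by rewrite !maxEle; case: ifP => _; case: ifP => hc; lra.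
Qed.

(** Concavity of the power gives the gain [b / a] over the trivial bound
    [a `^ s] as soon as the drop [b] is smaller than [a]. *)
Lemma ppow_drop s a b : 0 <= s <= 1 -> 0 <= b -> 0 < a ->
  ppow s a - ppow s (a - b) <= b * a `^ (s - 1).
Proof.
move=> s01 b0 a0; rewrite ppowE ?(ltW a0)//.
have aE : a `^ s = a * a `^ (s - 1).
  rewrite -{2}(powRr1 (ltW a0)) -powRD ?(gt_eqF a0) ?implybT//.
  by congr (_ `^ _); ring.
have [ab|ba] := leP a b.
  apply: (@le_trans _ _ (a `^ s)); first by rewrite gerBl ppow_ge0.
  by rewrite aE ler_wpM2r ?powR_ge0.
rewrite ppowE ?subr_ge0 ?(ltW ba)//.
have -> : a - b = a * ((a - b) / a) by rewrite mulrC divfK// gt_eqF.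
have r0 : 0 <= (a - b) / a by rewrite divr_ge0 ?subr_ge0// ltW.
have r1 : (a - b) / a <= 1 by rewrite ler_pdivrMr// mul1r gerBl.
have h : (a - b) / a <= ((a - b) / a) `^ s by apply: powR_conc; rewrite ?r0.
rewrite powRM// ?(ltW a0)//.
have -> : b * a `^ (s - 1) = a `^ s * (1 - (a - b) / a).
  by rewrite aE; field; rewrite gt_eqF.
by rewrite -{1}[a `^ s]mulr1 -mulrBr ler_wpM2l ?powR_ge0// lerD2l lerN2.
Qed.

(** [spow p] is the nonlinearity [t |-> |t|^(p-2) t] of the operator. *)
Definition spow (p x : R) : R := `|x| `^ (p - 2) * x.

Section spow_theory.
Variable p : R.
Hypothesis p2 : 2 < p.

Let p20 : 0 < p - 2. Proof. by rewrite subr_gt0. Qed.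
Let p10 : 0 < p - 1. Proof. by move: p2; lra. Qed.

Lemma spowE x : 0 <= x -> spow p x = x `^ (p - 1).
Proof.
move=> x0; rewrite /spow ger0_norm// mulrC -(@mulr_powRB1 _ x (p - 1))//.
by congr (_ * _ `^ _); ring.
Qed.

Lemma spowN x : spow p (- x) = - spow p x.
Proof. by rewrite /spow normrN mulrN. Qed.

Lemma spowNE x : x <= 0 -> spow p x = - (- x) `^ (p - 1).
Proof. by move=> x0; rewrite -[x in LHS]opprK spowN spowE// oppr_ge0. Qed.

Lemma norm_spow x : `|spow p x| = `|x| `^ (p - 1).
Proof.
have [x0|/ltW x0] := leP 0 x.
  by rewrite spowE// !ger0_norm ?powR_ge0.
by rewrite spowNE// normrN (ler0_norm x0) ger0_norm ?powR_ge0.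
Qed.

Lemma spowM k x : 0 <= k -> spow p (k * x) = k `^ (p - 1) * spow p x.
Proof.
move=> k0; rewrite -(spowE k0) /spow normrM powRM//; by ring.
Qed.

Lemma spow_ge0 x : 0 <= x -> 0 <= spow p x.
Proof. by move=> x0; rewrite spowE// powR_ge0. Qed.

Lemma spow_le x y : x <= y -> spow p x <= spow p y.
Proof.
have mono (u v : R) : 0 <= u -> u <= v -> spow p u <= spow p v.
  move=> u0 uv; have v0 := le_trans u0 uv.
  by rewrite !spowE// ge0_ler_powR ?nnegrE// ltW.
have [x0|/ltW x0] := leP 0 x; first exact: mono.
have [y0 _|/ltW y0 xy] := leP 0 y.
  apply: (@le_trans _ _ 0); last exact: spow_ge0.
  by rewrite spowNE// oppr_le0 powR_ge0.
rewrite -[x]opprK -[y]opprK (spowN (- x)) (spowN (- y)) lerN2.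
by apply: mono; rewrite ?oppr_ge0 ?lerN2.
Qed.

Lemma spow_lip M x y : `|x| <= M -> `|y| <= M -> y <= x ->
  spow p x - spow p y <= (p - 1) * M `^ (p - 2) * (x - y).
Proof.
have p1 : 1 <= p - 1 by move: p2; lra.
have pE : p - 1 - 1 = p - 2 by ring.
have lip (u v : R) : `|u| <= M -> 0 <= v -> v <= u ->
    spow p u - spow p v <= (p - 1) * M `^ (p - 2) * (u - v).
  move=> uM v0 vu; have u0 := le_trans v0 vu.
  rewrite !spowE//; apply: le_trans (powR_lip p1 _) _; first by rewrite v0.
  rewrite pE ler_wpM2r ?subr_ge0// ler_wpM2l ?(ltW p10)//.
  have uM' : u <= M by rewrite -(ger0_norm u0).
  by rewrite ge0_ler_powR ?nnegrE ?(ltW p20) ?(le_trans u0).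
move=> xM yM yx.
have [y0|/ltW y0] := leP 0 y; first exact: lip.
have [x0|/ltW x0] := leP 0 x; last first.
  have -> : spow p x - spow p y = spow p (- y) - spow p (- x).
    by rewrite !spowN; ring.
  have -> : x - y = - y - - x by ring.
  by apply: lip; rewrite ?normrN ?oppr_ge0 ?lerN2.
have M0 : 0 <= M by rewrite (le_trans (normr_ge0 x)).
apply: (@le_trans _ _ (M `^ (p - 2) * (x - y))); last first.
  by rewrite ler_wpM2r ?subr_ge0// -[leLHS]mul1r ler_wpM2r ?powR_ge0.
rewrite /spow mulrBr lerB//; first rewrite ler_wpM2r//.
  by rewrite ge0_ler_powR ?nnegrE ?(ltW p20).
apply: ler_wnM2r => //; by rewrite ge0_ler_powR ?nnegrE ?(ltW p20).
Qed.

Lemma measurable_spow : measurable_fun [set: R] (spow p).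
Proof.
apply: measurable_funM => //.
by apply: (measurableT_comp (measurable_powR _)) => //; exact: normr_measurable.
Qed.

End spow_theory.

Lemma measurable_ppow s : measurable_fun [set: R] (ppow s).
Proof.
apply: (measurableT_comp (measurable_powR _)).
exact: measurable_maxr.
Qed.

End real_powers.

(** * Lebesgue measure and polar coordinates *)

Section affine_change_of_variable.
Context {R : realType}.
Local Notation leb := (@lebesgue_measure R).

(** The affine change of variable transports Lebesgue measure to a multiple of
    itself: the two measures agree on intervals. *)
Lemma ge0_integral_affine (f : R -> \bar R) (b c : R) : c != 0 ->
  measurable_fun [set: R] f -> (forall x, 0 <= f x)%E ->
  (\int[leb]_x f x = `|c|%:E * \int[leb]_x f (b + c * x)%R)%E.
Proof.
move=> c0 mf f0.
pose phi : measurableTypeR R -> measurableTypeR R := fun x => b + c * x.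
have mphi : measurable_fun [set: R] phi.
  by apply: measurable_funD => //; exact: measurable_funM.
have c1 : 0 <= `|c| by [].
pose push : {measure set (measurableTypeR R) -> \bar R} :=
  measure_function_pushforward__canonical__measure_function_Measure leb mphi.
pose nu := mscale (NngNum c1) push.
have lebE A : measurable A -> leb A = nu A.
  apply: lebesgue_measure_unique => _ [[x y]] _ <-.
  rewrite /=.
  transitivity (`|c|%:E * leb (phi @^-1` `]x, y]))%E; last by [].
  have [cp|cn|/eqP] := ltgtP 0 c; last by rewrite eq_sym (negbTE c0).
    have -> : phi @^-1` `]x, y] = `](x - b) / c, (y - b) / c]%classic.
      apply/seteqP; split => t /=; rewrite !in_itv/= /phi ltr_pdivrMr//
        ler_pdivlMr// ltrBlDr lerBrDr ![_ * c]mulrC ![b + _]addrC//.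
    rewrite !lebesgue_measure_itv/= !lte_fin ltr_pM2r ?invr_gt0// ltrD2r.
    case: ifPn => _; last by rewrite mule0.
    rewrite -!EFinD -EFinM; congr EFin; rewrite gtr0_norm//; field.
    by rewrite gt_eqF.
    have -> : phi @^-1` `]x, y] = `[(y - b) / c, (x - b) / c[%classic.
      apply/seteqP; split => t /=; rewrite !in_itv/= /phi ltr_ndivlMr//
        ler_ndivrMr// ltrBlDr lerBrDr ![_ * c]mulrC ![b + _]addrC andbC//.
    rewrite !lebesgue_measure_itv/= !lte_fin ltr_nM2r ?invr_lt0// ltrD2r.
    case: ifPn => _; last by rewrite mule0.
    rewrite -!EFinD -EFinM; congr EFin; rewrite ltr0_norm//; field.
    by rewrite lt_eqF.
rewrite [LHS](_ : _ = \int[nu]_x f x)%E; last first.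
  by apply: eq_measure_integral => A mA _; exact: lebE.
rewrite /nu ge0_integral_mscale//= ge0_integral_pushforward//.
Qed.

Lemma ge0_integral_rVS n (f : 'rV[R]_n.+1 -> \bar R) :
  measurable_fun [set: 'rV[R]_n.+1] f -> (forall x, 0 <= f x)%E ->
  (\int[lebesgue_rV R n.+1]_x f x =
   \int[leb]_a \int[lebesgue_rV R n]_z f (cons_rV (a, z)))%E.
Proof.
move=> mf f0.
have mc := @measurable_cons_rV R n.
transitivity (\int[leb \x lebesgue_rV R n]_z (f \o @cons_rV R n) z)%E.
  have := @ge0_integral_pushforward _ _ _ _ R _ mc
    (leb \x lebesgue_rV R n)%E setT f measurableT mf.
  by rewrite preimage_setT => -> // y _.
rewrite fubini_tonelli1//; first exact: measurableT_comp.
by move=> z; exact: f0.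
Qed.

Lemma measurable_affine_rV n (b : 'rV[R]_n) (c : R) :
  measurable_fun [set: 'rV[R]_n] (fun x => b + c *: x).
Proof.
apply: measurable_fun_rV => i; under eq_fun do rewrite !mxE.
apply: measurable_funD => //; apply: measurable_funM => //.
exact: measurable_rV_coord.
Qed.

Lemma ge0_integral_affine_rV n (f : 'rV[R]_n -> \bar R) b (c : R) : c != 0 ->
  measurable_fun [set: 'rV[R]_n] f -> (forall x, 0 <= f x)%E ->
  (\int[lebesgue_rV R n]_x f x =
   (`|c| ^+ n)%:E * \int[lebesgue_rV R n]_x f (b + c *: x)%R)%E.
Proof.
elim: n f b => [|n IHn] f b c0 mf f0.
  rewrite expr0 mul1e; apply: eq_integral => x _.
  by rewrite [b]thinmx0 [x]thinmx0 scaler0 addr0.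
have mc := @measurable_cons_rV R n.
have mcc a : measurable_fun [set: 'rV[R]_n] (fun z => f (cons_rV (a, z))).
  apply: (measurableT_comp mf); apply: (measurableT_comp mc).
  exact: measurable_fun_pair.
pose b' : 'rV[R]_n := \row_i b 0 (lift ord0 i).
pose g (y : measurableTypeR R * 'rV[R]_n) := f (cons_rV (y.1, b' + c *: y.2)).
have mg : measurable_fun [set: measurableTypeR R * 'rV[R]_n] g.
  apply: (measurableT_comp mf); apply: (measurableT_comp mc).
  apply: measurable_fun_pair => //.
  exact: (measurableT_comp (measurable_affine_rV b' c)).
have g0 y : (0 <= g y)%E by exact: f0.
rewrite ge0_integral_rVS// [in RHS]ge0_integral_rVS//; last first.
  apply: (measurableT_comp mf); exact: measurable_affine_rV.
under eq_integral => a _.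
  rewrite (IHn _ b' c0 (mcc a))//.
  over.
rewrite ge0_integralZl//; last 2 first.
- exact: (@measurable_fun_fubini_tonelli_F _ _ _ _ R (lebesgue_rV R n) g mg g0).
- by move=> a _; apply: integral_ge0 => z _.
rewrite [X in (_ * X = _)%E](@ge0_integral_affine _ (b 0 0) c c0); last 2 first.
- exact: (@measurable_fun_fubini_tonelli_F _ _ _ _ R (lebesgue_rV R n) g mg g0).
- by move=> a; apply: integral_ge0 => z _.
rewrite muleA -EFinM -exprSr; congr (_ * _)%E.
apply: eq_integral => a _; apply: eq_integral => z _; congr f.
apply/rowP => i; rewrite !mxE; case: unliftP => [j ->|->]; rewrite ?mxE//.
Qed.

End affine_change_of_variable.

Section polar_coordinates.
Context {R : realType}.
Local Notation leb := (@lebesgue_measure R).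

Lemma ge0_integral_line (h : R -> \bar R) :
  measurable_fun [set: R] h -> (forall t, 0 <= h t)%E ->
  (\int[leb]_t h t = \int[leb]_(t in `]0%R, +oo[) h t +
                     \int[leb]_(t in `]0%R, +oo[) h (- t)%R)%E.
Proof.
move=> mh h0.
have -> : (\int[leb]_(t in `]0%R, +oo[) h (- t)%R =
           \int[leb]_(t in `]-oo, 0%R[) h t)%E.
  rewrite integral_mkcond [RHS]integral_mkcond.
  have c0 : (-1 : R) != 0 by rewrite oppr_eq0 oner_eq0.
  have mr : measurable_fun [set: R] (h \_ `]-oo, 0%R[).
    apply/(measurable_restrictT _ _).1; first exact: measurable_itv.
    exact: measurable_funTS.
  have r0 t : (0 <= (h \_ `]-oo, 0%R[) t)%E by apply: erestrict_ge0.
  rewrite [RHS](ge0_integral_affine 0 c0 mr r0) normrN1 mul1e.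
  apply: eq_integral => t _.
  rewrite !patchE !add0r mulN1r; congr (if _ then _ else _).
  by apply/idP/idP; rewrite !inE/= !in_itv/= ?andbT oppr_lt0.
rewrite -(itv_setU_setT false 0) ge0_integral_setU//=; last 2 first.
- exact: measurable_funTS.
- apply/disj_setPLR => x /=; rewrite !in_itv/= andbT => x0.
  by apply/negP; rewrite -leNgt.
rewrite addeC; congr (_ + _)%E; rewrite -integral_itv_bndo_bndc//.
exact: measurable_funTS.
Qed.

(** The part of the integral of [phi] in polar coordinates around [x] that
    comes from the direction [e]. *)
Definition ray n (phi : 'rV[R]_n.+1 -> \bar R) (x e : 'rV[R]_n.+1) : \bar R :=
  (\int[leb]_(t in `]0%R, +oo[) (phi (x + t *: e)%R * (t ^+ n)%:E))%E.

Lemma measurable_line n (x e : 'rV[R]_n) :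
  measurable_fun [set: R] (fun t : R => x + t *: e).
Proof.
apply: measurable_fun_rV => i; under eq_fun do rewrite !mxE.
by apply: measurable_funD => //; apply: measurable_funM.
Qed.

Let slope n (phi : 'rV[R]_n.+1 -> \bar R) x
    (z : measurableTypeR R * 'rV[R]_n) : \bar R :=
  (phi (x + z.1 *: cons_rV (1, z.2))%R * (`|z.1| ^+ n)%:E)%E.

Let measurable_slopes n (phi : 'rV[R]_n.+1 -> \bar R) x :
  measurable_fun [set: 'rV[R]_n.+1] phi ->
  measurable_fun [set: measurableTypeR R * 'rV[R]_n] (slope phi x).
Proof.
move=> mphi; apply: emeasurable_funM; last first.
  apply/measurable_EFinP; apply: measurable_funX.
  exact: (measurableT_comp (@normr_measurable R setT)).
apply: (measurableT_comp mphi); apply: measurable_fun_rV => i.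
under eq_fun do rewrite !mxE.
apply: measurable_funD => //; apply: measurable_funM => //.
case: (unliftP ord0 i) => [j|] _ /=; last exact: measurable_cst.
exact: (measurableT_comp (@measurable_rV_coord R n j) measurable_snd).
Qed.

Let slopes_ge0 n (phi : 'rV[R]_n.+1 -> \bar R) x :
  (forall y, 0 <= phi y)%E -> (forall z, 0 <= slope phi x z)%E.
Proof. by move=> phi0 z; rewrite mule_ge0// lee_fin exprn_ge0. Qed.

(** Polar coordinates are replaced by lines [x + t (1, v)] through [x], indexed
    by the slope [v]: this needs Tonelli and scaling only, not a surface measure
    on the sphere, and normalising [(1, v)] gives back unit directions. *)
Lemma integral_slopes n (phi : 'rV[R]_n.+1 -> \bar R) (x : 'rV[R]_n.+1) :
  measurable_fun [set: 'rV[R]_n.+1] phi -> (forall y, 0 <= phi y)%E ->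
  (\int[lebesgue_rV R n.+1]_y phi y =
   \int[lebesgue_rV R n]_v \int[leb]_t
     (phi (x + t *: cons_rV (1, v))%R * (`|t| ^+ n)%:E))%E.
Proof.
move=> mphi phi0.
have mc := @measurable_cons_rV R n.
have mg := measurable_slopes x mphi; have g0 := slopes_ge0 x phi0.
set g := slope phi x in mg g0.
have mx : measurable_fun [set: 'rV[R]_n.+1] (fun y => phi (x + 1 *: y)).
  apply: (measurableT_comp mphi); exact: measurable_affine_rV.
rewrite (ge0_integral_affine_rV x (oner_neq0 R) mphi phi0) normr1 expr1n mul1e.
rewrite (ge0_integral_rVS mx)//.
pose F (a : measurableTypeR R) :=
  (\int[lebesgue_rV R n]_z phi (x + 1 *: cons_rV (a, z))%R)%E.
pose f (z : measurableTypeR R * 'rV[R]_n) := phi (x + 1 *: cons_rV z).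
have mf : measurable_fun [set: measurableTypeR R * 'rV[R]_n] f.
  exact: (measurableT_comp mx).
have f0 z : (0 <= f z)%E by exact: phi0.
have mF : measurable_fun [set: R] F.
  exact: (@measurable_fun_fubini_tonelli_F _ _ _ _ R (lebesgue_rV R n) f mf f0).
have mG : measurable_fun [set: R] (fun a => \int[lebesgue_rV R n]_v g (a, v))%E.
  exact: (@measurable_fun_fubini_tonelli_F _ _ _ _ R (lebesgue_rV R n) g mg g0).
transitivity (\int[leb]_a \int[lebesgue_rV R n]_v g (a, v))%E; last first.
  exact: (@fubini_tonelli _ _ _ _ R leb (lebesgue_rV R n) g mg g0).
have mD : measurable ([set: R] `\ 0) by exact: measurableD.
rewrite -(@integral_setD1 _ _ 0)//; last exact: measurable_funTS.
rewrite -[RHS](@integral_setD1 _ _ 0)//; last exact: measurable_funTS.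
apply: eq_integral => a; rewrite inE/= => -[_ /eqP a0].
have mfa : measurable_fun [set: 'rV[R]_n] (fun z => f (a, z)).
  by apply: (measurableT_comp mf); exact: measurable_fun_pair.
rewrite (ge0_integral_affine_rV 0 a0 mfa)//.
rewrite -ge0_integralZl//; last first.
  apply: (measurableT_comp mfa); exact: measurable_affine_rV.
apply: eq_integral => v _; rewrite muleC; congr (phi _ * _)%E.
rewrite scale1r; congr (_ + _); apply/rowP => i; rewrite !mxE.
by case: unliftP => [j _|_]; rewrite ?mxE ?add0r ?mulr1.
Qed.

Lemma enorm_cons1 n (v : 'rV[R]_n) : 0 < enorm (cons_rV (1, v)).
Proof.
rewrite enorm_gt0; apply/eqP => /rowP/(_ ord0); rewrite !mxE unlift_none.
by apply/eqP; rewrite oner_eq0.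
Qed.

Lemma integral_line_rays n (phi : 'rV[R]_n.+1 -> \bar R)
    (x e : 'rV[R]_n.+1) (c : R) : 0 < c ->
  measurable_fun [set: 'rV[R]_n.+1] phi -> (forall y, 0 <= phi y)%E ->
  (\int[leb]_t (phi (x + t *: (c *: e))%R * (`|t| ^+ n)%:E) =
   (c ^- n.+1)%:E * (ray phi x e + ray phi x (- e)))%E.
Proof.
move=> c0 mphi phi0.
pose h (e : 'rV[R]_n.+1) (t : R) := (phi (x + t *: e)%R * (`|t| ^+ n)%:E)%E.
have mh w : measurable_fun [set: R] (h w).
  apply: emeasurable_funM.
    by apply: (measurableT_comp mphi); exact: measurable_line.
  by apply/measurable_EFinP; apply: measurable_funX.
have h0 w t : (0 <= h w t)%E by rewrite mule_ge0// lee_fin exprn_ge0.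
have ci : c^-1 != 0 by rewrite invr_eq0 gt_eqF.
rewrite (ge0_integral_affine 0 ci (mh (c *: e)) (h0 _)).
have -> : (\int[leb]_t h (c *: e) (0 + c^-1 * t)%R =
           (c ^- n)%:E * \int[leb]_t h e t)%E.
  rewrite -ge0_integralZl//; last 2 first.
  - exact: mh.
  - by rewrite lee_fin invr_ge0 exprn_ge0// ltW.
  apply: eq_integral => t _; rewrite /h add0r normrM exprMn scalerA.
  rewrite mulrAC mulVf ?gt_eqF// mul1r muleCA; congr (_ * _)%E.
  by rewrite -EFinM ger0_norm ?invr_ge0 ?(ltW c0)// exprVn.
rewrite muleA -EFinM ger0_norm ?invr_ge0 ?(ltW c0)// exprS invfM.
congr (_ * _)%E; rewrite ge0_integral_line//; congr (_ + _)%E.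
  apply: eq_integral => t; rewrite inE/= in_itv/= andbT => t0.
  by rewrite /h gtr0_norm.
apply: eq_integral => t; rewrite inE/= in_itv/= andbT => t0.
by rewrite /h normrN gtr0_norm// scaleNr -scalerN.
Qed.

(** Comparison of two integrals direction by direction.  Opposite directions
    are taken together, which is how principal values cancel. *)
Lemma le_integral_rays n (phi psi : 'rV[R]_n.+1 -> \bar R) (x : 'rV[R]_n.+1) :
  measurable_fun [set: 'rV[R]_n.+1] phi -> (forall y, 0 <= phi y)%E ->
  measurable_fun [set: 'rV[R]_n.+1] psi -> (forall y, 0 <= psi y)%E ->
  (forall e, enorm e = 1%R ->
    ray phi x e + ray phi x (- e) <= ray psi x e + ray psi x (- e))%E ->
  (\int[lebesgue_rV R n.+1]_y phi y <= \int[lebesgue_rV R n.+1]_y psi y)%E.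
Proof.
move=> mphi phi0 mpsi psi0 le_rays.
have fubm (f : 'rV[R]_n.+1 -> \bar R) :
    measurable_fun [set: 'rV[R]_n.+1] f -> (forall y, 0 <= f y)%E ->
    measurable_fun [set: 'rV[R]_n] (fun v => \int[leb]_t
     (f (x + t *: cons_rV (1, v))%R * (`|t| ^+ n)%:E))%E.
  move=> mf f0.
  exact: (@measurable_fun_fubini_tonelli_G _ _ _ _ R leb _
    (measurable_slopes x mf) (slopes_ge0 x f0)).
rewrite (integral_slopes x mphi phi0) (integral_slopes x mpsi psi0).
apply: ge0_le_integral => //.
- move=> v _; apply: integral_ge0 => t _.
  by rewrite mule_ge0// lee_fin exprn_ge0.
- exact: fubm.
- exact: fubm.
move=> v _; set e0 := cons_rV _.
have l0 : 0 < enorm e0 := enorm_cons1 v.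
have -> : e0 = enorm e0 *: ((enorm e0)^-1 *: e0).
  by rewrite scalerA mulfV ?gt_eqF// scale1r.
rewrite !integral_line_rays//; apply: lee_wpmul2l.
  by rewrite lee_fin invr_ge0 exprn_ge0// ltW.
apply: le_rays; rewrite enormZ ger0_norm ?invr_ge0 ?(ltW l0)//.
by rewrite mulVf// gt_eqF.
Qed.

End polar_coordinates.

Section balls_and_rays.
Context {R : realType}.
Local Notation leb := (@lebesgue_measure R).

Lemma lebesgue_rV_cube n (x : 'rV[R]_n) (r : R) : 0 <= r ->
  lebesgue_rV R n [set y | forall i, `]x 0 i - r, x 0 i + r[%classic (y 0 i)] =
  ((2 * r) ^+ n)%:E.
Proof.
move=> r0; rewrite (lebesgue_rV_box (A := fun i => `]x 0 i - r, x 0 i + r[%classic))//.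
rewrite (eq_bigr (fun=> (2 * r)%:E)) => [|i _].
  by rewrite prodEFin prodr_const card_ord.
rewrite lebesgue_measure_itv/= lte_fin -EFinD.
case: ltP => [_|]; first by congr EFin; ring.
rewrite -subr_ge0 => h; congr EFin; lra.
Qed.

Lemma measurable_cube n (x : 'rV[R]_n) (r : R) :
  measurable [set y : 'rV[R]_n |
    forall i, `]x 0 i - r, x 0 i + r[%classic (y 0 i)].
Proof.
rewrite [X in measurable X](_ : _ = \bigcap_(i in [set: 'I_n])
    ((fun y : 'rV[R]_n => y 0 i) @^-1` `]x 0 i - r, x 0 i + r[)).
  apply: fin_bigcap_measurable => // i _.
  rewrite -[X in measurable X]setTI.
  exact: (@measurable_rV_coord R n i measurableT _ (measurable_itv _)).
by apply/seteqP; split => [y Ay i _|y Ay i]; [exact: Ay|exact: (Ay i I)].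
Qed.

(* Crude volume bounds by the circumscribed and the inscribed cube suffice. *)
Lemma lebesgue_rV_eball_le n (x : 'rV[R]_n) (r : R) : 0 <= r ->
  (lebesgue_rV R n (eball x r) <= ((2 * r) ^+ n)%:E)%E.
Proof.
move=> r0; rewrite -(lebesgue_rV_cube x r0); apply: le_measure.
- by rewrite inE; exact: measurable_eball.
- by rewrite inE; exact: measurable_cube.
move=> y /= xy i; rewrite /= in_itv/=.
have := le_lt_trans (coord_le_enorm (x - y) i) xy.
by rewrite !mxE ltr_norml => /andP[? ?]; apply/andP; split; lra.
Qed.

Lemma lebesgue_rV_eball_ge n (x : 'rV[R]_n.+1) (r : R) : 0 < r ->
  (((2 * (r / n.+1%:R)) ^+ n.+1)%:E <= lebesgue_rV R n.+1 (eball x r))%E.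
Proof.
move=> r0; have q0 : 0 < r / n.+1%:R by rewrite divr_gt0.
rewrite -(lebesgue_rV_cube x (ltW q0)); apply: le_measure.
- by rewrite inE; exact: measurable_cube.
- by rewrite inE; exact: measurable_eball.
move=> y /= xy; rewrite /eball/=.
rewrite -(@ltr_pXn2r _ 2)// ?nnegrE ?enorm_ge0 ?(ltW r0)// enorm_sqr /dot.
apply: (@lt_le_trans _ _ (\sum_(i < n.+1) (r / n.+1%:R) ^+ 2)).
  apply: ltr_sum => [|i _]; first by apply/hasP; exists ord0; rewrite ?mem_index_enum.
  rewrite -expr2 -real_normK ?num_real// ltr_pXn2r ?nnegrE ?(ltW q0)//.
  have /= := xy i; rewrite in_itv/= !mxE ltr_norml.
  move: (r / n.+1%:R) => q /andP[? ?]; apply/andP; split; lra.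
rewrite sumr_const card_ord.
have -> : (r / n.+1%:R) ^+ 2 *+ n.+1 = r ^+ 2 * n.+1%:R^-1.
  by rewrite -[LHS]mulr_natr; field; rewrite addrC natr1 pnatr_eq0.
by apply: ler_piMr; rewrite ?sqr_ge0// invf_le1// ler1n.
Qed.

Lemma measurable_ray_integrand n (phi : 'rV[R]_n.+1 -> \bar R) x e D :
  measurable_fun [set: 'rV[R]_n.+1] phi ->
  measurable_fun D (fun t : R => (phi (x + t *: e)%R * (t ^+ n)%:E)%E).
Proof.
move=> mphi; apply: measurable_funTS; apply: emeasurable_funM.
  by apply: (measurableT_comp mphi); exact: measurable_line.
by apply/measurable_EFinP; apply: measurable_funX.
Qed.

Lemma rayD n (phi psi : 'rV[R]_n.+1 -> \bar R) x e :
  measurable_fun [set: 'rV[R]_n.+1] phi -> (forall y, 0 <= phi y)%E ->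
  measurable_fun [set: 'rV[R]_n.+1] psi -> (forall y, 0 <= psi y)%E ->
  ray (fun y => phi y + psi y)%E x e = (ray phi x e + ray psi x e)%E.
Proof.
move=> mphi phi0 mpsi psi0; rewrite -ge0_integralD//.
- by apply: eq_integral => t _; rewrite ge0_muleDl.
- by move=> t; rewrite /= in_itv/= andbT => t0; rewrite mule_ge0// lee_fin exprn_ge0// ltW.
- exact: measurable_ray_integrand.
- by move=> t; rewrite /= in_itv/= andbT => t0; rewrite mule_ge0// lee_fin exprn_ge0// ltW.
- exact: measurable_ray_integrand.
Qed.

(** A uniform bound on the rays is absorbed by the indicator of a spherical
    shell, each ray of which is at least [1]. *)
Lemma le_integral_rays_add n (phi psi : 'rV[R]_n.+1 -> \bar R) x (C : R) :
  0 <= C ->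
  measurable_fun [set: 'rV[R]_n.+1] phi -> (forall y, 0 <= phi y)%E ->
  measurable_fun [set: 'rV[R]_n.+1] psi -> (forall y, 0 <= psi y)%E ->
  (forall e, enorm e = 1%R ->
    ray phi x e + ray phi x (- e) <=
    ray psi x e + ray psi x (- e) + (2 * C)%:E)%E ->
  (\int[lebesgue_rV R n.+1]_y phi y <=
   \int[lebesgue_rV R n.+1]_y psi y + (C * 4 ^+ n.+1)%:E)%E.
Proof.
move=> C0 mphi phi0 mpsi psi0 le_rays.
pose S := eball x 2 `\` eball x 1.
have mS : measurable S by apply: measurableD; exact: measurable_eball.
pose chi (y : 'rV[R]_n.+1) := (C * \1_S y)%:E.
have mchi : measurable_fun [set: 'rV[R]_n.+1] chi.
  by apply/measurable_EFinP; apply: measurable_funM => //; exact: measurable_indic.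
have chi0 y : (0 <= chi y)%E by rewrite lee_fin mulr_ge0.
have chiray e : enorm e = 1%R -> (C%:E <= ray chi x e)%E.
  move=> e1.
  apply: (@le_trans _ _ (\int[leb]_(t in `[1%R, 2%R[) C%:E)%E).
    rewrite integral_cst//= lebesgue_measure_itv/= lte_fin ltr1n.
    by rewrite -EFinD -EFinM lee_fin; lra.
  apply: (@le_trans _ _ (\int[leb]_(t in `[1%R, 2%R[) (chi (x + t *: e)%R * (t ^+ n)%:E))%E).
    apply: ge0_le_integral => //.
    - exact: measurable_ray_integrand.
    move=> t; rewrite /= in_itv/= => /andP[t1 t2].
    have te : enorm (x - (x + t *: e)) = t.
      by rewrite opprD addNKr enormN enormZ e1 mulr1 ger0_norm// (le_trans ler01).
    rewrite /chi -EFinM lee_fin indicE mem_set; last first.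
      by split; rewrite /eball/= te//; apply/negP; rewrite -leNgt.
    by rewrite mulr1 ler_peMr// exprn_ege1.
  apply: ge0_subset_integral => //.
  - exact: measurable_ray_integrand.
  - by move=> t; rewrite /= in_itv/= andbT => t0; rewrite mule_ge0// lee_fin exprn_ge0// ltW.
  - by move=> t; rewrite /= !in_itv/= => /andP[t1 _]; rewrite (lt_le_trans ltr01).
have int_chi : (\int[lebesgue_rV R n.+1]_y chi y <= (C * 4 ^+ n.+1)%:E)%E.
  rewrite /chi; under eq_integral do rewrite EFinM.
  rewrite ge0_integralZl//; last by apply/measurable_EFinP; exact: measurable_indic.
  rewrite integral_indic// setIT EFinM; apply: lee_wpmul2l => //.
  apply: (@le_trans _ _ (lebesgue_rV R n.+1 (eball x 2))).
    by apply: le_measure; rewrite ?inE//; [exact: measurable_eball|exact: subDsetl].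
  by apply: le_trans (lebesgue_rV_eball_le _ _) _ => //; rewrite -natrM.
apply: (@le_trans _ _ (\int[lebesgue_rV R n.+1]_y (psi y + chi y))%E).
  apply: (le_integral_rays (x := x)) => //.
  - exact: emeasurable_funD.
  - by move=> y; rewrite adde_ge0.
  move=> e e1; apply: (le_trans (le_rays _ e1)).
  rewrite (rayD x e mpsi psi0 mchi chi0) (rayD x (- e) mpsi psi0 mchi chi0).
  rewrite [leRHS]addeACA; apply: leeD2l.
  rewrite mulr_natl mulr2n EFinD.
  by apply: leeD; apply: chiray; rewrite ?enormN.
by rewrite ge0_integralD//; exact: leeD2l.
Qed.

Lemma integral_rays_le n (phi : 'rV[R]_n.+1 -> \bar R) x (C : R) : 0 <= C ->
  measurable_fun [set: 'rV[R]_n.+1] phi -> (forall y, 0 <= phi y)%E ->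
  (forall e, enorm e = 1%R -> ray phi x e <= C%:E)%E ->
  (\int[lebesgue_rV R n.+1]_y phi y <= (C * 4 ^+ n.+1)%:E)%E.
Proof.
move=> C0 mphi phi0 le_rays.
have := @le_integral_rays_add n phi (cst 0%E) x C C0 mphi phi0.
rewrite integral0 add0e; apply => // e e1.
apply: (@le_trans _ _ (C%:E + C%:E)%E).
  by rewrite leeD// le_rays ?enormN.
have -> : (C%:E + C%:E = 0 + (2 * C)%:E)%E.
  by rewrite add0e -EFinD; congr EFin; ring.
apply: leeD => //; by rewrite adde_ge0//; apply: integral_ge0 => t _; rewrite mul0e.
Qed.

End balls_and_rays.

(** * One-dimensional integrals *)

Section one_dimensional_integrals.
Context {R : realType}.
Local Notation leb := (@lebesgue_measure R).
Implicit Types f F : R -> R.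

Lemma within_itvcc f (a b : R) :
  (forall x, a <= x <= b -> {for x, continuous f}) ->
  {within `[a, b], continuous f}.
Proof.
move=> cf; apply: continuous_in_subspaceT => x.
by rewrite inE/= in_itv/=; exact: cf.
Qed.

Lemma is_derive_cvg F (x d : R) : is_derive x 1 F d -> F z @[z --> x] --> F x.
Proof. by move=> /@ex_derive/derivable1_diffP/differentiable_continuous. Qed.

Lemma derivable_oo_LR F (a b : R) : a < b ->
  (forall x, a <= x <= b -> derivable F x 1) ->
  derivable_oo_LRcontinuous F a b.
Proof.
move=> ab dF.
have cF x : a <= x <= b -> F z @[z --> x] --> F x.
  by move=> /dF /derivable1_diffP/differentiable_continuous.
split.
- by move=> x; rewrite in_itv/= => /andP[ax xb]; apply: dF; rewrite !ltW.
- by apply: cvg_at_right_filter; apply: cF; rewrite lexx ltW.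
- by apply: cvg_at_left_filter; apply: cF; rewrite lexx ltW.
Qed.

Lemma FTC2_in f F (a b : R) : a < b ->
  (forall x, a <= x <= b -> is_derive x 1 F (f x)) ->
  (forall x, a <= x <= b -> {for x, continuous f}) ->
  (\int[leb]_(x in `[a, b]) (f x)%:E = (F b)%:E - (F a)%:E)%E.
Proof.
move=> ab dF cf; apply: continuous_FTC2 => //.
- exact: within_itvcc.
- by apply: derivable_oo_LR => // x /dF/@ex_derive.
move=> x; rewrite in_itv/= => /andP[ax xb]; rewrite derive1E.
by apply: (@derive_val _ _ _ _ _ _ _ (dF _ _)); rewrite !ltW.
Qed.

Lemma measurable_powRl (q : R) (D : set R) :
  measurable_fun D (fun t : R => t `^ q).
Proof. by apply: measurable_funTS; exact: measurable_powR. Qed.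

Lemma integral_exhaust_le (f : R -> \bar R) (F : (set R)^nat) (M : \bar R) :
  nondecreasing_seq F -> (forall k, measurable (F k)) ->
  measurable_fun (\bigcup_k F k) f -> (forall x, 0 <= f x)%E ->
  (forall k, \int[leb]_(x in F k) f x <= M)%E ->
  (\int[leb]_(x in \bigcup_k F k) f x <= M)%E.
Proof.
move=> ndF mF mf f0 FM.
have mfF k : measurable_fun (F k) f.
  by apply: measurable_funS mf; [exact: bigcup_measurable|exact: bigcup_sup].
have f0F k x : F k x -> (0 <= f x)%E by [].
have cv := @ge0_nondecreasing_set_cvg_integral _ (measurableTypeR R) R F f leb ndF mF mfF f0F.
rewrite -(cvg_lim _ cv)//; apply: lime_le; first exact: cvgP cv.
exact: nearW.
Qed.

Lemma bigcup_itv_head (c : R) : 0 < c ->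
  \bigcup_k `[c / k.+1%:R, c]%classic = `]0%R, c]%classic.
Proof.
move=> c0; apply/seteqP; split => t.
  move=> [k _]; rewrite /= !in_itv/= => /andP[kt ->]; rewrite andbT.
  by apply: lt_le_trans kt; rewrite divr_gt0.
rewrite /= in_itv/= => /andP[t0 tc].
have kP : c / t < (Num.truncn (c / t)).+1%:R by exact: truncnS_gt.
exists (Num.truncn (c / t)) => //; rewrite /= in_itv/= tc andbT.
by rewrite ler_pdivrMr// mulrC -ler_pdivrMr// ltW.
Qed.

Lemma integral_powR_head (s c : R) : 0 < s < 1 -> 0 < c ->
  (\int[leb]_(t in `]0%R, c]) (t `^ (- s))%:E <= (c `^ (1 - s) / (1 - s))%:E)%E.
Proof.
move=> /andP[s0 s1] c0; rewrite -bigcup_itv_head//.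
apply: integral_exhaust_le.
- apply/nondecreasing_seqP => k; rewrite subsetEset => t.
  rewrite /= !in_itv/= => /andP[kt ->]; rewrite andbT.
  by apply: le_trans kt; rewrite ler_pM2l// lef_pV2 ?posrE// ler_nat.
- by move=> k; exact: measurable_itv.
- by apply/measurable_EFinP; exact: measurable_powRl.
- by move=> t; rewrite lee_fin powR_ge0.
case=> [|k]; first by rewrite divr1 set_itv1 integral_set1 lee_fin divr_ge0 ?powR_ge0// subr_ge0 ltW.
have kc : c / k.+2%:R < c by rewrite ltr_pdivrMr// ltr_pMr// ltr1n.
have k0 : 0 < c / k.+2%:R by rewrite divr_gt0.
have dF x : c / k.+2%:R <= x <= c ->
    is_derive x 1 (fun t : R => t `^ (1 - s) * (1 - s)^-1) (x `^ (- s)).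
  move=> /andP[kx _]; have x0 := lt_le_trans k0 kx.
  have H := is_deriveM (is_derive1_powR (1 - s) x0) (is_derive_cst (1 - s)^-1 x 1).
  apply: (is_derive_eq H); rewrite /= scaler0 add0r /GRing.scale/=.
  rewrite mulrA mulVf ?mul1r; last by rewrite gt_eqF// subr_gt0.
  by congr (_ `^ _); ring.
rewrite (FTC2_in kc dF) => [|x /andP[kx _]].
  by rewrite -EFinB lee_fin gerBl divr_ge0 ?powR_ge0// subr_ge0 ltW.
by apply: powR_continuous; exact: lt_le_trans kx.
Qed.

Lemma powRN_cvg0 (q : R) : 0 < q -> t `^ (- q) @[t --> +oo] --> (0 : R).
Proof.
move=> q0; apply/cvgrPdist_lt => e e0; near=> t.
have t0 : 0 < t by near: t; exact: nbhs_pinfty_gt.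
rewrite sub0r normrN ger0_norm ?powR_ge0// powRN invf_plt ?posrE ?powR_gt0//.
have -> : e^-1 = (e^-1 `^ q^-1) `^ q.
  by rewrite -powRrM mulVf ?gt_eqF// powRr1// invr_ge0 ltW.
by rewrite gt0_ltr_powR// ?nnegrE ?powR_ge0 ?(ltW t0).
Unshelve. all: by end_near. Qed.

Lemma integral_powR_tail (q c : R) : 0 < q -> 0 < c ->
  (\int[leb]_(t in `[c, +oo[) (t `^ (- 1 - q))%:E = (c `^ (- q) / q)%:E)%E.
Proof.
move=> q0 c0.
have dF (x : R) : 0 < x ->
    is_derive x 1 (fun t : R => t `^ (- q) * (- q^-1)) (x `^ (- 1 - q)).
  move=> x0.
  have H := is_deriveM (is_derive1_powR (- q) x0) (is_derive_cst (- q^-1) x 1).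
  apply: (is_derive_eq H); rewrite /= scaler0 add0r /GRing.scale/=.
  rewrite mulrA mulNr mulrN opprK mulVf ?mul1r; last by rewrite gt_eqF.
  by congr (_ `^ _); ring.
rewrite (@ge0_continuous_FTC2y _ _ (fun t : R => t `^ (- q) * (- q^-1)) c 0).
- by rewrite sub0e -EFinN mulrN opprK.
- by move=> x _; exact: powR_ge0.
- apply: continuous_in_subspaceT => x; rewrite inE/= in_itv/= andbT => cx.
  by apply: powR_continuous; exact: lt_le_trans cx.
- rewrite -[X in _ --> X](mul0r (- q^-1)); apply: cvgMr_tmp.
  exact: powRN_cvg0.
- by move=> x cx; apply: (@ex_derive _ _ _ _ _ _ _ (dF _ _)); exact: lt_trans cx.
- apply: cvg_at_right_filter; exact: is_derive_cvg (dF _ c0).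
- move=> x; rewrite in_itv/= andbT => cx; rewrite derive1E.
  by apply: (@derive_val _ _ _ _ _ _ _ (dF _ _)); exact: lt_trans cx.
Qed.

(** [t^-1 * min ((t / c)^(1 - s)) ((c / t)^s)].  Being [t^-1] times a function of
    [t / c], it has an integral over [0, +oo] that does not depend on [c]; this
    is what makes bounds uniform up to the boundary of a ball. *)
Definition crossover (s c t : R) : R :=
  if t <= c then t `^ (- s) * c `^ (s - 1) else t `^ (- 1 - s) * c `^ s.

Lemma crossover_ge0 s c t : 0 <= crossover s c t.
Proof. by rewrite /crossover; case: ifP => _; rewrite mulr_ge0 ?powR_ge0. Qed.

Lemma measurable_crossover s c (D : set R) : measurable_fun D (crossover s c).
Proof.
apply: measurable_funTS; apply: measurable_fun_ifT.
- exact: measurable_fun_ler.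
- by apply: measurable_funM => //; exact: measurable_powRl.
- by apply: measurable_funM => //; exact: measurable_powRl.
Qed.

Lemma integral_crossover (s c : R) : 0 < s < 1 -> 0 < c ->
  (\int[leb]_(t in `]0%R, +oo[) (crossover s c t)%:E <=
   ((1 - s)^-1 + s^-1)%:E)%E.
Proof.
move=> s01 c0; have /andP[s0 s1] := s01.
rewrite (@itv_bndbnd_setU _ _ _ (BRight c)) ?bnd_simp ?(ltW c0)//.
have mk (D : set R) : measurable_fun D (fun t => (crossover s c t)%:E).
  by apply/measurable_EFinP; exact: measurable_crossover.
rewrite ge0_integral_setU//; last 3 first.
- exact: mk.
- by move=> t _; rewrite lee_fin crossover_ge0.
- apply/disj_setPLR => t /=; rewrite !in_itv/= andbT => /andP[_ tc].
  by apply/negP; rewrite -leNgt.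
rewrite EFinD; apply: leeD.
- rewrite (eq_integral (fun t : measurableTypeR R => (c `^ (s - 1))%:E * (t `^ (- s))%:E))%E; last first.
    move=> t; rewrite inE/= in_itv/= => /andP[_ tc].
    by rewrite /crossover tc -EFinM mulrC.
  rewrite ge0_integralZl//; last 3 first.
  + by apply/measurable_EFinP; exact: measurable_powRl.
  + by move=> t _; rewrite lee_fin powR_ge0.
  + by rewrite lee_fin powR_ge0.
  have cE : (c `^ (s - 1) * (c `^ (1 - s) / (1 - s)) = (1 - s)^-1)%R.
    rewrite mulrA -powRD; last by rewrite (gt_eqF c0) implybT.
    have -> : s - 1 + (1 - s) = 0 by ring.
    by rewrite powRr0 mul1r.
  rewrite -[leRHS]/((1 - s)^-1)%:E -cE EFinM.
  by apply: lee_wpmul2l; rewrite ?lee_fin ?powR_ge0//; exact: integral_powR_head.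
- rewrite (eq_integral (fun t : measurableTypeR R => (c `^ s)%:E * (t `^ (- 1 - s))%:E))%E; last first.
    move=> t; rewrite inE/= in_itv/= andbT => ct.
    by rewrite /crossover (lt_geF ct) -EFinM mulrC.
  rewrite ge0_integralZl//; last 3 first.
  + by apply/measurable_EFinP; exact: measurable_powRl.
  + by move=> t _; rewrite lee_fin powR_ge0.
  + by rewrite lee_fin powR_ge0.
  rewrite integral_itv_obnd_cbnd; last first.
    by apply/measurable_EFinP; exact: measurable_powRl.
  rewrite integral_powR_tail// -EFinM lee_fin mulrA -powRD; last first.
    by rewrite (gt_eqF c0) implybT.
  by rewrite subrr powRr0 mul1r.
Qed.

End one_dimensional_integrals.

(** * Principal value of the half-line profile *)

Section half_line.
Context {R : realType}.
Local Notation leb := (@lebesgue_measure R).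
Variables s p : R.
Hypothesis s01 : 0 < s < 1.
Hypothesis p2 : 2 < p.

Let s0 : 0 < s. Proof. by case/andP: s01. Qed.
Let s1 : s < 1. Proof. by case/andP: s01. Qed.
Let sle : 0 <= s <= 1. Proof. by rewrite !ltW. Qed.
Let p0 : 0 < p. Proof. by rewrite (lt_trans _ p2). Qed.
Let sp0 : 0 < s * p. Proof. exact: mulr_gt0. Qed.

(** The two halves of the integrand of the operator for [(1 + t)_+^s] at the
    point [0], as functions of the distance [t] to that point. *)
Definition hl_behind (t : R) : R :=
  (1 - ppow s (1 - t)) `^ (p - 1) * t `^ (- 1 - s * p).
Definition hl_ahead (t : R) : R :=
  ((1 + t) `^ s - 1) `^ (p - 1) * t `^ (- 1 - s * p).
(** Boundary term of the substitution that compares the two halves. *)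
Definition hl_phi (t : R) : R := (1 - (1 - t) `^ s) `^ p * t `^ (- (s * p)).

Lemma hl_behind_ge0 t : 0 <= hl_behind t.
Proof. by rewrite mulr_ge0 ?powR_ge0. Qed.

Lemma hl_ahead_ge0 t : 0 <= hl_ahead t.
Proof. by rewrite mulr_ge0 ?powR_ge0. Qed.

Lemma measurable_hl_behind (D : set R) : measurable_fun D hl_behind.
Proof.
apply: measurable_funTS; apply: measurable_funM; last exact: measurable_powRl.
apply: (measurableT_comp (measurable_powR _)); apply: measurable_funB => //.
by apply: (measurableT_comp (measurable_ppow _)); exact: measurable_funB.
Qed.

Lemma measurable_hl_ahead (D : set R) : measurable_fun D hl_ahead.
Proof.
apply: measurable_funTS; apply: measurable_funM; last exact: measurable_powRl.
apply: (measurableT_comp (measurable_powR _)); apply: measurable_funB => //.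
by apply: (measurableT_comp (measurable_powR _)); exact: measurable_funD.
Qed.

Let base_gt0 (x : R) : 0 < x < 1 -> 0 < 1 - (1 - x) `^ s.
Proof.
move=> /andP[x0 x1]; rewrite subr_gt0; apply: powR_lt1 => //.
by rewrite subr_ge0 (ltW x1)/= gtrBl.
Qed.

Let d_onem (x : R) : is_derive x 1 (fun t : R => 1 - t) (-1).
Proof.
have H := is_deriveB (is_derive_cst (1 : R) x 1) (is_derive_id x 1).
by apply: (is_derive_eq H); rewrite sub0r.
Qed.

Let continuous_onem (x : R) : {for x, continuous (fun t : R => 1 - t)}.
Proof. by apply: cvgB; [exact: cvg_cst|exact: cvg_id]. Qed.

Let continuous_hl_behind (x : R) : 0 < x < 1 -> {for x, continuous
  (fun t : R => (1 - (1 - t) `^ s) `^ (p - 1) * t `^ (- 1 - s * p))}.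
Proof.
move=> x01; have /andP[x0 x1] := x01.
apply: continuousM; last exact: powR_continuous.
apply: (@continuous_comp R R R (fun t : R => 1 - (1 - t) `^ s) (fun y : R => y `^ (p - 1))).
  apply: (@continuous_comp R R R (fun t : R => (1 - t) `^ s) (fun y : R => 1 - y)) => //.
  apply: (@continuous_comp R R R (fun t : R => 1 - t) (fun y : R => y `^ s)) => //.
  by apply: powR_continuous; rewrite subr_gt0.
by apply: powR_continuous; exact: base_gt0.
Qed.

Let continuous_hl_ahead (x : R) : 0 < x -> {for x, continuous hl_ahead}.
Proof.
move=> x0; apply: continuousM; last exact: powR_continuous.
apply: (@continuous_comp R R R (fun t : R => (1 + t) `^ s - 1) (fun y : R => y `^ (p - 1))).
  apply: (@continuous_comp R R R (fun t : R => (1 + t) `^ s) (fun y : R => y - 1)).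
    apply: (@continuous_comp R R R (fun t : R => 1 + t) (fun y : R => y `^ s)).
      by apply: cvgD; [exact: cvg_cst|exact: cvg_id].
    by apply: powR_continuous; rewrite addr_gt0.
  by apply: cvgB; [exact: cvg_id|exact: cvg_cst].
by apply: powR_continuous; rewrite subr_gt0 powR_gt1// ltrDl.
Qed.

Let dphi (x : R) : 0 < x < 1 -> is_derive x 1 hl_phi
  ((s * p) * (hl_behind x * ((1 - x) `^ (s - 1) - 1))).
Proof.
move=> x01; have /andP[x0 x1] := x01.
have onem_gt0 : 0 < 1 - x by rewrite subr_gt0.
have d1 := d_onem x.
have d2 := @is_derive1_comp R (fun y => y `^ s) (fun t => 1 - t) x _ _
  (is_derive1_powR s onem_gt0) d1.
have d3 : is_derive x 1 (fun t : R => 1 - (1 - t) `^ s) (s * (1 - x) `^ (s - 1)).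
  have H := is_deriveB (is_derive_cst (1 : R) x 1) d2.
  by apply: (is_derive_eq H); rewrite sub0r /GRing.scale/= mulrN1 opprK.
have d4 := @is_derive1_comp R (fun y => y `^ p) (fun t => 1 - (1 - t) `^ s) x
  _ _ (is_derive1_powR p (base_gt0 x01)) d3.
have H := is_deriveM d4 (is_derive1_powR (- (s * p)) x0).
apply: (is_derive_eq H); rewrite /GRing.scale/= /hl_behind ppowE ?(ltW onem_gt0)//.
have e1 : (1 - (1 - x) `^ s) `^ p =
    (1 - (1 - x) `^ s) * (1 - (1 - x) `^ s) `^ (p - 1).
  by rewrite mulr_powRB1// ltW// base_gt0.
have e2 : x `^ (- (s * p)) = x * x `^ (- 1 - s * p).
  by rewrite -{2}(powRr1 (ltW x0)) -powRD ?(gt_eqF x0) ?implybT//; congr (_ `^ _); ring.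
have e3 : (1 - x) `^ s = (1 - x) * (1 - x) `^ (s - 1) by rewrite mulr_powRB1// ltW.
have e4 : - (s * p) - 1 = - 1 - s * p by ring.
rewrite e4 e1 e2; move: (_ `^ (p - 1)) (_ `^ (-1 - s * p)) => A B.
by rewrite e3; move: (_ `^ (s - 1)) => D; ring.
Qed.

(** In terms of the distance [y] to the end point of the half-line this is the
    inversion [y |-> y^-1], with [y = 1 - t] behind the base point and
    [y = 1 + F t] ahead of it. *)
Let F (t : R) : R := (1 - t)^-1 - 1.

Let dF (x : R) : x < 1 -> is_derive x 1 F ((1 - x) ^- 2).
Proof.
move=> x1; have onem : 1 - x != 0 by rewrite gt_eqF// subr_gt0.
have d1 := d_onem x.
have d2 := @is_deriveV R (fun t => 1 - t) x _ 1 onem d1.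
have H := is_deriveB d2 (is_derive_cst (1 : R) x 1).
by apply: (is_derive_eq H); rewrite subr0 /GRing.scale/= mulrN1 opprK.
Qed.

Let derivF (x : R) : x < 1 -> F^`()%classic x = (1 - x) ^- 2.
Proof. by move=> x1; rewrite derive1E; have [_ ->] := dF x1. Qed.

Let continuous_dF (x : R) : x < 1 -> {for x, continuous F^`()%classic}.
Proof.
move=> x1; rewrite /prop_for /continuous_at derivF//.
apply: (@cvg_trans _ ((1 - y) ^- 2 @[y --> x])).
  apply: near_eq_cvg; near=> y; rewrite derivF//.
  by near: y; exact: lt_nbhsl.
have nz : (1 - x) ^+ 2 != 0 by rewrite expf_neq0// gt_eqF// subr_gt0.
have dX := @is_deriveX R R (fun t => 1 - t) 2 x 1 _ (d_onem x).
exact: is_derive_cvg (@is_deriveV R (fun t => (1 - t) ^+ 2) x _ 1 nz dX).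
Unshelve. all: by end_near. Qed.

Let ltF (x y : R) : y < 1 -> x < y -> F x < F y.
Proof.
move=> y1 xy; rewrite ltrD2r ltf_pV2 ?posrE ?subr_gt0//.
  by rewrite ltrD2l ltrN2.
exact: lt_trans y1.
Qed.

Let FE (x : R) : x < 1 -> F x = x / (1 - x).
Proof. by move=> x1; rewrite /F; field; rewrite gt_eqF// subr_gt0. Qed.

Let F_gt0 (x : R) : 0 < x < 1 -> 0 < F x.
Proof. by move=> /andP[x0 x1]; rewrite FE// divr_gt0// subr_gt0. Qed.

Let jacobian (x : R) : 0 < x < 1 ->
  hl_ahead (F x) * F^`()%classic x = hl_behind x * (1 - x) `^ (s - 1).
Proof.
move=> x01; have /andP[x0 x1] := x01; have a0 : 0 < 1 - x by rewrite subr_gt0.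
rewrite derivF// /hl_ahead /hl_behind ppowE ?(ltW a0)//.
have b0 := base_gt0 x01.
have -> : 1 + F x = (1 - x) `^ (-1) by rewrite powR_inv1 ?(ltW a0)// /F; ring.
rewrite FE// -(powR_inv1 (ltW a0)).
set a := 1 - x in a0 b0 *.
have -> : (a `^ (-1)) `^ s - 1 = (1 - a `^ s) * a `^ (- s).
  rewrite -powRrM mulN1r mulrBl mul1r -powRD ?(gt_eqF a0) ?implybT//.
  by rewrite subrr powRr0.
have -> : a ^- 2 = a `^ (- 2) by rewrite powR_invn// ltW.
rewrite (@powRM _ _ _ (p - 1) (ltW b0) (powR_ge0 _ _)).
rewrite (@powRM _ _ _ (- 1 - s * p) (ltW x0) (powR_ge0 _ _)) -!powRrM.
rewrite [LHS](_ : _ = (1 - a `^ s) `^ (p - 1) * x `^ (- 1 - s * p) *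
  (a `^ (- s * (p - 1)) * a `^ (-1 * (- 1 - s * p)) * a `^ (- 2))); last by ring.
congr (_ * _); rewrite -!powRD ?(gt_eqF a0) ?implybT//.
by congr (_ `^ _); ring.
Qed.

Let onem_powR_ge1 (x : R) : 0 < x < 1 -> 1 <= (1 - x) `^ (s - 1).
Proof.
move=> /andP[x0 x1]; have -> : s - 1 = - (1 - s) by ring.
rewrite powRN invf_ge1 ?powR_gt0 ?subr_gt0//.
by apply: powR_le1; rewrite ?subr_ge0 ?(ltW s1) ?(ltW x1)//= gerBl ltW.
Qed.

(** The inversion carries the half ahead to the half behind weighted by
    [(1 - t)^(s - 1)]; the surplus of the weight over [1] has [hl_phi / (s p)]
    as a primitive. *)
Lemma hl_substitution (e x : R) : 0 < e -> e < x -> x < 1 ->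
  (\int[leb]_(t in `[e, x]) (hl_behind t)%:E +
     ((hl_phi x - hl_phi e) / (s * p))%:E =
   \int[leb]_(t in `[F e, F x]) (hl_ahead t)%:E)%E.
Proof.
move=> e0 ex x1.
have in01 t : e <= t <= x -> 0 < t < 1.
  by move=> /andP[et tx]; rewrite (lt_le_trans e0 et) (le_lt_trans tx x1).
rewrite (@integration_by_substitution_increasing R F hl_ahead e x (ltW ex)).
- pose d t := hl_behind t * ((1 - t) `^ (s - 1) - 1).
  have -> : (((hl_phi x - hl_phi e) / (s * p))%:E =
             \int[leb]_(t in `[e, x]) (d t)%:E)%E.
    pose d0 t : R := (1 - (1 - t) `^ s) `^ (p - 1) * t `^ (- 1 - s * p) *
      ((1 - t) `^ (s - 1) - 1).
    have dd0 t : e <= t <= x -> d t = d0 t.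
      move=> /in01/andP[_ t1].
      by rewrite /d /hl_behind ppowE// subr_ge0 ltW.
    rewrite (eq_integral (fun t : measurableTypeR R => (d0 t)%:E)); last first.
      by move=> t; rewrite inE/= in_itv/= => /dd0 ->.
    have spn0 : s * p != 0 by rewrite gt_eqF.
    have dP t : e <= t <= x -> is_derive t 1 (fun t => hl_phi t / (s * p)) (d0 t).
      move=> et; have H := is_deriveM (dphi (in01 _ et))
        (is_derive_cst ((s * p)^-1) t 1).
      apply: (is_derive_eq H); rewrite scaler0 add0r /GRing.scale/= -dd0//.
      by rewrite mulKf.
    rewrite (FTC2_in ex dP) => [|t /in01 t01]; first by rewrite -EFinB -mulrBl.
    apply: continuousM; first exact: continuous_hl_behind.
    apply: (@continuous_comp R R R (fun t : R => (1 - t) `^ (s - 1)) (fun y : R => y - 1)).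
      apply: (@continuous_comp R R R (fun t : R => 1 - t) (fun y : R => y `^ (s - 1))) => //.
      by apply: powR_continuous; rewrite subr_gt0; case/andP: t01.
    by apply: cvgB; [exact: cvg_id|exact: cvg_cst].
  have md : measurable_fun [set: R] d.
    apply: measurable_funM; first exact: measurable_hl_behind.
    apply: measurable_funB => //; apply: (measurableT_comp (measurable_powR _)).
    exact: measurable_funB.
  rewrite -ge0_integralD//; last 4 first.
  + by move=> t _; rewrite lee_fin hl_behind_ge0.
  + by apply/measurable_EFinP; exact: measurable_hl_behind.
  + move=> t; rewrite /= in_itv/= => /in01 t01.
    by rewrite lee_fin mulr_ge0 ?hl_behind_ge0// subr_ge0 onem_powR_ge1.
  + by apply/measurable_EFinP; exact: measurable_funTS.
  apply: eq_integral => t; rewrite inE/= in_itv/= => /in01 t01.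
  rewrite -EFinD; congr EFin; rewrite -[RHS]/(hl_ahead (F t) * F^`()%classic t) jacobian//.
  by rewrite /d; ring.
- move=> a b; rewrite !in_itv/= => _ /andP[_ bx]; apply: ltF.
  exact: le_lt_trans x1.
- move=> t; rewrite in_itv/= => /andP[_ tx]; apply: continuous_dF.
  exact: lt_trans x1.
- apply: (@cvgP _ _ (F^`()%classic e)); apply: cvg_at_right_filter.
  by apply: continuous_dF; exact: lt_trans x1.
- apply: (@cvgP _ _ (F^`()%classic x)); apply: cvg_at_left_filter.
  exact: continuous_dF.
- apply: derivable_oo_LR => // t /andP[_ tx].
  by have [] := dF (le_lt_trans tx x1).
- apply: within_itvcc => t /andP[Fet _]; apply: continuous_hl_ahead.
  by apply: lt_le_trans Fet; apply: F_gt0; rewrite e0 (lt_trans ex).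
Qed.

Let x_ (k : nat) : R := 1 - k.+3%:R^-1.

Let onem_x k : 1 - x_ k = k.+3%:R^-1.
Proof. by rewrite /x_ opprB addrCA subrr addr0. Qed.

Let x_lt1 k : x_ k < 1.
Proof. by rewrite /x_ gtrBl invr_gt0. Qed.

Let F_x k : F (x_ k) = k.+2%:R.
Proof. by rewrite /F onem_x invrK -(natrB _ (isT : 0 < k.+3)%N) subn1. Qed.

Let inv3_cvg0 : (k.+3%:R^-1 : R) @[k --> \oo] --> (0 : R).
Proof.
have := @cvg_harmonic R; rewrite -(cvg_shiftn 2).
by under eq_fun do rewrite addn2.
Qed.

Let phi_cvg1 : hl_phi (x_ k) @[k --> \oo] --> (1 : R).
Proof.
have h : (1 - y `^ s) `^ p * (1 - y) `^ (- (s * p)) @[y --> 0^'+] --> (1 : R).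
  have l1 (g : R -> R) q : g y @[y --> 0^'+] --> (0 : R) ->
      (1 - g y) `^ q @[y --> 0^'+] --> (1 : R).
    move=> g0; have e1 : 1 `^ q = 1 :> R by rewrite powR1.
    rewrite -[X in _ --> X]e1.
    apply: (@cvg_comp _ _ _ (fun y => 1 - g y) (fun z => z `^ q) _ (nbhs (1 : R))).
      have := cvgB (cvg_cst (1 : R)) g0; rewrite subr0; exact.
    exact: powR_continuous.
  rewrite -[X in _ --> X](mulr1 1); apply: cvgM; apply: l1; first exact: powR_cvg0.
  by apply: cvg_at_right_filter; exact: cvg_id.
have {}h := (cvg_at_rightP _ _ _).1 h (fun k => k.+3%:R^-1).
have -> : (fun k => hl_phi (x_ k)) = (fun k => (1 - k.+3%:R^-1 `^ s) `^ p *
    (1 - k.+3%:R^-1) `^ (- (s * p))).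
  by apply/funext => k; rewrite /hl_phi onem_x.
by apply: h; split => // k; rewrite invr_gt0.
Qed.

(** Exactness of the half-line profile: with the cut-off moved by the
    inversion, the two halves of the principal value differ only by the
    boundary term [hl_phi]. *)
Lemma hl_balance (e : R) : 0 < e <= 2^-1 ->
  (\int[leb]_(t in `[e, +oo[) (hl_behind t)%:E =
   \int[leb]_(t in `[(e / (1 - e))%R, +oo[) (hl_ahead t)%:E +
   (hl_phi e / (s * p))%:E)%E.
Proof.
move=> /andP[e0 e12].
have e1 : e < 1 by lra.
rewrite -FE//.
have ex k : e < x_ k.
  rewrite /x_ ltrBrDr -ltrBrDl; apply: (@le_lt_trans _ _ 3^-1).
    by rewrite lef_pV2 ?posrE// ler_nat.
  by lra.
have mb D : measurable_fun D (fun t => (hl_behind t)%:E).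
  by apply/measurable_EFinP; exact: measurable_hl_behind.
have ma D : measurable_fun D (fun t => (hl_ahead t)%:E).
  by apply/measurable_EFinP; exact: measurable_hl_ahead.
have b0 t : (0 <= (hl_behind t)%:E)%E by rewrite lee_fin hl_behind_ge0.
have a0 t : (0 <= (hl_ahead t)%:E)%E by rewrite lee_fin hl_ahead_ge0.
have le_x i j : (i <= j)%N -> x_ i <= x_ j.
  by move=> ij; rewrite /x_ lerD2l lerN2 lef_pV2 ?posrE// ler_nat.
have UA : \bigcup_k `[e, x_ k]%classic = `[e, 1[%classic.
  apply/seteqP; split => t.
    move=> [k _]; rewrite /= !in_itv/= => /andP[-> tx].
    exact: le_lt_trans (x_lt1 k).
  rewrite /= in_itv/= => /andP[et t1].
  exists (Num.truncn (1 - t)^-1) => //; rewrite /= in_itv/= et /x_/= lerBrDr -lerBrDl.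
  rewrite -[leRHS]invrK lef_pV2 ?posrE ?invr_gt0 ?subr_gt0//.
  apply/ltW/(lt_le_trans (truncnS_gt _)).
  by rewrite ler_nat (leqW (leqnSn _)).
have UB : \bigcup_k `[F e, F (x_ k)]%classic = `[F e, +oo[%classic.
  apply/seteqP; split => t.
    by move=> [k _]; rewrite /= !in_itv/= andbT => /andP[->].
  rewrite /= in_itv/= andbT => et; exists (Num.truncn t) => //.
  rewrite /= in_itv/= et F_x; apply/ltW/(lt_le_trans (truncnS_gt _)).
  by rewrite ler_nat leqnSn.
have cA : (\int[leb]_(t in `[e, x_ k]) (hl_behind t)%:E)%E @[k --> \oo] -->
    (\int[leb]_(t in `[e, 1%R[) (hl_behind t)%:E)%E.
  rewrite -UA; apply: (@ge0_nondecreasing_set_cvg_integral _ (measurableTypeR R)) => //.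
  - apply/nondecreasing_seqP => k; rewrite subsetEset => t.
    rewrite /= !in_itv/= => /andP[-> tx]; apply: le_trans tx _.
    exact: le_x.
  - by move=> k; exact: mb.
have cB : (\int[leb]_(t in `[F e, F (x_ k)]) (hl_ahead t)%:E)%E @[k --> \oo] -->
    (\int[leb]_(t in `[F e, +oo[) (hl_ahead t)%:E)%E.
  rewrite -UB; apply: (@ge0_nondecreasing_set_cvg_integral _ (measurableTypeR R)) => //.
  - apply/nondecreasing_seqP => k; rewrite subsetEset => t.
    rewrite /= !in_itv/= => /andP[-> tx]; apply: le_trans tx _.
    by rewrite !F_x ler_nat.
  - by move=> k; exact: ma.
have cP : ((hl_phi (x_ k) - hl_phi e) / (s * p))%:E @[k --> \oo] -->
    ((1 - hl_phi e) / (s * p))%:E.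
  apply: cvg_EFin; first exact: nearW.
  by apply: cvgMr_tmp; apply: cvgB => //; exact: cvg_cst.
have AB : (\int[leb]_(t in `[e, 1%R[) (hl_behind t)%:E +
    ((1 - hl_phi e) / (s * p))%:E = \int[leb]_(t in `[F e, +oo[) (hl_ahead t)%:E)%E.
  have /cvgeD/(_ cA cP) cAP : (\int[leb]_(t in `[e, 1%R[) (hl_behind t)%:E +?
      ((1 - hl_phi e) / (s * p))%:E)%E by rewrite fin_num_adde_defl.
  rewrite -(cvg_lim _ cAP)// -(cvg_lim _ cB)//; congr (limn _).
  by apply/funext => k; exact: hl_substitution.
rewrite (@itv_bndbnd_setU _ _ _ (BLeft 1%R)) ?bnd_simp ?(ltW e1)//.
rewrite ge0_integral_setU//; [|exact: mb|]; last first.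
  apply/disj_setPLR => t /=; rewrite !in_itv/= andbT => /andP[_ t1].
  by apply/negP; rewrite -ltNge.
rewrite -AB -addeA; congr (_ + _)%E.
rewrite (eq_integral (fun t : measurableTypeR R => (t `^ (- 1 - s * p))%:E)).
  rewrite integral_powR_tail// powR1 -EFinD; congr EFin.
  by rewrite -mulrDl subrK.
move=> t; rewrite inE/= in_itv/= andbT => t1.
rewrite /hl_behind ppow0 ?gt_eqF// ?subr_le0// subr0 powR1 mul1r//.
Qed.

Let gamma_gt0 : 0 < p - s * p.
Proof. by rewrite subr_gt0 gtr_pMl. Qed.

Let hl_phi_le (e : R) : 0 < e <= 2^-1 -> 0 <= hl_phi e <= e `^ (p - s * p).
Proof.
move=> /andP[e0 e12]; have e01 : 0 < e < 1 by rewrite e0/=; lra.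
rewrite /hl_phi mulr_ge0 ?powR_ge0//= [leRHS]powRB ?(gt_eqF e0) ?implybT//.
rewrite powRN ler_wpM2r ?invr_ge0 ?powR_ge0//.
rewrite ge0_ler_powR ?(ltW p0)// ?nnegrE ?(ltW e0) ?(ltW (base_gt0 e01))//.
rewrite lerBlDr -lerBlDl; apply: powR_conc => //.
by case/andP: e01 => ? ?; apply/andP; split; lra.
Qed.

Let hl_ahead_le (e t : R) : 0 < e -> e <= t <= 2 * e ->
  hl_ahead t <= (2 * e) `^ (p - 1) * e `^ (- 1 - s * p).
Proof.
move=> e0 /andP[et t2e]; have t0 := lt_le_trans e0 et.
apply: ler_pM; rewrite ?powR_ge0//.
  have p10 : 0 <= p - 1 by move: p2; lra.
  rewrite ge0_ler_powR// ?nnegrE.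
  - by rewrite subr_ge0; apply/ltW/powR_gt1; rewrite ?ltrDl.
  - by rewrite mulr_ge0// ltW.
  apply: le_trans t2e; rewrite lerBlDr addrC.
  by apply: ler1_powR; rewrite ?lerDr ltW.
have -> : - 1 - s * p = - (1 + s * p) by ring.
rewrite !powRN lef_pV2 ?posrE ?powR_gt0//.
by rewrite ge0_ler_powR ?nnegrE ?addr_ge0 ?(ltW sp0) ?(ltW e0) ?(ltW t0).
Qed.

(** Consequently the principal value of the half-line profile, with the
    symmetric cut-off at distance [e], is of order [e^(p - s p)]. *)
Lemma hl_balance_le (e : R) : 0 < e <= 2^-1 ->
  let K := ((2 `^ p + (s * p)^-1) * e `^ (p - s * p))%:E in
  (\int[leb]_(t in `[e, +oo[) (hl_behind t)%:E <=
     \int[leb]_(t in `[e, +oo[) (hl_ahead t)%:E + K)%E /\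
  (\int[leb]_(t in `[e, +oo[) (hl_ahead t)%:E <=
     \int[leb]_(t in `[e, +oo[) (hl_behind t)%:E + K)%E.
Proof.
move=> e01 /=; have /andP[phi0 phi1] := hl_phi_le e01.
have /andP[e0 e12] := e01.
have e1 : e < 1 by lra.
have b0 t : (0 <= (hl_behind t)%:E)%E by rewrite lee_fin hl_behind_ge0.
have a0 t : (0 <= (hl_ahead t)%:E)%E by rewrite lee_fin hl_ahead_ge0.
have ma D : measurable_fun D (fun t => (hl_ahead t)%:E).
  by apply/measurable_EFinP; exact: measurable_hl_ahead.
have eFe : e <= e / (1 - e) by rewrite ler_pdivlMr ?subr_gt0// ler_piMr ?ltW// gtrBl.
have Fe2 : e / (1 - e) <= 2 * e.
  by rewrite ler_pdivrMr ?subr_gt0//; nra.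
have Feg : e / (1 - e) - e <= 2 * e * e.
  rewrite lerBlDr ler_pdivrMr ?subr_gt0//; nra.
rewrite hl_balance//; split.
  apply: leeD.
    apply: ge0_subset_integral => //; first exact: ma.
    by move=> t; rewrite /= !in_itv/= !andbT; exact: le_trans.
  rewrite lee_fin mulrDl -[leLHS]add0r; apply: lerD.
    by rewrite mulr_ge0 ?powR_ge0.
  by rewrite mulrC ler_wpM2l// invr_ge0 ltW.
rewrite (@itv_bndbnd_setU _ _ (BLeft e) (BLeft (e / (1 - e)))) ?bnd_simp//.
rewrite ge0_integral_setU//; [|exact: ma|]; last first.
  apply/disj_setPLR => t /=; rewrite !in_itv/= andbT => /andP[_ t1].
  by apply/negP; rewrite -ltNge.
rewrite [leLHS]addeC -[leRHS]addeA; apply: leeD => //.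
apply: (@le_trans _ _ ((2 `^ p * e `^ (p - s * p))%:E)); last first.
  rewrite -EFinD lee_fin mulrDl addrCA lerDl addr_ge0 ?mulr_ge0 ?powR_ge0//;
    by rewrite ?invr_ge0 ltW.
apply: (@le_trans _ _ (\int[leb]_(t in `[e, (e / (1 - e))%R[)
    ((2 * e) `^ (p - 1) * e `^ (- 1 - s * p))%:E)%E).
  apply: ge0_le_integral => //; first exact: ma.
  move=> t; rewrite /= in_itv/= => /andP[et /ltW te].
  by rewrite lee_fin hl_ahead_le// et (le_trans te).
rewrite integral_cst//= lebesgue_measure_itv/= lte_fin.
case: ifPn => [_|_]; last by rewrite mule0 lee_fin mulr_ge0 ?powR_ge0.
rewrite -EFinB -EFinM lee_fin.
apply: (@le_trans _ _ ((2 * e) `^ (p - 1) * e `^ (- 1 - s * p) * (2 * e * e))).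
  by rewrite ler_wpM2l// mulr_ge0 ?powR_ge0.
rewrite -(@mulr_powRB1 _ 2 p)//.
have -> : e `^ (p - s * p) = e `^ (p - 1) * e `^ (- 1 - s * p) * (e * e).
  rewrite -{4 5}(powRr1 (ltW e0)) -!powRD ?(gt_eqF e0) ?implybT//.
  by congr (_ `^ _); ring.
by rewrite powRM ?(ltW e0)// le_eqVlt; apply/orP; left; apply/eqP; ring.
Qed.

End half_line.

(** * The operator on half-space and ball profiles *)

Section profiles.
Context {R : realType} {n : nat}.
Local Notation leb := (@lebesgue_measure R).
Local Notation lebn := (lebesgue_rV R n.+1).
Variables s p : R.
Hypothesis s01 : 0 < s < 1.
Hypothesis p2 : 2 < p.
Implicit Types x y e g : 'rV[R]_n.+1.

Let s0 : 0 < s. Proof. by case/andP: s01. Qed.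
Let s1 : s < 1. Proof. by case/andP: s01. Qed.
Let sle : 0 <= s <= 1. Proof. by rewrite !ltW. Qed.
Let p0 : 0 < p. Proof. by rewrite (lt_trans _ p2). Qed.
Let p10 : 0 < p - 1. Proof. by move: p2; lra. Qed.
Let p20 : 0 < p - 2. Proof. by move: p2; lra. Qed.
Let sp0 : 0 < s * p. Proof. exact: mulr_gt0. Qed.

Definition ker x y : R := (enorm (x - y) `^ (n.+1%:R + s * p))^-1.

Lemma ker_ge0 x y : 0 <= ker x y. Proof. by rewrite invr_ge0 powR_ge0. Qed.

Lemma measurable_ker x : measurable_fun [set: 'rV[R]_n.+1] (ker x).
Proof.
have -> : ker x = (fun y => enorm (x - y) `^ (- (n.+1%:R + s * p))).
  by apply/funext => y; rewrite powRN.
by apply: (measurableT_comp (measurable_powR _)); exact: measurable_enormB.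
Qed.

Lemma enorm_line x e t : enorm e = 1 -> 0 <= t -> enorm (x - (x + t *: e)) = t.
Proof.
by move=> e1 t0; rewrite opprD addNKr enormN enormZ e1 mulr1 ger0_norm.
Qed.

Lemma ker_line x e t : enorm e = 1 -> 0 < t ->
  ker x (x + t *: e) * t ^+ n = t `^ (- 1 - s * p).
Proof.
move=> e1 t0; rewrite /ker enorm_line ?(ltW t0)// -powRN -powR_mulrn ?(ltW t0)//.
rewrite -powRD ?(gt_eqF t0) ?implybT//; congr (_ `^ _).
by rewrite -natr1; ring.
Qed.

Lemma measurableC_eball x (eps : R) : measurable (~` eball x eps).
Proof. by apply: measurableC; exact: measurable_eball. Qed.

(** Outside the cut-off ball, the kernel turns rays into one-dimensional
    integrals against [t^(- 1 - s p)]. *)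
Lemma ray_ker x e eps (f : 'rV[R]_n.+1 -> R) (F : R -> R) :
  enorm e = 1 -> 0 < eps -> (forall t, 0 < t -> f (x + t *: e) = F t) ->
  (ray ((fun y => (f y * ker x y)%:E) \_ (~` eball x eps)) x e =
   \int[leb]_(t in `[eps, +oo[) (F t * t `^ (- 1 - s * p))%:E)%E.
Proof.
move=> e1 eps0 fF; rewrite /ray integral_mkcond [RHS]integral_mkcond.
apply: eq_integral => t _; rewrite !patchE.
have [t0|t0] := boolP (t \in `]0%R, +oo[%classic); last first.
  rewrite memNset//; move: t0; rewrite notin_setE/= !in_itv/= !andbT.
  by move=> t0 et; apply: t0; exact: lt_le_trans et.
have {}t0 : 0 < t by move: t0; rewrite inE/= in_itv/= andbT.
have [et|te] := leP eps t.
  rewrite !mem_set/=; first by rewrite -EFinM -mulrA ker_line// fF.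
    by rewrite in_itv/= et.
  by rewrite /eball/= enorm_line ?(ltW t0)//; apply/negP; rewrite -leNgt.
rewrite !memNset/= ?mul0e//.
  by rewrite in_itv/= andbT; apply/negP; rewrite -ltNge.
by rewrite /eball/= enorm_line ?(ltW t0)// => /negP; rewrite -leNgt leNgt te.
Qed.

Lemma integral_tail_scale (f : R -> R) (a eps : R) : 0 < a ->
  measurable_fun [set: R] f -> (forall t, 0 <= f t) ->
  (\int[leb]_(t in `[eps, +oo[) (f (a * t)%R)%:E =
   (a^-1)%:E * \int[leb]_(t in `[(a * eps)%R, +oo[) (f t)%:E)%E.
Proof.
move=> a0 mf f0; rewrite integral_mkcond [X in (_ * X)%E]integral_mkcond.
set h := ((fun t => (f t)%:E) \_ `[(a * eps)%R, +oo[).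
have mh : measurable_fun [set: R] h.
  apply/(measurable_restrictT _ _).1; first exact: measurable_itv.
  by apply/measurable_EFinP; exact: measurable_funTS.
have h0 t : (0 <= h t)%E by apply: erestrict_ge0 => u _; rewrite lee_fin.
have an0 : a != 0 by rewrite gt_eqF.
rewrite (ge0_integral_affine 0 an0 mh h0) muleA -EFinM gtr0_norm// mulVf// mul1e.
apply: eq_integral => t _; rewrite /h !patchE add0r; congr (if _ then _ else _).
by apply/idP/idP; rewrite !inE/= !in_itv/= !andbT ler_pM2l.
Qed.

Lemma integral_ker_le x eps (f : 'rV[R]_n.+1 -> R) (C : R) :
  0 <= C -> 0 < eps ->
  measurable_fun [set: 'rV[R]_n.+1] f -> (forall y, 0 <= f y) ->
  (forall e, enorm e = 1 -> exists F : R -> R,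
    [/\ measurable_fun [set: R] F, forall t, 0 <= F t,
        forall t, eps <= t -> f (x + t *: e) * t `^ (- 1 - s * p) <= F t &
        (\int[leb]_(t in `[eps, +oo[) (F t)%:E <= C%:E)%E]) ->
  (\int[lebn]_(y in ~` eball x eps) (f y * ker x y)%:E <=
   (C * 4 ^+ n.+1)%:E)%E.
Proof.
move=> C0 eps0 mf f0 fF; rewrite integral_mkcond.
apply: (@integral_rays_le _ _ _ x) => //.
- apply/(measurable_restrictT _ _).1; first exact: measurableC_eball.
  apply/measurable_EFinP; apply: measurable_funTS.
  by apply: measurable_funM => //; exact: measurable_ker.
- by apply: erestrict_ge0 => y _; rewrite lee_fin mulr_ge0 ?ker_ge0.
move=> e e1; have [F [mF F0 fFe FC]] := fF e e1.
rewrite (ray_ker (F := fun t => f (x + t *: e)) e1 eps0)//.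
apply: le_trans FC; apply: ge0_le_integral => //.
- by move=> t _; rewrite lee_fin mulr_ge0 ?powR_ge0.
- apply/measurable_EFinP; apply: measurable_funTS; apply: measurable_funM.
    by apply: (measurableT_comp mf); exact: measurable_line.
  exact: measurable_powRl.
- by apply/measurable_EFinP; exact: measurable_funTS.
- by move=> t; rewrite /= in_itv/= andbT => et; rewrite lee_fin fFe.
Qed.

(** Half-space profile [L_+^s] with [L] affine, [L x = q0], of slope [g]. *)
Definition hsp x (q0 : R) g y : R := ppow s (q0 + dot g (y - x)).

Lemma measurable_dotB x g :
  measurable_fun [set: 'rV[R]_n.+1] (fun y => dot g (y - x)).
Proof.
apply: measurable_sum => i; apply: measurable_funM => //.
under eq_fun do rewrite !mxE.
by apply: measurable_funB => //; exact: measurable_rV_coord.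
Qed.

Lemma measurable_hsp x q0 g : measurable_fun [set: 'rV[R]_n.+1] (hsp x q0 g).
Proof.
apply: (measurableT_comp (measurable_ppow _)); apply: measurable_funD => //.
exact: measurable_dotB.
Qed.

Lemma hsp_line x q0 g e t : hsp x q0 g (x + t *: e) = ppow s (q0 + t * dot g e).
Proof. by rewrite /hsp addrAC subrr add0r dotZr. Qed.

Section half_space.
Variables (x g : 'rV[R]_n.+1) (q0 : R).
Hypothesis q0_gt0 : 0 < q0.

Let D y : R := spow p (q0 `^ s - hsp x q0 g y).

Let D_line e t : D (x + t *: e) = spow p (q0 `^ s - ppow s (q0 + t * dot g e)).
Proof. by rewrite /D hsp_line. Qed.

Let mD : measurable_fun [set: 'rV[R]_n.+1] D.
Proof.
apply: (measurableT_comp (measurable_spow _)); apply: measurable_funB => //.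
exact: measurable_hsp.
Qed.

Let P eps := (fun y => (Num.max (D y) 0 * ker x y)%:E) \_ (~` eball x eps).
Let N eps := (fun y => (Num.max (- D y) 0 * ker x y)%:E) \_ (~` eball x eps).

Let c (a : R) : R := (q0 `^ s) `^ (p - 1) * a `^ (s * p).

Let pow_scale (a t : R) : 0 < a -> 0 < t ->
  t `^ (- 1 - s * p) = a * (a `^ (s * p)) * (a * t) `^ (- 1 - s * p).
Proof.
move=> a0 t0; rewrite powRM ?(ltW a0) ?(ltW t0)// mulrA.
rewrite -{1}(powRr1 (ltW a0)) -!powRD ?(gt_eqF a0) ?implybT//.
have -> : 1 + s * p + (- 1 - s * p) = 0 by ring.
by rewrite powRr0 mul1r.
Qed.

Let ppow_scale k t : 0 <= k -> ppow s (k * t) = k `^ s * ppow s t.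
Proof.
move=> k0; rewrite /ppow -{1}(mulr0 k) -maxr_pMr// powRM//.
by rewrite le_max lexx.
Qed.

Let ray0 (f : 'rV[R]_n.+1 -> R) e eps : enorm e = 1 -> 0 < eps ->
  (forall t, 0 < t -> f (x + t *: e) = 0) ->
  ray ((fun y => (f y * ker x y)%:E) \_ (~` eball x eps)) x e = 0%E.
Proof.
move=> e1 eps0 f0; rewrite (ray_ker e1 eps0 f0).
by under eq_integral do rewrite mul0r; exact: integral0.
Qed.

Let ray_scale (f : 'rV[R]_n.+1 -> R) (h : R -> R) e eps (a : R) :
  enorm e = 1 -> 0 < eps -> 0 < a -> measurable_fun [set: R] h ->
  (forall t, 0 <= h t) ->
  (forall t, 0 < t -> f (x + t *: e) * t `^ (- 1 - s * p) =
    c a * a * h (a * t)) ->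
  ray ((fun y => (f y * ker x y)%:E) \_ (~` eball x eps)) x e =
  ((c a)%:E * \int[leb]_(t in `[(a * eps)%R, +oo[) (h t)%:E)%E.
Proof.
move=> e1 eps0 a0 mh h0 fh.
have c0 : 0 <= c a by rewrite mulr_ge0 ?powR_ge0.
rewrite (ray_ker (F := fun t => f (x + t *: e)) e1 eps0)//.
rewrite (eq_integral (fun t : measurableTypeR R =>
    (c a * a)%:E * (h (a * t))%:E)%E); last first.
  move=> t; rewrite inE/= in_itv/= andbT => et.
  by rewrite fh ?EFinM// (lt_le_trans eps0).
rewrite ge0_integralZl//; last 3 first.
- apply/measurable_EFinP; apply: measurable_funTS.
  by apply: (measurableT_comp mh); exact: measurable_funM.
- by move=> t _; rewrite lee_fin.
- by rewrite lee_fin mulr_ge0// ltW.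
rewrite integral_tail_scale// muleA -EFinM -mulrA mulfV ?mulr1//.
by rewrite gt_eqF.
Qed.

Let rays_pos e (eps : R) : enorm e = 1 -> 0 < eps -> 0 < dot g e ->
  let a := dot g e / q0 in
  [/\ ray (P eps) x e = 0%E,
      ray (P eps) x (- e) = ((c a)%:E *
        \int[leb]_(t in `[(a * eps)%R, +oo[) (hl_behind s p t)%:E)%E,
      ray (N eps) x e = ((c a)%:E *
        \int[leb]_(t in `[(a * eps)%R, +oo[) (hl_ahead s p t)%:E)%E &
      ray (N eps) x (- e) = 0%E].
Proof.
move=> e1 eps0 b0 a; have a0 : 0 < a by rewrite divr_gt0.
have ba : dot g e = q0 * a by rewrite /a mulrC divfK// gt_eqF.
clearbody a.
have q0s : 0 <= q0 `^ s := powR_ge0 _ _.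
have e1' : enorm (- e) = 1 by rewrite enormN.
have ahead (t : R) : 0 < t ->
    D (x + t *: e) = - ((q0 `^ s) `^ (p - 1) * ((1 + a * t) `^ s - 1) `^ (p - 1)).
  move=> t0; rewrite D_line ba.
  have -> : q0 + t * (q0 * a) = q0 * (1 + a * t) by ring.
  rewrite ppow_scale ?(ltW q0_gt0)// ppowE ?addr_ge0 ?mulr_ge0 ?(ltW a0) ?(ltW t0)//.
  have -> : q0 `^ s - q0 `^ s * (1 + a * t) `^ s =
    - (q0 `^ s * ((1 + a * t) `^ s - 1)) by ring.
  rewrite spowN spowM// spowE// subr_ge0; apply/ltW/powR_gt1 => //.
  by rewrite ltrDl mulr_gt0.
have behind (t : R) : 0 < t -> D (x + t *: - e) =
    (q0 `^ s) `^ (p - 1) * (1 - ppow s (1 - a * t)) `^ (p - 1).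
  move=> t0; rewrite D_line -(scaleN1r e) dotZr ba.
  have -> : q0 + t * (-1 * (q0 * a)) = q0 * (1 - a * t) by ring.
  rewrite ppow_scale ?(ltW q0_gt0)// -{1}(mulr1 (q0 `^ s)) -mulrBr.
  rewrite spowM// spowE// subr_ge0.
  apply: (@le_trans _ _ (ppow s 1)); last by rewrite ppowE// powR1.
  by apply: ppow_le; rewrite ?(ltW s0)// gerBl mulr_ge0 ?(ltW a0) ?(ltW t0).
have aheadN (t : R) : 0 < t -> D (x + t *: e) <= 0.
  by move=> t0; rewrite ahead// oppr_le0 mulr_ge0 ?powR_ge0.
have behindP (t : R) : 0 < t -> 0 <= D (x + t *: - e).
  by move=> t0; rewrite behind// mulr_ge0 ?powR_ge0.
split.
- by apply: ray0 => // t t0; rewrite max_r// aheadN.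
- apply: ray_scale => //.
  + exact: measurable_hl_behind.
  + exact: hl_behind_ge0.
  + move=> t t0; rewrite max_l ?behindP// behind// /hl_behind (pow_scale a0 t0).
    by rewrite /c; ring.
- apply: ray_scale => //.
  + exact: measurable_hl_ahead.
  + exact: hl_ahead_ge0.
  + move=> t t0; rewrite max_l ?oppr_ge0 ?aheadN// ahead// opprK /hl_ahead.
    by rewrite (pow_scale a0 t0) /c; ring.
- by apply: ray0 => // t t0; rewrite max_r// oppr_le0 behindP.
Qed.

Let pv_const (eps : R) : R := (2 `^ p + (s * p)^-1) *
  ((q0 `^ s) `^ (p - 1) * (enorm g / q0) `^ p * eps `^ (p - s * p)).

Let mP eps : measurable_fun [set: 'rV[R]_n.+1] (P eps).
Proof.
apply/(measurable_restrictT _ _).1; first exact: measurableC_eball.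
apply/measurable_EFinP; apply: measurable_funTS; apply: measurable_funM.
  exact: measurable_maxr.
exact: measurable_ker.
Qed.

Let mN eps : measurable_fun [set: 'rV[R]_n.+1] (N eps).
Proof.
apply/(measurable_restrictT _ _).1; first exact: measurableC_eball.
apply/measurable_EFinP; apply: measurable_funTS; apply: measurable_funM.
  by apply: measurable_maxr => //; exact: measurable_funN.
exact: measurable_ker.
Qed.

Let P_ge0 eps y : (0 <= P eps y)%E.
Proof. by apply: erestrict_ge0 => z _; rewrite lee_fin mulr_ge0 ?ker_ge0// le_max lexx orbT. Qed.

Let N_ge0 eps y : (0 <= N eps y)%E.
Proof. by apply: erestrict_ge0 => z _; rewrite lee_fin mulr_ge0 ?ker_ge0// le_max lexx orbT. Qed.

Let pv_const_ge0 eps : 0 <= pv_const eps.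
Proof. by rewrite !mulr_ge0 ?addr_ge0 ?powR_ge0// invr_ge0 ltW. Qed.

Let rays_le e (eps : R) : enorm e = 1 -> 0 < eps -> 2 * (eps * enorm g) <= q0 ->
  (ray (P eps) x e + ray (P eps) x (- e) <=
    ray (N eps) x e + ray (N eps) x (- e) + (2 * pv_const eps)%:E)%E /\
  (ray (N eps) x e + ray (N eps) x (- e) <=
    ray (P eps) x e + ray (P eps) x (- e) + (2 * pv_const eps)%:E)%E.
Proof.
move=> + eps0 small; wlog b0 : e / 0 <= dot g e.
  move=> H e1; have [/H|/ltW b0] := leP 0 (dot g e); first exact.
  have b0' : 0 <= dot g (- e) by rewrite -scaleN1r dotZr mulN1r oppr_ge0.
  have := H (- e) b0'; rewrite enormN opprK => /(_ e1).
  move: (ray (P eps) x e) (ray (P eps) x (- e)) (ray (N eps) x e).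
  by move: (ray (N eps) x (- e)) => d a b c'; rewrite (addeC b) (addeC d).
move=> e1; have [b0'|bn0] := eqVneq (dot g e) 0.
  have D0 t : D (x + t *: e) = 0.
    by rewrite D_line b0' mulr0 addr0 ppowE ?(ltW q0_gt0)// subrr /spow mulr0.
  have D0' t : D (x + t *: - e) = 0 by rewrite scalerN -scaleNr D0.
  rewrite !ray0 ?enormN//; last 4 first.
  - by move=> t _; rewrite D0' oppr0 maxxx.
  - by move=> t _; rewrite D0 oppr0 maxxx.
  - by move=> t _; rewrite D0' maxxx.
  - by move=> t _; rewrite D0 maxxx.
  by rewrite !add0e lee_fin mulr_ge0 ?pv_const_ge0.
have {bn0}b0 : 0 < dot g e by rewrite lt_neqAle eq_sym bn0.
have [-> -> -> ->] := rays_pos e1 eps0 b0.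
set a := dot g e / q0; have a0 : 0 < a by rewrite divr_gt0.
have ag : a <= enorm g / q0.
  rewrite ler_wpM2r ?invr_ge0 ?(ltW q0_gt0)//.
  by have := dot_le_enorm g e; rewrite e1 mulr1.
have ae : 0 < a * eps <= 2^-1.
  rewrite mulr_gt0//=; apply: (@le_trans _ _ (enorm g / q0 * eps)).
    by rewrite ler_wpM2r// ltW.
  rewrite mulrAC ler_pdivrMr//; lra.
have c0 : (0 <= (c a)%:E)%E by rewrite lee_fin mulr_ge0 ?powR_ge0.
have [le1 le2] := hl_balance_le s01 p2 ae.
have K2 : ((c a)%:E * ((2 `^ p + (s * p)^-1) * (a * eps) `^ (p - s * p))%:E <=
    (2 * pv_const eps)%:E)%E.
  rewrite -EFinM lee_fin; apply: (@le_trans _ _ (pv_const eps)); last first.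
    by rewrite ler_peMl ?pv_const_ge0// ler1n.
  rewrite /pv_const /c mulrCA ler_wpM2l//.
    by rewrite addr_ge0 ?powR_ge0// invr_ge0 ltW.
  rewrite powRM ?(ltW a0) ?(ltW eps0)// !mulrA ler_wpM2r ?powR_ge0//.
  rewrite -mulrA ler_wpM2l ?powR_ge0// -powRD ?(gt_eqF a0) ?implybT//.
  have -> : s * p + (p - s * p) = p by ring.
  by rewrite ge0_ler_powR ?(ltW p0) ?nnegrE ?(ltW a0)// divr_ge0 ?enorm_ge0// ltW.
rewrite !adde0 !add0e; split.
- apply: le_trans (lee_wpmul2l c0 le1) _.
  by rewrite ge0_muleDr ?leeD2l// ?lee_fin ?mulr_ge0 ?addr_ge0 ?powR_ge0 ?invr_ge0 ?(ltW sp0)//;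
    apply: integral_ge0 => t _; rewrite lee_fin hl_ahead_ge0.
- apply: le_trans (lee_wpmul2l c0 le2) _.
  by rewrite ge0_muleDr ?leeD2l// ?lee_fin ?mulr_ge0 ?addr_ge0 ?powR_ge0 ?invr_ge0 ?(ltW sp0)//;
    apply: integral_ge0 => t _; rewrite lee_fin hl_behind_ge0.
Qed.

Let D_holder e t : enorm e = 1 -> 0 <= t ->
  `|D (x + t *: e)| <= (enorm g * t) `^ (s * (p - 1)).
Proof.
move=> e1 t0; rewrite D_line norm_spow// powRrM.
rewrite ge0_ler_powR ?(ltW p10) ?nnegrE ?powR_ge0//.
rewrite -(ppowE s (ltW q0_gt0)); apply: le_trans (ppow_holder _ _ sle) _.
rewrite ge0_ler_powR ?(ltW s0) ?nnegrE ?mulr_ge0 ?enorm_ge0//.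
rewrite opprD addNKr normrN normrM mulrC (ger0_norm t0) ler_wpM2r//.
by have := norm_dot_le g e; rewrite e1 mulr1.
Qed.

Lemma integrable_hsp eps : 0 < eps ->
  lebn.-integrable (~` eball x eps)
    (fun y => (spow p (q0 `^ s - hsp x q0 g y) * ker x y)%:E).
Proof.
move=> eps0; apply/integrableP; split.
  apply/measurable_EFinP; apply: measurable_funTS; apply: measurable_funM => //.
  exact: measurable_ker.
pose C := enorm g `^ (s * (p - 1)) * (eps `^ (- s) / s).
apply: (@le_lt_trans _ _ (C * 4 ^+ n.+1)%:E); last exact: ltry.
rewrite (eq_integral (fun y => (`|D y| * ker x y)%:E)); last first.
  by move=> y _; rewrite /= normrM (ger0_norm (ker_ge0 _ _)).
apply: integral_ker_le => //.
- by rewrite mulr_ge0 ?divr_ge0 ?powR_ge0// ltW.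
- exact: (measurableT_comp (@normr_measurable R setT) mD).
move=> e e1; exists (fun t => enorm g `^ (s * (p - 1)) * t `^ (- 1 - s)); split.
- by apply: measurable_funM => //; exact: measurable_powRl.
- by move=> t; rewrite mulr_ge0 ?powR_ge0.
- move=> t et; have t0 := lt_le_trans eps0 et.
  apply: le_trans (ler_wpM2r (powR_ge0 _ _) (D_holder e1 (ltW t0))) _.
  rewrite powRM ?enorm_ge0 ?(ltW t0)// -mulrA ler_wpM2l ?powR_ge0//.
  rewrite -powRD ?(gt_eqF t0) ?implybT//.
  by rewrite le_eqVlt; apply/orP; left; apply/eqP; congr (_ `^ _); ring.
- under eq_integral do rewrite EFinM.
  rewrite ge0_integralZl//; last 2 first.
  + by move=> t _; rewrite lee_fin powR_ge0.
  + by rewrite lee_fin powR_ge0.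
  + by rewrite integral_powR_tail// EFinM.
  + by apply/measurable_EFinP; exact: measurable_powRl.
Qed.

(** The half-space profile is a solution: its principal value at [x] is [0],
    quantitatively in the cut-off. *)
Lemma halfspace_pv eps : 0 < eps -> 2 * (eps * enorm g) <= q0 ->
  (`|\int[lebn]_(y in ~` eball x eps)
      (spow p (q0 `^ s - hsp x q0 g y) * ker x y)%:E| <=
    ((2 `^ p + (s * p)^-1) * ((q0 `^ s) `^ (p - 1) * (enorm g / q0) `^ p *
      eps `^ (p - s * p)) * 4 ^+ n.+1)%:E)%E.
Proof.
move=> eps0 small; rewrite -/(pv_const eps) integralE.
have PE : (\int[lebn]_(y in ~` eball x eps)
    (fun y => (D y * ker x y)%:E)^\+ y = \int[lebn]_y P eps y)%E.
  rewrite [RHS](_ : _ = \int[lebn]_(y in ~` eball x eps)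
      (Num.max (D y) 0 * ker x y)%:E)%E; last by rewrite [RHS]integral_mkcond.
  apply: eq_integral => y _; rewrite funeposE -EFin_max; congr EFin.
  by rewrite maxr_pMl ?ker_ge0// mul0r.
have NE : (\int[lebn]_(y in ~` eball x eps)
    (fun y => (D y * ker x y)%:E)^\- y = \int[lebn]_y N eps y)%E.
  rewrite [RHS](_ : _ = \int[lebn]_(y in ~` eball x eps)
      (Num.max (- D y) 0 * ker x y)%:E)%E; last by rewrite [RHS]integral_mkcond.
  apply: eq_integral => y _; rewrite funenegE -EFinN -EFin_max; congr EFin.
  by rewrite maxr_pMl ?ker_ge0// mul0r mulNr.
have Pfin := integrable_pos_fin_num (measurableC_eball x eps) (integrable_hsp eps0).
have Nfin := integrable_neg_fin_num (measurableC_eball x eps) (integrable_hsp eps0).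
have C0 := pv_const_ge0 eps.
have PN : (\int[lebn]_y P eps y <=
    \int[lebn]_y N eps y + (pv_const eps * 4 ^+ n.+1)%:E)%E.
  by apply: (@le_integral_rays_add _ _ _ _ x) => // e e1;
    have [] := rays_le e1 eps0 small.
have NP : (\int[lebn]_y N eps y <=
    \int[lebn]_y P eps y + (pv_const eps * 4 ^+ n.+1)%:E)%E.
  by apply: (@le_integral_rays_add _ _ _ _ x) => // e e1;
    have [] := rays_le e1 eps0 small.
move: Pfin Nfin PN NP; rewrite {}PE {}NE.
move: (\int[lebn]_y P eps y)%E (\int[lebn]_y N eps y)%E => a b.
move=> /fineK <- /fineK <-; move: (fine a) (fine b) => {}a {}b.
rewrite -!EFinD abse_EFin !lee_fin => h1 h2.
by rewrite ler_norml; apply/andP; split; lra.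
Qed.

End half_space.

Section ball.
Variables (y0 : 'rV[R]_n.+1) (r : R).
Hypothesis r0 : 0 < r.

Definition ball_quad y : R := 1 - (enorm (y - y0) / r) ^+ 2.

(** Ball profile [(1 - |y - y0|^2 / r^2)_+^s]. *)
Definition bar y : R := ppow s (ball_quad y).

Definition ball_slope x : 'rV[R]_n.+1 := (- (2 / r ^+ 2)) *: (x - y0).

Lemma ball_quad_le1 y : ball_quad y <= 1.
Proof. by rewrite gerBl sqr_ge0. Qed.

Lemma bar_le1 y : bar y <= 1.
Proof.
by apply: powR_le1; rewrite ?(ltW s0)// le_max lexx ge_max ler01 ball_quad_le1.
Qed.

Lemma measurable_bar : measurable_fun [set: 'rV[R]_n.+1] bar.
Proof.
apply: (measurableT_comp (measurable_ppow _)); apply: measurable_funB => //.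
apply: measurable_funX; apply: measurable_funM => //.
by under eq_fun do rewrite enormB; exact: measurable_enormB.
Qed.

Lemma ball_quad_taylor x y : ball_quad y =
  ball_quad x + dot (ball_slope x) (y - x) - (enorm (y - x) / r) ^+ 2.
Proof.
rewrite /ball_quad /ball_slope !expr_div_n !enorm_sqr dotZl.
have -> : y - y0 = (x - y0) + (y - x) by rewrite [RHS]addrC addrA subrK.
move: (x - y0) (y - x) => a b; rewrite !(dotDl, dotDr) (dotC b a).
by field; rewrite gt_eqF.
Qed.

Lemma bar_le_hsp x y : bar y <= hsp x (ball_quad x) (ball_slope x) y.
Proof. by apply: ppow_le; rewrite ?(ltW s0)// (ball_quad_taylor x y) gerBl sqr_ge0. Qed.

Lemma enorm_ball_slope x : enorm (x - y0) <= r -> enorm (ball_slope x) <= 2 / r.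
Proof.
move=> xr; rewrite enormZ normrN ger0_norm ?divr_ge0 ?sqr_ge0//.
have -> : 2 / r = 2 / r ^+ 2 * r by field; rewrite gt_eqF.
by rewrite ler_wpM2l// divr_ge0// sqr_ge0.
Qed.

(** The ball profile lies below the half-space profile of its tangent, and they
    agree at [x]; this is the resulting surplus in the integrand of the
    operator. *)
Definition excess x y : R := spow p (ball_quad x `^ s - bar y) -
  spow p (ball_quad x `^ s - hsp x (ball_quad x) (ball_slope x) y).

Lemma excess_ge0 x y : 0 <= excess x y.
Proof. by rewrite subr_ge0 spow_le// lerD2l lerN2 bar_le_hsp. Qed.

Lemma measurable_excess x : measurable_fun [set: 'rV[R]_n.+1] (excess x).
Proof.
apply: measurable_funB; apply: (measurableT_comp (measurable_spow _));
  apply: measurable_funB => //; [exact: measurable_bar|exact: measurable_hsp].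
Qed.

(** On a line through [x] at signed distance [t] the quadratic
    [q + b t - t^2 / r^2] vanishes at some [c > 0]; by concavity [q + b t]
    compares with the linear function [t c / r^2] on either side of [c]. *)
Let exit_time (q b : R) : 0 < q -> exists2 c : R, 0 < c & q + b * c = (c / r) ^+ 2.
Proof.
move=> q_gt0; set d := Num.sqrt (b ^+ 2 + 4 * q / r ^+ 2).
have q4 : 0 < 4 * q / r ^+ 2 by rewrite divr_gt0 ?mulr_gt0 ?exprn_gt0.
have d2 : d ^+ 2 = b ^+ 2 + 4 * q / r ^+ 2.
  by rewrite sqr_sqrtr// addr_ge0 ?sqr_ge0 ?ltW.
have bd : `|b| < d.
  by rewrite -(@ltr_pXn2r _ 2)// ?nnegrE ?sqrtr_ge0// d2 real_normK ?num_real// ltrDl.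
have bd0 : 0 < b + d by move: bd; rewrite ltr_norml => /andP[]; lra.
exists (r ^+ 2 * (b + d) / 2); first by rewrite divr_gt0 ?mulr_gt0 ?exprn_gt0.
have -> : q = r ^+ 2 * (d ^+ 2 - b ^+ 2) / 4.
  by rewrite d2; field; rewrite gt_eqF.
by field; rewrite gt_eqF.
Qed.

Let drop_bound (q b c t : R) : 0 < q -> 0 < c -> q + b * c = (c / r) ^+ 2 ->
  0 < t -> ppow s (q + b * t) - ppow s (q + b * t - (t / r) ^+ 2) <=
  r `^ (- (2 * s)) * (t `^ (1 + 2 * s) * crossover s c t).
Proof.
move=> q_gt0 c0 cE t0; have tc0 : 0 < t * c by rewrite mulr_gt0.
have rt : 0 <= (t / r) ^+ 2 by rewrite sqr_ge0.
have r2 (a : R) : (r ^+ 2) `^ a = r `^ (2 * a).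
  by rewrite -powR_mulrn ?ltW// -powRrM.
have lin : q + b * t - (t / c) * (c / r) ^+ 2 = q * (1 - t / c).
  by rewrite -cE; field; rewrite gt_eqF.
have linE : (t / c) * (c / r) ^+ 2 = t * c / r ^+ 2.
  by field; rewrite !gt_eqF.
have tcr0 : 0 < t * c / r ^+ 2 by rewrite divr_gt0 ?exprn_gt0.
rewrite /crossover; case: ifPn => [tc|]; last rewrite -ltNge => ct.
  have le_a : t * c / r ^+ 2 <= q + b * t.
    rewrite -subr_ge0 -linE lin mulr_ge0 ?(ltW q_gt0)// subr_ge0.
    by rewrite ler_pdivrMr// mul1r.
  have a0 : 0 < q + b * t := lt_le_trans tcr0 le_a.
  apply: le_trans (ppow_drop sle rt a0) _.
  apply: (@le_trans _ _ ((t / r) ^+ 2 * (t * c / r ^+ 2) `^ (s - 1))).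
    rewrite ler_wpM2l//; have -> : s - 1 = - (1 - s) by ring.
    rewrite !powRN lef_pV2 ?posrE ?powR_gt0//.
    by rewrite ge0_ler_powR ?nnegrE ?subr_ge0 ?(ltW s1) ?(ltW a0) ?(ltW tcr0).
  rewrite expr_div_n !powRM ?invr_ge0 ?sqr_ge0 ?(ltW t0) ?(ltW c0) ?(ltW tc0)//.
  have -> : (r ^+ 2)^-1 `^ (s - 1) = r `^ (2 * (1 - s)).
    by rewrite -powR_inv1 ?sqr_ge0// -powRrM r2; congr (_ `^ _); ring.
  have -> : t ^+ 2 / r ^+ 2 * (t `^ (s - 1) * c `^ (s - 1) * r `^ (2 * (1 - s))) =
    (t ^+ 2 * t `^ (s - 1)) * c `^ (s - 1) * ((r ^+ 2)^-1 * r `^ (2 * (1 - s))) by ring.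
  rewrite -(powR_invn 2 (ltW r0)) -(powR_mulrn 2 (ltW t0)).
  rewrite -!powRD ?(gt_eqF t0) ?(gt_eqF r0) ?implybT//.
  rewrite [leRHS](_ : _ = t `^ (1 + 2 * s) * t `^ (- s) * c `^ (s - 1) * r `^ (- (2 * s)));
    last by ring.
  rewrite -powRD ?(gt_eqF t0) ?implybT//.
  by rewrite le_eqVlt; apply/orP; left; apply/eqP; congr (_ `^ _ * _ * _ `^ _); ring.
have a_le : q + b * t <= t * c / r ^+ 2.
  rewrite -subr_le0 -linE lin mulr_ge0_le0 ?(ltW q_gt0)// subr_le0.
  by rewrite ler_pdivlMr// mul1r ltW.
apply: (@le_trans _ _ (ppow s (q + b * t))); first by rewrite gerBl ppow_ge0.
apply: (le_trans (ppow_le (ltW s0) a_le)); rewrite ppowE ?(ltW tcr0)//.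
rewrite !powRM ?invr_ge0 ?sqr_ge0 ?(ltW t0) ?(ltW c0) ?(ltW tc0)//.
have -> : (r ^+ 2)^-1 `^ s = r `^ (- (2 * s)).
  by rewrite -powR_inv1 ?sqr_ge0// -powRrM r2; congr (_ `^ _); ring.
rewrite [leRHS](_ : _ = t `^ (1 + 2 * s) * t `^ (- 1 - s) * c `^ s * r `^ (- (2 * s)));
  last by ring.
rewrite -powRD ?(gt_eqF t0) ?implybT//.
by rewrite le_eqVlt; apply/orP; left; apply/eqP; congr (_ `^ _ * _ * _ `^ _); ring.
Qed.

Let excess_line x e (c t : R) : enorm (x - y0) < r -> enorm e = 1 -> 0 < c ->
  ball_quad x + dot (ball_slope x) e * c = (c / r) ^+ 2 -> 0 < t ->
  excess x (x + t *: e) * t `^ (- 1 - s * p) <=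
  (p - 1) * 3 `^ (s * (p - 2)) * r `^ (- (s * p)) * crossover s c t.
Proof.
move=> xr e1 c0 cE t0.
have q_gt0 : 0 < ball_quad x.
  rewrite subr_gt0 expr_lt1 ?divr_ge0 ?enorm_ge0 ?(ltW r0)//.
  by rewrite ltr_pdivrMr// mul1r.
set q := ball_quad x in cE q_gt0 *; set b := dot _ e in cE.
have b2 : `|b| <= 2 / r.
  apply: le_trans (norm_dot_le _ _) _; rewrite e1 mulr1.
  by apply: enorm_ball_slope; exact: ltW.
have tr0 : 0 < t / r by rewrite divr_gt0.
have xyE : x + t *: e - x = t *: e by rewrite addrAC subrr add0r.
have barE : bar (x + t *: e) = ppow s (q + b * t - (t / r) ^+ 2).
  rewrite /bar (ball_quad_taylor x) xyE dotZr -/b mulrC enormZ e1 mulr1.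
  by rewrite (gtr0_norm t0).
have hspE : hsp x q (ball_slope x) (x + t *: e) = ppow s (q + b * t).
  by rewrite hsp_line -/b mulrC.
have qE : q `^ s = ppow s q by rewrite ppowE// ltW.
pose M := (3 * (t / r)) `^ s.
have tr3 : 0 <= 3 * (t / r) by apply: mulr_ge0 => //; exact: ltW.
have trb : `|b * t| <= 2 * (t / r).
  rewrite normrM (gtr0_norm t0) mulrCA [leRHS]mulrC ler_wpM2r ?(ltW t0)//.
have Y_le : `|q `^ s - hsp x q (ball_slope x) (x + t *: e)| <= M.
  rewrite hspE qE; apply: le_trans (ppow_holder _ _ sle) _.
  rewrite ge0_ler_powR ?(ltW s0) ?nnegrE ?tr3//.
  rewrite opprD addNKr normrN; apply: le_trans trb _.
  by rewrite ler_wpM2r ?(ltW tr0)// ler_nat.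
have X_le : `|q `^ s - bar (x + t *: e)| <= M.
  have [tr1|tr1] := leP (t / r) 1.
    rewrite barE qE; apply: le_trans (ppow_holder _ _ sle) _.
    rewrite ge0_ler_powR ?(ltW s0) ?nnegrE ?tr3//.
    have -> : q - (q + b * t - (t / r) ^+ 2) = (t / r) ^+ 2 - b * t by ring.
    apply: le_trans (ler_normB _ _) _; rewrite ger0_norm ?sqr_ge0//.
    have : (t / r) ^+ 2 <= t / r by rewrite expr2 ler_piMr ?(ltW tr0).
    by move: trb; lra.
  apply: (@le_trans _ _ 1).
    have q1 : 0 <= q `^ s <= 1 by rewrite qE ppow_ge0 bar_le1.
    have b1 : 0 <= bar (x + t *: e) <= 1 by rewrite ppow_ge0 bar_le1.
    by rewrite ler_norml; move: q1 b1 => /andP[? ?] /andP[? ?]; apply/andP; split; lra.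
  have -> : 1 = 1 `^ s :> R by rewrite powR1.
  rewrite ge0_ler_powR ?(ltW s0) ?nnegrE ?tr3//.
  by lra.
rewrite /excess -/q.
have le_XY : q `^ s - hsp x q (ball_slope x) (x + t *: e) <=
    q `^ s - bar (x + t *: e) by rewrite lerD2l lerN2 bar_le_hsp.
apply: le_trans (ler_wpM2r (powR_ge0 _ _) (spow_lip p2 X_le Y_le le_XY)) _.
have -> : q `^ s - bar (x + t *: e) -
    (q `^ s - hsp x q (ball_slope x) (x + t *: e)) =
    ppow s (q + b * t) - ppow s (q + b * t - (t / r) ^+ 2).
  by rewrite -barE hspE; ring.
have C0 : 0 <= (p - 1) * M `^ (p - 2) by rewrite mulr_ge0 ?powR_ge0 ?ltW.
apply: le_trans (ler_wpM2r (powR_ge0 _ _)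
  (ler_wpM2l C0 (drop_bound q_gt0 c0 cE t0))) _.
have ME : M `^ (p - 2) =
    3 `^ (s * (p - 2)) * (t `^ (s * (p - 2)) * r `^ (- (s * (p - 2)))).
  rewrite /M -powRrM powRM ?(ltW tr0)// powRM ?(ltW t0) ?invr_ge0 ?(ltW r0)//.
  by rewrite -[r^-1]powR_inv1 ?(ltW r0)// -powRrM mulN1r.
rewrite ME; set k := crossover s c t; set T := 3 `^ _.
rewrite [leLHS](_ : _ = (p - 1) * T *
  (t `^ (s * (p - 2)) * t `^ (1 + 2 * s) * t `^ (- 1 - s * p)) *
  (r `^ (- (s * (p - 2))) * r `^ (- (2 * s))) * k); last by ring.
rewrite -!powRD ?(gt_eqF t0) ?(gt_eqF r0) ?implybT//.
have -> : s * (p - 2) + (1 + 2 * s) + (- 1 - s * p) = 0 by ring.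
have -> : - (s * (p - 2)) + - (2 * s) = - (s * p) by ring.
by rewrite powRr0 mulr1.
Qed.

Definition excess_const : R :=
  (p - 1) * 3 `^ (s * (p - 2)) * ((1 - s)^-1 + s^-1) * 4 ^+ n.+1.

Lemma excess_const_ge0 : 0 <= excess_const.
Proof.
rewrite !mulr_ge0 ?powR_ge0 ?exprn_ge0 ?(ltW p10)//.
by rewrite addr_ge0// invr_ge0 ?subr_ge0 ltW.
Qed.

(** Along every line the surplus is at most a multiple of [crossover], whose
    integral does not see the exit time; hence a bound that does not degenerate
    as [x] approaches the sphere. *)
Lemma integral_excess_le x eps : enorm (x - y0) < r -> 0 < eps ->
  (\int[lebn]_(y in ~` eball x eps) (excess x y * ker x y)%:E <=
   (excess_const * r `^ (- (s * p)))%:E)%E.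
Proof.
move=> xr eps0.
have q_gt0 : 0 < ball_quad x.
  rewrite subr_gt0 expr_lt1 ?divr_ge0 ?enorm_ge0 ?(ltW r0)//.
  by rewrite ltr_pdivrMr// mul1r.
pose K := (p - 1) * 3 `^ (s * (p - 2)) * r `^ (- (s * p)).
have K0 : 0 <= K by rewrite !mulr_ge0 ?powR_ge0// ltW.
have S0 : 0 <= (1 - s)^-1 + s^-1 by rewrite addr_ge0// invr_ge0 ?subr_ge0 ltW.
have -> : excess_const * r `^ (- (s * p)) = K * ((1 - s)^-1 + s^-1) * 4 ^+ n.+1.
  by rewrite /excess_const /K; ring.
apply: integral_ker_le => //.
- exact: mulr_ge0.
- exact: measurable_excess.
- exact: excess_ge0.
move=> e e1; have [c c0 cE] := exit_time (dot (ball_slope x) e) q_gt0.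
exists (fun t => K * crossover s c t); split.
- by apply: measurable_funM => //; exact: measurable_crossover.
- by move=> t; rewrite mulr_ge0 ?crossover_ge0.
- by move=> t et; apply: excess_line => //; exact: lt_le_trans et.
have mc (D : set R) : measurable_fun D (fun t => (crossover s c t)%:E).
  by apply/measurable_EFinP; exact: measurable_crossover.
under eq_integral do rewrite EFinM.
rewrite ge0_integralZl//;
  [|exact: mc|by move=> t _; rewrite lee_fin crossover_ge0].
rewrite [leRHS]EFinM; apply: lee_wpmul2l; first by rewrite lee_fin.
apply: le_trans (integral_crossover s01 c0).
apply: ge0_subset_integral => //.
- exact: mc.
- by move=> t _; rewrite lee_fin crossover_ge0.
- by move=> t; rewrite /= !in_itv/= !andbT; exact: lt_le_trans.
Qed.

End ball.

End profiles.

(** * Touching from below *)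

(** The integral of [g] may be infinite, and then both sides are [-oo]. *)
Lemma integral_sub_ge0 d (T : measurableType d) (R : realType)
    (mu : {measure set T -> \bar R}) (D : set T) (f g : T -> R) :
  measurable D -> mu.-integrable D (EFin \o f) -> measurable_fun D g ->
  (forall x, D x -> 0 <= g x) ->
  (\int[mu]_(x in D) (f x - g x)%:E =
   \int[mu]_(x in D) (f x)%:E - \int[mu]_(x in D) (g x)%:E)%E.
Proof.
move=> mD intf mg g0.
have mf : measurable_fun D f by apply/measurable_EFinP; exact: measurable_int intf.
have mgE : measurable_fun D (EFin \o g) by exact/measurable_EFinP.
have [gfin|ginf] := ltP (\int[mu]_(x in D) (g x)%:E)%E +oo%E.
  have intg : mu.-integrable D (EFin \o g).
    apply/integrableP; split => //.
    rewrite (eq_integral (fun x => (g x)%:E))// => x; rewrite inE => Dx.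
    by rewrite /= ger0_norm// g0.
  by rewrite -integralB//; apply: eq_integral => x _; rewrite EFinB.
have ffin : (\int[mu]_(x in D) (f x)%:E)%E \is a fin_num by exact: integrable_fin_num.
move: ginf; rewrite leye_eq => /eqP ginf; rewrite ginf.
have -> : (\int[mu]_(x in D) (f x)%:E - +oo = -oo)%E by rewrite -(fineK ffin).
have mfg : measurable_fun D (fun x => (f x - g x)%:E).
  by apply/measurable_EFinP; exact: measurable_funB.
rewrite integralE.
have posfin : (\int[mu]_(x in D) (fun x => (f x - g x)%:E)^\+ x < +oo)%E.
  apply: le_lt_trans (integral_funepos_lt_pinfty mD intf).
  apply: ge0_le_integral => //.
  - exact: measurable_funepos.
  - by apply: measurable_funepos; exact/measurable_EFinP.
  move=> x Dx; rewrite !funeposE -!EFin_max lee_fin ge_max !le_max lexx orbT andbT.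
  by rewrite gerBl g0.
have neginf : (\int[mu]_(x in D) (fun x => (f x - g x)%:E)^\- x = +oo)%E.
  apply/eqP; rewrite -leye_eq -ginf leNgt; apply/negP => neglt.
  have : (\int[mu]_(x in D) (g x)%:E < +oo)%E.
    apply: (@le_lt_trans _ _ (\int[mu]_(x in D) ((EFin \o f)^\+ x +
        (fun x => (f x - g x)%:E)^\- x))%E).
      apply: ge0_le_integral => //.
      - apply: emeasurable_funD.
          by apply: measurable_funepos; exact/measurable_EFinP.
        exact: measurable_funeneg.
      move=> x Dx; rewrite funeposE funenegE -EFinN -!EFin_max -EFinD lee_fin.
      by rewrite !maxEle; case: ifP; case: ifP; lra.
    rewrite ge0_integralD//.
    - apply: lte_add_pinfty; first exact: integral_funepos_lt_pinfty.
      by rewrite -ginf.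
    - by apply: measurable_funepos; exact/measurable_EFinP.
    - exact: measurable_funeneg.
  by rewrite ginf ltxx.
rewrite neginf; move: posfin.
by move: (integral _ _ _) => []// r'.
Qed.

Section contact.
Context {R : realType} {n : nat}.
Local Notation lebn := (lebesgue_rV R n.+1).
Variables s p : R.
Hypothesis s01 : 0 < s < 1.
Hypothesis p2 : 2 < p.
Implicit Types x y : 'rV[R]_n.+1.

Let s0 : 0 < s. Proof. by case/andP: s01. Qed.
Let s1 : s < 1. Proof. by case/andP: s01. Qed.
Let p0 : 0 < p. Proof. by rewrite (lt_trans _ p2). Qed.
Let p10 : 0 < p - 1. Proof. by move: p2; lra. Qed.
Let sp0 : 0 < s * p. Proof. exact: mulr_gt0. Qed.

Variables (y0 x : 'rV[R]_n.+1) (r : R).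
Hypothesis r0 : 0 < r.
Hypothesis xr : enorm (x - y0) < r.
Variables (u : 'rV[R]_n.+1 -> R) (k : R).
Hypothesis mu : measurable_fun [set: 'rV[R]_n.+1] u.
Hypothesis k0 : 0 < k.
Hypothesis touch : forall y,
  u x - u y <= k * (bar s y0 r x - bar s y0 r y).
Variables (A : set 'rV[R]_n.+1) (delta eps1 : R).
Hypothesis mA : measurable A.
Hypothesis delta0 : 0 <= delta.
Hypothesis eps10 : 0 < eps1.
Hypothesis farA : forall y, A y -> eps1 <= enorm (x - y).
Hypothesis gainA : forall y, A y ->
  spow p (u x - u y) <= spow p (k * (bar s y0 r x - bar s y0 r y)) - delta.

Let q := ball_quad y0 r x.
Let g := ball_slope y0 r x.
Let K := k `^ (p - 1).
Let C (eps : R) := ~` eball x eps.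

Let q_gt0 : 0 < q.
Proof.
rewrite subr_gt0 expr_lt1 ?divr_ge0 ?enorm_ge0 ?(ltW r0)//.
by rewrite ltr_pdivrMr// mul1r.
Qed.

Let h y := K * (spow p (q `^ s - hsp s x q g y) * ker s p x y).
Let e y := K * (excess s p y0 r x y * ker s p x y).
Let phi y := spow p (u x - u y) * ker s p x y.
Let w y := h y + e y - phi y.

Let mC eps : measurable (C eps). Proof. exact: measurableC_eball. Qed.

Let mphi : measurable_fun [set: 'rV[R]_n.+1] phi.
Proof.
apply: measurable_funM; last exact: measurable_ker.
by apply: (measurableT_comp (measurable_spow _)); exact: measurable_funB.
Qed.

Let mh : measurable_fun [set: 'rV[R]_n.+1] h.
Proof.
apply: measurable_funM => //; apply: measurable_funM; last exact: measurable_ker.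
apply: (measurableT_comp (measurable_spow _)); apply: measurable_funB => //.
exact: measurable_hsp.
Qed.

Let me : measurable_fun [set: 'rV[R]_n.+1] e.
Proof.
apply: measurable_funM => //; apply: measurable_funM; last exact: measurable_ker.
exact: measurable_excess.
Qed.

Let e_ge0 y : 0 <= e y.
Proof. by rewrite !mulr_ge0 ?powR_ge0 ?excess_ge0 ?ker_ge0. Qed.

Let profile_spow y : spow p (k * (bar s y0 r x - bar s y0 r y)) * ker s p x y =
  h y + e y.
Proof.
rewrite spowM ?(ltW k0)// /h /e /excess -/q -/g.
have -> : bar s y0 r x = q `^ s by rewrite /bar ppowE// ltW.
by rewrite /K; ring.
Qed.

Let w_ge y : delta * \1_A y * ker s p x y <= w y.
Proof.
rewrite /w -profile_spow -mulrBl ler_wpM2r ?ker_ge0// indicE.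
have [/set_mem yA|_] := boolP (y \in A); last first.
  by rewrite mulr0 subr_ge0 spow_le.
by rewrite mulr1 lerBrDr addrC -lerBrDr gainA.
Qed.

Let w_ge0 y : 0 <= w y.
Proof. by apply: le_trans (w_ge y); rewrite !mulr_ge0 ?ker_ge0. Qed.

Let mw : measurable_fun [set: 'rV[R]_n.+1] w.
Proof. by apply: measurable_funB => //; exact: measurable_funD. Qed.

Let Emax := K * (@excess_const R n s p * r `^ (- (s * p))).

Let int_e eps : 0 < eps ->
  (\int[lebn]_(y in C eps) (e y)%:E <= Emax%:E)%E.
Proof.
move=> eps0; under eq_integral do rewrite EFinM.
rewrite ge0_integralZl//; last 3 first.
- apply/measurable_EFinP; apply: measurable_funTS.
  by apply: measurable_funM; [exact: measurable_excess|exact: measurable_ker].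
- by move=> y _; rewrite lee_fin mulr_ge0 ?excess_ge0 ?ker_ge0.
- by rewrite lee_fin powR_ge0.
rewrite [leRHS]EFinM; apply: lee_wpmul2l; first by rewrite lee_fin powR_ge0.
exact: integral_excess_le.
Qed.

Let intble_e eps : 0 < eps -> lebn.-integrable (C eps) (EFin \o e).
Proof.
move=> eps0; apply/integrableP; split.
  by apply/measurable_EFinP; exact: measurable_funTS.
rewrite (eq_integral (fun y => (e y)%:E)).
  by apply: le_lt_trans (int_e eps0) _; exact: ltry.
by move=> y _; rewrite /= ger0_norm.
Qed.

Let intble_h eps : 0 < eps -> lebn.-integrable (C eps) (EFin \o h).
Proof.
move=> eps0; rewrite (_ : _ \o _ = (fun y => K%:E *
    (spow p (q `^ s - hsp s x q g y) * ker s p x y)%:E)%E); last first.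
  by apply/funext => y; rewrite /= EFinM.
by apply: integrableZl => //; exact: integrable_hsp.
Qed.

Let H eps := (\int[lebn]_(y in C eps) (h y)%:E)%E.
Let E eps := (\int[lebn]_(y in C eps) (e y)%:E)%E.
Let W eps := (\int[lebn]_(y in C eps) (w y)%:E)%E.

Let JE eps : 0 < eps -> (\int[lebn]_(y in C eps) (phi y)%:E =
  H eps + E eps - W eps)%E.
Proof.
move=> eps0; rewrite /H /E -integralD//; [|exact: intble_h|exact: intble_e].
have := @integral_sub_ge0 _ _ R lebn (C eps) (fun y => h y + e y) w (mC eps).
move=> <-//.
- by apply: eq_integral => y _; congr EFin; rewrite /w; ring.
- rewrite (_ : _ \o _ = (EFin \o h) \+ (EFin \o e))%E; last first.
    by apply/funext => y; rewrite /= EFinD.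
  by apply: integrableD => //; [exact: intble_h|exact: intble_e].
- exact: measurable_funTS.
Qed.

Let C_anti eps eps' : eps <= eps' -> C eps' `<=` C eps.
Proof.
move=> le y; rewrite /C /eball/= => /negP; rewrite -leNgt => h1.
by apply/negP; rewrite -leNgt (le_trans le).
Qed.

Let norm_itv (a : \bar R) (c : R) : (`|a| <= c%:E)%E ->
  ((- c)%:E <= a <= c%:E)%E.
Proof. by case: a => //= a; rewrite !lee_fin ler_norml. Qed.

Let cvgH : H eps @[eps --> 0^'+] --> 0%E.
Proof.
pose B := K * ((2 `^ p + (s * p)^-1) *
  ((q `^ s) `^ (p - 1) * (enorm g / q) `^ p) * 4 ^+ n.+1).
have B0 : B * eps `^ (p - s * p) @[eps --> 0^'+] --> (0 : R).
  rewrite -[X in _ --> X](mulr0 B); apply: cvgMl_tmp.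
  by apply: powR_cvg0; rewrite subr_gt0 gtr_pMl.
have G1 : 0 < enorm g + 1 by rewrite ltr_wpDl ?enorm_ge0.
apply: (@squeeze_cvge _ _ _ _ (fun eps => (- (B * eps `^ (p - s * p)))%:E) _
    (fun eps => (B * eps `^ (p - s * p))%:E)).
- near=> eps; apply: norm_itv.
  have eps0 : 0 < eps by [].
  rewrite /H; under eq_integral do rewrite EFinM.
  rewrite integralZl//; last exact: integrable_hsp.
  rewrite abseM abse_EFin ger0_norm ?powR_ge0//.
  have -> : B * eps `^ (p - s * p) = K * ((2 `^ p + (s * p)^-1) *
      ((q `^ s) `^ (p - 1) * (enorm g / q) `^ p * eps `^ (p - s * p)) *
      4 ^+ n.+1) by rewrite /B; ring.
  rewrite [leRHS]EFinM; apply: lee_wpmul2l; first by rewrite lee_fin powR_ge0.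
  apply: halfspace_pv => //.
  apply: (@le_trans _ _ (2 * eps * (enorm g + 1))).
    by rewrite mulrA ler_wpM2l ?mulr_ge0 ?(ltW eps0)// lerDl.
  rewrite -ler_pdivlMr// mulrC -ler_pdivlMr//.
  by near: eps; apply: nbhs_right_le; rewrite divr_gt0 ?G1// divr_gt0.
- by rewrite -oppe0 -EFinN; apply: cvg_EFin; [exact: nearW|exact: cvgN].
- by apply: cvg_EFin; [exact: nearW|].
Unshelve. all: by end_near. Qed.

Let cvg_anti (f : 'rV[R]_n.+1 -> R) :
  measurable_fun [set: 'rV[R]_n.+1] f -> (forall y, 0 <= f y) ->
  let F eps := (\int[lebn]_(y in C eps) (f y)%:E)%E in
  F eps @[eps --> 0^'+] --> ereal_sup (F @` `]0, 1[%classic).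
Proof.
move=> mf f0 F; apply: nonincreasing_at_right_cvge; first by rewrite bnd_simp.
move=> a b _ _ ab; apply: ge0_subset_integral => //.
- by apply/measurable_EFinP; exact: measurable_funTS.
- by move=> y _; rewrite lee_fin.
- exact: C_anti.
Qed.

(** Touching makes the integrand of [u] at most that of the profile, because
    [spow] is monotone, with a gain of [delta] times the kernel on [A].  The principal value exists
    in the extended reals because the difference with the half-space profile is
    an integrable function minus a nonnegative one. *)
Lemma lim_touching (mu0 : R) : (mu0%:E <= \int[lebn]_(y in A) (ker s p x y)%:E)%E ->
  (lim (\int[lebn]_(y in ~` eball x eps)
      (spow p (u x - u y) * ker s p x y)%:E @[eps --> 0^'+]) <=
   (k `^ (p - 1) * (@excess_const R n s p * r `^ (- (s * p))) -
      delta * mu0)%:E)%E.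
Proof.
move=> mu0A.
have cE := cvg_anti me e_ge0; have cW := cvg_anti mw w_ge0.
move: cE cW; rewrite /= -/E -/W.
set E0 := ereal_sup (_ @` _); set W0 := ereal_sup (_ @` _) => cE cW.
have half01 : `]0, 1[%classic (2^-1 : R) by rewrite /= in_itv/=; lra.
have E0_le : (E0 <= Emax%:E)%E.
  apply: ge_ereal_sup => _ [eps + <-]; rewrite /= in_itv/= => /andP[eps0 _].
  exact: int_e.
have E0_ge0 : (0 <= E0)%E.
  apply: le_trans (ereal_sup_ubound _); last by exists 2^-1.
  by apply: integral_ge0 => y _; rewrite lee_fin.
have E0fin : E0 \is a fin_num.
  by rewrite ge0_fin_numE// (le_lt_trans E0_le)// ltry.
have W0_ge : ((delta * mu0)%:E <= W0)%E.
  pose eps := Num.min eps1 2^-1.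
  have eps0 : 0 < eps by rewrite lt_min eps10/=; lra.
  apply: (@le_trans _ _ (W eps)); last first.
    apply: ereal_sup_ubound; exists eps => //; rewrite /= in_itv/= eps0/=.
    by rewrite gt_min orbC; apply/orP; left; lra.
  apply: (@le_trans _ _ (\int[lebn]_(y in C eps) (delta * \1_A y * ker s p x y)%:E)%E).
    rewrite (eq_integral (fun y => delta%:E * (((fun y => (ker s p x y)%:E) \_ A) y))%E).
      rewrite ge0_integralZl//; last 2 first.
      - apply: measurable_funTS; apply/(measurable_restrictT _ _).1 => //.
        by apply/measurable_EFinP; apply: measurable_funTS; exact: measurable_ker.
      - by move=> y _; apply: erestrict_ge0 => z _; rewrite lee_fin ker_ge0.
      rewrite EFinM; apply: lee_wpmul2l; first by rewrite lee_fin.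
      apply: le_trans mu0A _; rewrite -integral_mkcondr.
      rewrite (_ : C eps `&` A = A)//; apply/setIidr => y Ay.
      rewrite /C /eball/=; apply/negP; rewrite -leNgt.
      by apply: le_trans (farA Ay); rewrite ge_min lexx.
    move=> y _; rewrite patchE indicE; case: ifP => _.
      by rewrite mulr1 EFinM.
    by rewrite mulr0 mul0r mule0.
  apply: ge0_le_integral => //.
  - by move=> y _; rewrite lee_fin !mulr_ge0 ?ker_ge0.
  - apply/measurable_EFinP; apply: measurable_funTS.
    apply: measurable_funM; last exact: measurable_ker.
    by apply: measurable_funM => //; exact: measurable_indic.
  - by apply/measurable_EFinP; exact: measurable_funTS.
  - by move=> y _; rewrite lee_fin.
have cJ : (\int[lebn]_(y in C eps) (phi y)%:E)%E @[eps --> 0^'+] -->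
    (0 + E0 - W0)%E.
  apply: (@cvg_trans _ ((H eps + E eps - W eps)%E @[eps --> 0^'+])).
    apply: near_eq_cvg; near=> eps; rewrite JE//.
  apply: cvgeB => //; first by rewrite add0e fin_num_adde_defr.
  by apply: cvgeD => //; rewrite fin_num_adde_defl.
rewrite (cvg_lim _ cJ)// add0e EFinB; exact: leeB.
Unshelve. all: by end_near. Qed.

End contact.

(** * Propagation of lower bounds *)

Section euclidean_topology.
Context {R : realType} {n : nat}.
Implicit Types x y z : 'rV[R]_n.

Lemma norm_le_enorm x : `|x| <= enorm x.
Proof.
rewrite [leLHS]/Num.norm/= mx_normrE; apply: bigmax_le => [|[i j] _]; first exact: enorm_ge0.
by rewrite /= (ord1 i); exact: coord_le_enorm.
Qed.

Lemma continuous_enormB x : continuous (fun y => enorm (y - x)).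
Proof.
suff h y : \sum_(i < n) (z - x) 0 i ^+ 2 @[z --> y] -->
    \sum_(i < n) (y - x) 0 i ^+ 2.
  by move=> y; rewrite /enorm; apply: (@continuous_comp 'rV[R]_n R R
    (fun y => \sum_(i < n) (y - x) 0 i ^+ 2) (@Num.sqrt R) y (h y));
    exact: sqrt_continuous.
have Ff : Filter (nbhs y) := nbhs_filter y.
have c i : (z - x) 0 i @[z --> y] --> (y - x) 0 i.
  under eq_cvg do rewrite !mxE.
  rewrite !mxE; apply: (@cvgB _ _ _ (nbhs y) Ff); last exact: cvg_cst.
  exact: coord_continuous.
elim: (index_enum 'I_n) => [|i l IHl].
  by rewrite big_nil; under eq_cvg do rewrite big_nil; exact: cvg_cst.
rewrite big_cons; under eq_cvg do rewrite big_cons expr2.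
by rewrite expr2; apply: (@cvgD _ _ _ (nbhs y) Ff) IHl; apply: cvgM; exact: c.
Qed.

Lemma open_eball x (r : R) : open (eball x r).
Proof.
rewrite (_ : eball x r = (fun y => enorm (y - x)) @^-1` [set t | t < r]).
  by apply: open_comp => [y _|]; [exact: continuous_enormB|exact: open_lt].
by apply/seteqP; split => y; rewrite /eball/= enormB.
Qed.

Lemma bounded_enorm x (r : R) (A : set 'rV[R]_n) :
  (forall y, A y -> enorm (y - x) <= r) -> bounded_set A.
Proof.
move=> Ar; exists (`|x| + r); split; first exact: num_real.
move=> M rM y Ay; apply: le_trans (ltW rM).
have -> : y = x + (y - x) by rewrite addrC subrK.
by apply: le_trans (ler_normD _ _) _; rewrite lerD2l (le_trans (norm_le_enorm _)) ?Ar.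
Qed.

End euclidean_topology.

Section propagation.
Context {R : realType} {n : nat}.
Local Notation lebn := (lebesgue_rV R n.+1).
Variables s p Cnsp : R.
Hypothesis s01 : 0 < s < 1.
Hypothesis p2 : 2 < p.
Hypothesis Cnsp0 : 0 < Cnsp.
Implicit Types x y : 'rV[R]_n.+1.

Let s0 : 0 < s. Proof. by case/andP: s01. Qed.
Let s1 : s < 1. Proof. by case/andP: s01. Qed.
Let p0 : 0 < p. Proof. by rewrite (lt_trans _ p2). Qed.
Let p10 : 0 < p - 1. Proof. by move: p2; lra. Qed.
Let p11 : 1 <= p - 1. Proof. by move: p2; lra. Qed.
Let sp0 : 0 < s * p. Proof. exact: mulr_gt0. Qed.
Let N : R := n.+1%:R + s * p.

Section touching_point.
Variables (u : 'rV[R]_n.+1 -> R) (y0 : 'rV[R]_n.+1) (r k : R).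
Hypothesis r0 : 0 < r.
Hypothesis k0 : 0 < k.
Hypothesis u_ge0 : forall y, 0 <= u y.
Hypothesis cu : forall y, eball y0 r y -> {for y, continuous u}.

Lemma ball_quad_gt0 y : 0 < ball_quad y0 r y -> eball y0 r y.
Proof.
rewrite /ball_quad subr_gt0 /eball/= enormB.
rewrite -{1}(expr1n _ 2) ltr_pXn2r ?nnegrE ?divr_ge0 ?enorm_ge0 ?(ltW r0)//.
by rewrite ltr_pdivrMr// mul1r.
Qed.

Let continuous_ball_quad : continuous (ball_quad y0 r).
Proof.
move=> y; have Ff : Filter (nbhs y) := nbhs_filter y.
have c : enorm (z - y0) / r @[z --> y] --> enorm (y - y0) / r.
  apply: (@cvgM _ _ (nbhs y) Ff); last exact: cvg_cst.
  exact: continuous_enormB.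
apply: (@cvgB _ _ _ (nbhs y) Ff); first exact: cvg_cst.
by rewrite expr2; under eq_cvg do rewrite expr2; apply: cvgM; exact: c.
Qed.

(** If [u] dips below the profile, then [u] minus the profile has a negative
    minimum over the whole space: near the sphere the profile is too small for
    [u >= 0] to be close to that minimum. *)
Lemma exists_touching x1 : u x1 < k * bar s y0 r x1 ->
  exists x, [/\ enorm (x - y0) < r, u x < k * bar s y0 r x &
    forall y, u x - u y <= k * (bar s y0 r x - bar s y0 r y)].
Proof.
move=> ux1; pose eta := k * bar s y0 r x1 - u x1.
have eta0 : 0 < eta by rewrite subr_gt0.
pose beta := (eta / k) `^ s^-1.
have beta0 : 0 < beta by rewrite powR_gt0// divr_gt0.
have betas : k * beta `^ s = eta.
  by rewrite /beta -powRrM mulVf ?gt_eqF// powRr1 ?divr_ge0 ?ltW// mulrC divfK// gt_eqF.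
pose S := [set y | beta <= ball_quad y0 r y].
(* [beta] is the depth below which the profile is smaller than the gap [eta]. *)
have small y : ball_quad y0 r y < beta -> k * bar s y0 r y < eta.
  move=> yb; rewrite -betas ltr_pM2l// /bar /ppow gt0_ltr_powR// ?nnegrE.
  - by rewrite le_max lexx.
  - exact: ltW.
  - by rewrite gt_max beta0.
have Sx1 : S x1.
  rewrite /S/= leNgt; apply/negP => /small; apply/negP; rewrite -leNgt.
  by rewrite gerBl.
have Sball y : S y -> enorm (y - y0) < r.
  by move=> Sy; rewrite enormB; apply: ball_quad_gt0; exact: lt_le_trans Sy.
have cS : compact S.
  apply: bounded_closed_compact.
    by apply: (@bounded_enorm _ _ y0 r) => y /Sball/ltW.
  rewrite (_ : S = ball_quad y0 r @^-1` [set t | beta <= t])//.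
  by apply: preimage_closed => [y _|]; [exact: continuous_ball_quad|exact: closed_ge].
have cf : {within S, continuous (fun y => u y - k * bar s y0 r y)}.
  apply: continuous_in_subspaceT => y; rewrite inE => Sy.
  have Ff : Filter (nbhs y) := nbhs_filter y.
  apply: (@cvgB _ _ _ (nbhs y) Ff); first by apply: cu; rewrite /eball/= enormB Sball.
  apply: (@cvgM _ _ (nbhs y) Ff); first exact: cvg_cst.
  have q0 : 0 < ball_quad y0 r y by exact: lt_le_trans Sy.
  apply: (@continuous_comp 'rV[R]_n.+1 R R (ball_quad y0 r) (ppow s)).
    exact: continuous_ball_quad.
  apply: (@cvg_trans _ (t `^ s @[t --> ball_quad y0 r y])).
    apply: near_eq_cvg; near=> t; rewrite ppowE// ltW//.
    by near: t; exact: lt_nbhsr.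
  by rewrite ppowE ?(ltW q0)//; exact: powR_continuous.
have [x] := EVT_min_rV (ex_intro _ x1 Sx1) cS cf.
rewrite inE => Sx xmin.
have xx1 : u x - k * bar s y0 r x <= - eta.
  by apply: le_trans (xmin x1 (mem_set Sx1)) _; rewrite /eta opprB.
exists x; split; first exact: Sball.
  by move: xx1; rewrite lerBlDr => h; apply: le_lt_trans h _; rewrite gtrDr oppr_lt0.
move=> y; have [Sy|] := boolP (y \in S).
  by rewrite mulrBr lerBlDr addrAC -addrA -lerBlDl; exact: xmin.
rewrite notin_setE/= => /negP; rewrite -ltNge => /small h.
rewrite mulrBr lerBlDr addrAC -addrA -lerBlDl.
apply: le_trans xx1 _; rewrite -[leLHS]add0r; apply: lerD => //.
by rewrite lerN2 ltW.
Unshelve. all: by end_near. Qed.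

End touching_point.


Let ball_mass : R := (10 `^ N)^-1 * ((4 * n.+1%:R) ^+ n.+1)^-1.

Let ball_mass_gt0 : 0 < ball_mass.
Proof.
by rewrite /ball_mass mulr_gt0// invr_gt0 ?powR_gt0 ?exprn_gt0// mulr_gt0.
Qed.

Let integral_ker_ball x a (r : R) : 0 < r -> enorm (x - a) <= 9 * r ->
  (forall y, eball a (r / 8) y -> r / 8 <= enorm (x - y)) ->
  ((ball_mass * r `^ (- (s * p)))%:E <=
    \int[lebn]_(y in eball a (r / 8)) (ker s p x y)%:E)%E.
Proof.
move=> r0 xa farA; have r80 : 0 < r / 8 by rewrite divr_gt0.
have N0 : 0 <= N by rewrite addr_ge0// ltW.
pose K := (10 * r) `^ N; have K0 : 0 < K by rewrite powR_gt0// mulr_gt0.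
apply: (@le_trans _ _ (\int[lebn]_(y in eball a (r / 8)) (K^-1)%:E)%E); last first.
  apply: ge0_le_integral => //.
  - exact: measurable_eball.
  - by move=> y _; rewrite lee_fin invr_ge0 ltW.
  - by apply/measurable_EFinP; apply: measurable_funTS; exact: measurable_ker.
  move=> y ay; rewrite lee_fin /ker.
  have xy := farA y ay.
  have xy0 : 0 < enorm (x - y) by exact: lt_le_trans xy.
  have r10 : 0 < 10 * r by rewrite mulr_gt0.
  rewrite /K lef_pV2 ?posrE ?powR_gt0// ge0_ler_powR ?nnegrE ?enorm_ge0 ?(ltW r10)//.
  have := enorm_dist_tri a x y; move: ay xa; rewrite /eball/=; lra.
rewrite integral_cst; last exact: measurable_eball.
apply: (@le_trans _ _ (K^-1%:E * ((2 * (r / 8 / n.+1%:R)) ^+ n.+1)%:E)%E).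
  rewrite -EFinM lee_fin /ball_mass /K powRM ?(ltW r0)//.
  have rN : r `^ N = r ^+ n.+1 * r `^ (s * p).
    by rewrite /N powRD ?(gt_eqF r0) ?implybT// powR_mulrn// ltW.
  rewrite powRN rN.
  rewrite le_eqVlt; apply/orP; left; apply/eqP.
  have -> : 2 * (r / 8 / n.+1%:R) = r * (4 * n.+1%:R)^-1 :> R.
    by have := ltr0Sn R n; move: n.+1%:R => j /gt_eqF j0; field; rewrite j0.
  rewrite expr_div_n.
  have /gt_eqF := powR_gt0 (s * p) r0; have /gt_eqF := exprn_gt0 n.+1 r0.
  have /gt_eqF : 0 < (4 * n.+1%:R : R) ^+ n.+1 by rewrite exprn_gt0// mulr_gt0.
  have /gt_eqF : 0 < (10 : R) `^ N by rewrite powR_gt0.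
  move: (_ `^ N) (_ ^+ _) (r ^+ _) (r `^ _) => b c d e b0 c0 d0 e0.
  by field; rewrite b0 c0 d0 e0.
by apply: lee_wpmul2l; [rewrite lee_fin invr_ge0 ltW|exact: lebesgue_rV_eball_ge].
Qed.

(** At a touching point the mass seen in the ball around [a] costs a multiple of
    [m ^ (p - 1)], while the scaled profile contributes only a multiple of
    [(theta * m) ^ (p - 1)]; the zero-order term is absorbed through the bound on
    [M].  All terms carry the factor [r ^ (- s p)], so [theta] serves all balls. *)
Lemma bar_propagation (Lam : R) : 0 <= Lam -> exists2 theta, 0 < theta &
  forall (u : 'rV[R]_n.+1 -> R) y0 a (r m M : R),
  measurable_fun [set: 'rV[R]_n.+1] u -> (forall y, 0 <= u y) ->
  0 < r -> 0 < m -> 0 <= M -> M * r `^ (s * p) <= Lam * m `^ (p - 2) ->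
  (forall y, eball y0 r y -> {for y, continuous u}) ->
  (forall y, eball y0 r y ->
    (0 <= frac_plaplacian s p Cnsp u y + (M * u y)%:E)%E) ->
  enorm (a - y0) <= 8 * r -> (forall y, eball a (r / 4) y -> m <= u y) ->
  forall y, theta * m * bar s y0 r y <= u y.
Proof.
move=> Lam0.
pose EC := @excess_const R n s p.
have EC0 : 0 <= EC := excess_const_ge0 s01 p2.
pose h := 2^-1 `^ (p - 1) : R.
have h0 : 0 < h by rewrite powR_gt0// invr_gt0.
pose D := Cnsp * (EC + ball_mass) + Lam.
have D0 : 0 <= D by rewrite addr_ge0// mulr_ge0 ?addr_ge0 ?(ltW Cnsp0) ?(ltW ball_mass_gt0).
pose B := Cnsp * ball_mass * h.
have B0 : 0 < B by rewrite !mulr_gt0.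
pose theta := Num.min 4^-1 (B / (2 * (D + 1))).
have D1 : 0 < D + 1 by lra.
have theta0 : 0 < theta by rewrite lt_min invr_gt0 ltr0n divr_gt0// mulr_gt0.
have theta4 : theta <= 4^-1 by rewrite ge_min lexx.
(* [B] is the gain from the ball around [a] and [D] collects the losses, which
   are linear in [theta] since [theta ^ (p - 1) <= theta]. *)
have thetaD : theta * D < B.
  have t1 : theta <= B / (2 * (D + 1)) by rewrite ge_min lexx orbT.
  move: t1; rewrite ler_pdivlMr ?mulr_gt0// => t1.
  have : 0 <= theta * D by rewrite mulr_ge0// ltW.
  by move: t1; lra.
exists theta => // u y0 a r m M mu u0 r0 m0 M0 MLam cu eqn ay0 um y.
rewrite leNgt; apply/negP => uy.
have k0 : 0 < theta * m by rewrite mulr_gt0.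
have [x [xr ux touch]] := exists_touching r0 k0 u0 cu uy.
set k := theta * m in k0 ux touch uy.
have km : k <= m / 4 by rewrite /k mulrC ler_pM2l.
have b1 z := bar_le1 s01 y0 r z.
have b0 z : 0 <= bar s y0 r z by exact: ppow_ge0.
have uxk : u x < k.
  by apply: lt_le_trans ux _; rewrite -[leRHS]mulr1 ler_pM2l.
have xa : r / 4 <= enorm (x - a).
  by rewrite leNgt enormB; apply/negP => /um; lra.
have xa9 : enorm (x - a) <= 9 * r.
  by have := enorm_dist_tri y0 x a; rewrite (enormB y0); lra.
(* The set that pays is the half of the ball around [a], to stay away from [x]. *)
have farA z : eball a (r / 8) z -> r / 8 <= enorm (x - z).
  by have := enorm_dist_tri z x a; rewrite /eball/= (enormB z); lra.
have p1p0 : 0 <= p - 1 by exact: ltW.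
pose delta := (m / 2) `^ (p - 1) - k `^ (p - 1).
have delta0 : 0 <= delta.
  have [m20 km2] : 0 <= m / 2 /\ k <= m / 2 by move: km m0; clear; split; lra.
  by rewrite subr_ge0 ge0_ler_powR ?nnegrE ?(ltW k0).
have gainA z : eball a (r / 8) z ->
    spow p (u x - u z) <= spow p (k * (bar s y0 r x - bar s y0 r z)) - delta.
  move=> za; have mz : m <= u z.
    by apply: um; move: za; rewrite /eball/=; lra.
  apply: (@le_trans _ _ (spow p (- (m / 2)))); first by apply: spow_le => //; lra.
  rewrite spowN spowE//; last lra.
  have : spow p (- k) <= spow p (k * (bar s y0 r x - bar s y0 r z)).
    apply: spow_le => //; rewrite -[leLHS]mulrN1 ler_pM2l//.
    by rewrite lerBrDr (le_trans _ (b0 x))// addrC subr_le0.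
  rewrite spowN spowE ?(ltW k0)// /delta; lra.
have r80 : 0 < r / 8 by rewrite divr_gt0.
have := lim_touching s01 p2 r0 xr mu k0 touch (measurable_eball a (r / 8))
  delta0 r80 farA gainA (integral_ker_ball r0 xa9 farA).
set L := lim _ => Lle.
have : (0 <= Cnsp%:E * L + (M * u x)%:E)%E.
  by apply: eqn; rewrite /eball/= enormB.
apply/negP; rewrite -ltNge.
have Cle : (Cnsp%:E * L <= Cnsp%:E *
    (k `^ (p - 1) * (EC * r `^ (- (s * p))) -
      delta * (ball_mass * r `^ (- (s * p))))%:E)%E.
  by apply: lee_wpmul2l => //; rewrite lee_fin ltW.
apply: le_lt_trans (leeD2r _ Cle) _; rewrite -EFinM -EFinD lte_fin.
set rho := r `^ (- (s * p)).
have rho0 : 0 < rho by rewrite powR_gt0.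
pose P := m `^ (p - 1).
have P0 : 0 < P by rewrite powR_gt0.
have kP : k `^ (p - 1) <= theta * P.
  rewrite /k powRM ?(ltW theta0) ?(ltW m0)// ler_pM2r//.
  rewrite -[leRHS]powRr1 ?(ltW theta0)// ger_powR// theta0/=.
  by apply: le_trans theta4 _; lra.
have mP : (m / 2) `^ (p - 1) = h * P.
  by rewrite mulrC powRM ?invr_ge0 ?(ltW m0)//.
have MP : M * u x <= Lam * theta * P * rho.
  apply: (@le_trans _ _ (M * k)); first by rewrite ler_wpM2l// ltW.
  have rr : r `^ (s * p) * rho = 1.
    by rewrite /rho powRN mulfV// gt_eqF// powR_gt0.
  have mm : m * m `^ (p - 2) = P.
    rewrite /P -(@mulr_powRB1 _ m (p - 1)) ?(ltW m0)//.
    by congr (_ * _ `^ _); ring.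
  have -> : M * k = M * r `^ (s * p) * (rho * theta * m).
    by rewrite -[LHS]mulr1 -rr /k; ring.
  have -> : Lam * theta * P * rho = Lam * m `^ (p - 2) * (rho * theta * m).
    by rewrite -mm; ring.
  by rewrite ler_pM2r// !mulr_gt0.
rewrite /delta mP.
have H1 : Cnsp * (k `^ (p - 1) * (EC * rho) - (h * P - k `^ (p - 1)) * (ball_mass * rho))
   <= (theta * (Cnsp * (EC + ball_mass)) - B) * (P * rho).
  have : 0 <= (theta * P - k `^ (p - 1)) * (Cnsp * (EC + ball_mass) * rho).
    by rewrite !mulr_ge0 ?subr_ge0 ?addr_ge0 ?(ltW Cnsp0) ?(ltW ball_mass_gt0) ?(ltW rho0).
  by rewrite /B; lra.
have : (theta * D - B) * (P * rho) < 0 by rewrite pmulr_llt0 ?subr_lt0// mulr_gt0.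
by rewrite /D; lra.
Qed.

End propagation.

(** * Distance to the boundary *)

Section boundary_distance.
Context {R : realType} {n : nat}.
Implicit Types (x y z : 'rV[R]_n) (A Omega : set 'rV[R]_n).

Lemma nbhs_eball x A : nbhs x A -> exists2 e : R, 0 < e & eball x e `<=` A.
Proof.
move=> /nbhs_ballP[e e0 xA]; exists e => // y xy; apply: xA.
rewrite -ball_normE/=; exact: le_lt_trans (norm_le_enorm _) xy.
Qed.

Lemma eball_nbhs x (e : R) : 0 < e -> nbhs x (eball x e).
Proof.
move=> e0; apply: open_nbhs_nbhs; split; first exact: open_eball.
by rewrite /eball/= subrr enorm0.
Qed.

Lemma dist_set_le x z A : A z -> dist_set x A <= enorm (x - z).
Proof.
move=> Az; apply: ge_inf; last by exists z.
by exists 0 => _ [y _ <-]; exact: enorm_ge0.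
Qed.

Lemma le_dist_set x A (e : R) : A !=set0 ->
  (forall z, A z -> e <= enorm (x - z)) -> e <= dist_set x A.
Proof.
move=> [z Az] h; apply: lb_le_inf; first by exists (enorm (x - z)), z.
by move=> _ [y Ay <-]; exact: h.
Qed.

Lemma dist_set_lt x A (e : R) : A !=set0 -> dist_set x A < e ->
  exists2 z, A z & enorm (x - z) < e.
Proof.
move=> [z Az] /inf_lt[|_ [y Ay <-] ye]; last by exists y.
by exists (enorm (x - z)), z.
Qed.

Lemma boundary_openN Omega z : open Omega -> boundary Omega z -> ~ Omega z.
Proof. by move=> /interior_id {2}<- []. Qed.

Lemma boundary_eball y (r : R) z : boundary (eball y r) z -> enorm (y - z) = r.
Proof.
move=> zb; apply/eqP; rewrite eq_le; apply/andP; split.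
  rewrite leNgt; apply/negP => rz.
  have e0 : 0 < enorm (y - z) - r by rewrite subr_gt0.
  have [w []] := zb.1 _ (eball_nbhs z e0).
  have := enorm_dist_tri w y z; rewrite /eball/= (enormB w); lra.
rewrite leNgt; apply/negP => zr.
exact: (boundary_openN (@open_eball _ _ y r) zb).
Qed.

(** The infimum of the outside times on the segment is itself an outside time,
    as [Omega] is open, and a limit of inside times. *)
Lemma boundary_crossing Omega x y : open Omega -> Omega x -> ~ Omega y ->
  exists2 z, boundary Omega z & enorm (x - z) <= enorm (x - y).
Proof.
move=> oO Ox Oy; pose f (t : R) := x + t *: (y - x).
pose T := [set t : R | 0 <= t <= 1 /\ ~ Omega (f t)].
have T1 : T 1 by split; [rewrite ler01 lexx|rewrite /f scale1r addrC subrK].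
have lT : lbound T 0 by move=> t [/andP[]].
have hT : has_inf T by split; [exists 1|exists 0].
pose t0 := inf T.
have t00 : 0 <= t0 by apply: lb_le_inf => //; exists 1.
have t01 : t0 <= 1 by apply: ge_inf => //; exists 0.
have df t t' : enorm (f t - f t') = `|t - t'| * enorm (y - x).
  by rewrite /f opprD addrACA subrr add0r -scalerBl enormZ.
have l0 : 0 < enorm (y - x) + 1 by rewrite ltr_wpDl ?enorm_ge0.
have small e t t' : 0 < e -> `|t - t'| < e / (enorm (y - x) + 1) ->
    eball (f t') e (f t).
  move=> e0; rewrite ltr_pdivlMr// mulrDr mulr1 /eball/= df distrC.
  by have := normr_ge0 (t' - t); lra.
have nO : ~ Omega (f t0).
  move=> Of; have [e e0 fe] := nbhs_eball (open_nbhs_nbhs (conj oO Of)).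
  have d0 : 0 < e / (enorm (y - x) + 1) by rewrite divr_gt0.
  have [t [t01' nt] tt0] := inf_adherent d0 hT.
  apply: (nt); apply: fe; apply: small => //.
  have : t0 <= t by apply: ge_inf; [exists 0|split].
  by move: tt0; rewrite -/t0 => ? ?; rewrite ger0_norm; lra.
have t0_gt0 : 0 < t0.
  rewrite lt_neqAle t00 andbT; apply/eqP => t0E; apply: nO.
  by rewrite -t0E /f scale0r addr0.
exists (f t0); last first.
  have -> : x = f 0 by rewrite /f scale0r addr0.
  rewrite df sub0r normrN ger0_norm// /f scale0r addr0 (enormB x).
  by rewrite ler_piMl ?enorm_ge0.
split; last by move=> /interior_subset.
move=> B /nbhs_eball[e e0 fB].
have d0 : 0 < e / (enorm (y - x) + 1) by rewrite divr_gt0.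
pose t := Num.max 0 (t0 - e / (enorm (y - x) + 1) / 2).
have tt0 : t < t0 by rewrite gt_max t0_gt0/= ltrBlDr ltrDl divr_gt0.
have tge0 : 0 <= t by rewrite le_max lexx.
exists (f t); split.
  apply: contrapT => nt; suff : t0 <= t by rewrite leNgt tt0.
  by apply: ge_inf; [exists 0|split => //; rewrite tge0/=; lra].
apply: fB; apply: small => //.
have : t0 - e / (enorm (y - x) + 1) / 2 <= t by rewrite le_max lexx orbT.
by rewrite distrC ger0_norm; lra.
Qed.

Lemma eball_dist_boundary Omega x : open Omega -> Omega x ->
  eball x (dist_set x (boundary Omega)) `<=` Omega.
Proof.
move=> oO Ox y xy; apply: contrapT => Oy.
have [z bz zy] := boundary_crossing oO Ox Oy.
by have := dist_set_le x bz; move: xy; rewrite /eball/=; lra.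
Qed.

Lemma dist_boundary_gt0 Omega x : open Omega -> Omega x ->
  boundary Omega !=set0 -> 0 < dist_set x (boundary Omega).
Proof.
move=> oO Ox b0.
have [e e0 xe] := nbhs_eball (open_nbhs_nbhs (conj oO Ox)).
apply: lt_le_trans e0 _; apply: le_dist_set => // z bz.
rewrite leNgt; apply/negP => /xe; exact: boundary_openN bz.
Qed.

Lemma compact_eroded Omega (rho : R) : 0 < rho -> bounded_set Omega ->
  compact [set y | eball y rho `<=` Omega].
Proof.
move=> rho0 bO; apply: bounded_closed_compact.
  have [M [rM OM]] := bO; exists M; split=> // N MN y yO; apply: (OM _ MN).
  by apply: yO; rewrite /eball/= subrr enorm0.
move=> y cy w yw.
have e0 : 0 < rho - enorm (y - w) by rewrite subr_gt0.
have [y' [y'O yy']] := cy _ (eball_nbhs y e0).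
apply: y'O; move: yy'; have := enorm_dist_tri y y' w.
by rewrite /eball/= (enormB y' y); lra.
Qed.

End boundary_distance.

Lemma bounded_setN0 {R : realType} {n : nat} (A : set 'rV[R]_n.+1) :
  bounded_set A -> exists y, ~ A y.
Proof.
move=> [M [_ AM]]; exists (const_mx (`|M| + 2)) => Ay.
have MM : M < `|M| + 1 by have := ler_norm M; lra.
have := AM _ MM _ Ay; apply/negP; rewrite -ltNge.
rewrite [ltRHS]/Num.norm/= mx_normrE.
apply: lt_le_trans (le_bigmax _ _ (ord0, ord0)).
by rewrite /= mxE (@ger0_norm _ (`|M| + 2)) ?addr_ge0//; lra.
Qed.

(** * Growth at the boundary *)

Lemma ball_quad_center {R : realType} {n : nat} (x : 'rV[R]_n.+1) (r : R) :
  ball_quad x r x = 1.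
Proof. by rewrite /ball_quad subrr enorm0 mul0r expr0n subr0. Qed.

(** With [q] the distance to the centre over [r], [1 - q ^ 2 >= 1 - q], and
    [1 - q] is the depth over [r]. *)
Lemma bar_ge {R : realType} {n : nat} (s r d : R) (y0 y : 'rV[R]_n.+1) :
  0 <= s -> 0 < r -> 0 <= d -> enorm (y - y0) <= r - d ->
  (d / r) `^ s <= bar s y0 r y.
Proof.
move=> s0 r0 d0 yd; have dr0 : 0 <= d / r by rewrite divr_ge0// ltW.
rewrite -(ppowE s dr0); apply: ppow_le => //; rewrite /ball_quad.
set q := enorm (y - y0) / r.
have q0 : 0 <= q by rewrite divr_ge0 ?enorm_ge0 ?ltW.
have q1 : q <= 1 - d / r.
  by rewrite /q ler_pdivrMr// mulrBl mul1r divfK ?gt_eqF.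
have : q * q <= 1 * q by rewrite ler_wpM2r//; lra.
by rewrite expr2; lra.
Qed.

Section growth.
Context {R : realType} {n : nat}.
Variables (s p Cnsp M : R) (Omega : set 'rV[R]_n.+1) (u : 'rV[R]_n.+1 -> R).
Hypothesis s01 : 0 < s < 1.
Hypothesis p2 : 2 < p.
Hypothesis Cnsp0 : 0 < Cnsp.
Hypothesis M0 : 0 <= M.
Hypothesis oO : open Omega.
Hypothesis bO : bounded_set Omega.
Hypothesis mu : measurable_fun [set: 'rV[R]_n.+1] u.
Hypothesis cu : forall y, Omega y -> {for y, continuous u}.
Hypothesis u_ge0 : forall y, 0 <= u y.
Hypothesis u_gt0 : forall y, Omega y -> 0 < u y.
Hypothesis eqn : forall y, Omega y ->
  (0 <= frac_plaplacian s p Cnsp u y + (M * u y)%:E)%E.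

Let s0 : 0 < s. Proof. by case/andP: s01. Qed.
Let p0 : 0 < p. Proof. by rewrite (lt_trans _ p2). Qed.
Let p20 : 0 < p - 2. Proof. by rewrite subr_gt0. Qed.

Let deep_lower_bound (rho : R) : 0 < rho -> exists2 m : R, 0 < m &
  forall y, eball y rho `<=` Omega -> m <= u y.
Proof.
move=> rho0; pose K := [set y | eball y rho `<=` Omega].
have KO y : K y -> Omega y by apply; rewrite /eball/= subrr enorm0.
have [K0|nK] := pselect (K !=set0); last first.
  by exists 1 => // y yO; exfalso; apply: nK; exists y.
have cK : {within K, continuous u}.
  by apply: continuous_in_subspaceT => y; rewrite inE => /KO/cu.
have [y] := EVT_min_rV K0 (compact_eroded rho0 bO) cK.
rewrite inE => Ky ymin; exists (u y); first exact/u_gt0/KO.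
by move=> z Kz; apply: ymin; rewrite inE.
Qed.

(** Interior balls of a common radius share the lower bound of [u] at a fixed
    depth, which propagates to their spheres. *)
Let profile_below (rho : R) : 0 < rho -> exists2 c : R, 0 < c &
  forall y0, eball y0 rho `<=` Omega -> forall y, c * bar s y0 rho y <= u y.
Proof.
move=> rho0; have rho20 : 0 < rho / 2 by rewrite divr_gt0.
have [m m0 um] := deep_lower_bound rho20.
have mp0 : 0 < m `^ (p - 2) by rewrite powR_gt0.
pose Lam := M * rho `^ (s * p) / m `^ (p - 2).
have Lam0 : 0 <= Lam.
  by rewrite divr_ge0 ?mulr_ge0 ?powR_ge0.
have [theta theta0 prop] := @bar_propagation R n s p Cnsp s01 p2 Cnsp0 Lam Lam0.
exists (theta * m); first exact: mulr_gt0.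
move=> y0 y0O; apply: (prop u y0 y0 rho m M) => //.
- by rewrite /Lam divfK ?gt_eqF.
- by move=> y /y0O; exact: cu.
- by move=> y /y0O; exact: eqn.
- by rewrite subrr enorm0 mulr_ge0// ltW.
move=> y yy0; apply: um => z zy; apply: y0O.
have := enorm_dist_tri y y0 z; move: yy0 zy; rewrite /eball/=; lra.
Qed.

(** Close to the boundary, the profile of an interior ball is comparable to
    the power [s] of the distance on a ball of radius [d] within [4 d] of the
    given point, and one more propagation carries this to the point itself,
    even though it need not lie in an interior ball. *)
Lemma boundary_growth (rho : R) : 0 < rho -> boundary Omega !=set0 ->
  (forall z, boundary Omega z ->
    exists y, eball y rho `<=` Omega /\ boundary (eball y rho) z) ->
  exists2 C : R, 0 < C & exists2 delta : R, 0 < delta &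
    forall x, Omega x -> dist_set x (boundary Omega) < delta ->
      C * dist_set x (boundary Omega) `^ s <= u x.
Proof.
move=> rho0 b0 ball; have [c c0 uc] := profile_below rho0.
have rs0 : 0 < rho `^ s by rewrite powR_gt0.
pose c1 := c / rho `^ s; have c10 : 0 < c1 by rewrite divr_gt0.
have c1p : 0 < c1 `^ (p - 2) by rewrite powR_gt0.
have Lam0 : 0 <= M / c1 `^ (p - 2) by rewrite divr_ge0// ltW.
have [theta theta0 prop] := @bar_propagation R n s p Cnsp s01 p2 Cnsp0 _ Lam0.
exists (theta * c1); first exact: mulr_gt0.
exists (Num.min 1 (rho / 2)); first by rewrite lt_min ltr01 divr_gt0.
move=> x Ox; set d := dist_set x _; rewrite lt_min => /andP[d1 drho].
have d0 : 0 < d by exact: dist_boundary_gt0.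
have xO : eball x d `<=` Omega by exact: eball_dist_boundary.
have [|z bz xz] := @dist_set_lt _ _ x (boundary Omega) (2 * d) b0.
  by rewrite -/d; lra.
have [y0 [y0O /boundary_eball y0z]] := ball z bz.
pose t := 2 * d / rho; pose a := z + t *: (y0 - z).
have t0 : 0 <= t by rewrite divr_ge0 ?ltW// mulr_gt0.
have t1 : t <= 1 by rewrite ler_pdivrMr//; lra.
have trho : t * rho = 2 * d by rewrite divfK ?gt_eqF.
have az : enorm (a - z) = 2 * d.
  by rewrite /a addrC addKr enormZ ger0_norm// y0z.
have ay0 : enorm (a - y0) = rho - 2 * d.
  have -> : a - y0 = (1 - t) *: (z - y0).
    by rewrite scalerBl scale1r -scalerN opprB /a addrAC.
  by rewrite enormZ ger0_norm ?subr_ge0// enormB y0z mulrBl mul1r trho.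
(* [a] lies at depth [2 d] in the interior ball, so the points of the small ball
   around it have depth at least [d]. *)
have ua w : eball a (d / 4) w -> c1 * d `^ s <= u w.
  rewrite /eball/= => aw; apply: le_trans (uc y0 y0O w).
  rewrite /c1 mulrAC -mulrA ler_pM2l//.
  have dr : d `^ s / rho `^ s = (d / rho) `^ s.
    rewrite powRM ?invr_ge0 ?(ltW d0) ?(ltW rho0)//; congr (_ * _).
    by rewrite -[in RHS]powR_inv1 ?(ltW rho0)// powRAC powR_inv1// powR_ge0.
  rewrite dr; apply: bar_ge => //; [exact: ltW|exact: ltW|].
  by have := enorm_dist_tri a w y0; rewrite ay0 (enormB w a); lra.
have -> : theta * c1 * d `^ s = theta * (c1 * d `^ s) * bar s x d x.
  by rewrite /bar ball_quad_center ppowE// powR1 mulr1 -mulrA.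
apply: (prop u x a d (c1 * d `^ s) M) => //.
- by rewrite mulr_gt0// powR_gt0.
- rewrite powRM ?(ltW c10) ?powR_ge0// mulrA divfK ?gt_eqF//.
  rewrite ler_wpM2l// -powRrM ger_powR ?d0 ?ltW//.
  by rewrite ltr_pM2l//; lra.
- by move=> y /xO; exact: cu.
- by move=> y /xO; exact: eqn.
have := enorm_dist_tri z a x; rewrite az (enormB z x); lra.
Qed.

End growth.

Unset Implicit Arguments.
Set Strict Implicit.

(* MathComp-Analysis *)
Theorem theorem2 (R : realType) (n : nat) (s p Cnsp : R)
    (Omega : set 'rV[R]_n) (u : 'rV[R]_n -> R)
    (n_gt0 : (0 < n)%N) (s_range : 0 < s < 1) (p_gt2 : 2 < p)
    (Cnsp_gt0 : 0 < Cnsp)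
    (Omega_open : open Omega) (Omega_connected : connected Omega)
    (Omega_nonempty : Omega !=set0) (Omega_bounded : bounded_set Omega)
    (Omega_ball : uniform_interior_ball Omega)
    (u_C11 : C11_loc Omega u) (u_Lsp : Lsp s p u)
    (u_lsc : lower_semicontinuous
               (fun x : subspace (closure Omega) => (u x)%:E))
    (u_gt0 : forall x, Omega x -> 0 < u x)
    (u_eq0 : forall x, ~ Omega x -> u x = 0) :
  exists2 C : R, 0 < C &
    forall c : 'rV[R]_n -> R,
      [bounded c x | x in Omega] ->
      (forall x, Omega x -> 0 <= c x) ->
      (forall x, Omega x ->
         (0 <= frac_plaplacian s p Cnsp u x + (c x * u x)%:E)%E) ->
      (C%:E <= limf_einf
                 (fun x => (u x / dist_set x (boundary Omega) `^ s)%:E)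
                 (to_boundary Omega))%E.
Proof.
case: n => [//|n] in Omega u n_gt0 Omega_open Omega_connected Omega_nonempty
  Omega_bounded Omega_ball u_C11 u_Lsp u_lsc u_gt0 u_eq0 *.
(* The constant may not depend on [c]; the conclusion does not mention [c], so
   the bound obtained from one admissible coefficient serves them all. *)
have [[c0 [c0b c00 c0eqn]]|noc] := pselect (exists c : 'rV[R]_n.+1 -> R,
  [/\ [bounded c x | x in Omega], forall x, Omega x -> 0 <= c x &
    forall x, Omega x ->
      (0 <= frac_plaplacian s p Cnsp u x + (c x * u x)%:E)%E]); last first.
  by exists 1 => // c cb c0 ceqn; exfalso; apply: noc; exists c.
have u_ge0 x : 0 <= u x.
  by have [/u_gt0/ltW//|/u_eq0->] := pselect (Omega x).
have [M M0 cM] : exists2 M, 0 <= M & forall x, Omega x -> c0 x <= M.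
  have [M [_ cM]] := c0b; exists (`|M| + 1); first exact: addr_ge0.
  move=> x Ox; apply: le_trans (ler_norm _) _; apply: cM => //.
  by apply: le_lt_trans (ler_norm M) _; rewrite ltrDl.
have b0 : boundary Omega !=set0.
  have [x Ox] := Omega_nonempty; have [y Oy] := bounded_setN0 Omega_bounded.
  by have [z bz _] := boundary_crossing Omega_open Ox Oy; exists z.
have cu y : Omega y -> {for y, continuous u}.
  by move=> /u_C11[/differentiable_continuous].
have eqn y : Omega y -> (0 <= frac_plaplacian s p Cnsp u y + (M * u y)%:E)%E.
  move=> Oy; apply: le_trans (c0eqn y Oy) _; apply: leeD2l.
  by rewrite lee_fin ler_wpM2r// cM.
have [rho rho0 ball] := Omega_ball.
have [C C0 [delta delta0 growth]] := boundary_growth s_range p_gt2 Cnsp_gt0 M0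
  Omega_open Omega_bounded u_Lsp.1.1 cu u_ge0 u_gt0 eqn rho0 b0 ball.
exists C => // c _ _ _; rewrite limf_einfE.
apply: le_trans (ereal_sup_ubound _); last first.
  exists [set x | Omega x /\ dist_set x (boundary Omega) < delta] => //.
  by exists delta.
apply: le_ereal_inf_tmp => _ [x [Ox xd] <-]; rewrite lee_fin.
rewrite ler_pdivlMr; first exact: growth.
by rewrite powR_gt0// dist_boundary_gt0.
Qed.
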